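(* Let $T_A$ be the rearrangement group of the Airplane limit space and let $\varepsilon\in T_A$ be the element described in the context. Then $T_A=[T_A,T_A]\rtimes\langle\varepsilon\rangle$ (internal semidirect product).
   Context: The Airplane rearrangement group $T_A$. Graphs are finite directed multigraphs with edges coloured red or blue. The base graph $\Gamma$ has vertices $l,a,b,r$, blue edges $e_L:a\to l$ and $e_R:b\to r$, and red edges $e_U:b\to a$ and $e_D:a\to b$. Replacement rules: a red edge from $v_i$ to $v_t$ is replaced by the graph with vertices $v_i,v_t$ and two new vertices $m,w$, with red edges $\mathsf r_1:v_i\to m$, $\mathsf r_2:m\to v_t$ and a blue edge $\mathsf s:m\to w$; a blue edge from $v_i$ to $v_t$ is replaced by the graph with vertices $v_i,v_t$ and two new vertices $x,y$, with blue edges $\mathsf b_-:x\to v_i$, $\mathsf b_+:y\to v_t$ and red edges $\mathsf u:y\to x$, $\mathsf d:x\to y$. An expansion is any graph obtained from $\Gamma$ by finitely many (possibly zero) replacements of single edges. Each edge of an expansion is named by the finite word $e_0e_1\cdots e_k$ recording the edge $e_0$ of $\Gamma$ from which it descends and the successive edges of replacement graphs. Let $\Gamma_0=\Gamma$, and let $\Gamma_{n+1}$ be obtained from $\Gamma_n$ by replacing every edge. Let $\Omega$ be the set of infinite words all of whose finite nonempty prefixes name edges (topologized as a subspace of a product of finite discrete sets). Two such words $e_0e_1\cdots$ and $f_0f_1\cdots$ are equivalent if for every $n$ the edges $e_0\cdots e_n$ and $f_0\cdots f_n$ of $\Gamma_n$ share at least one vertex; this is an equivalence relation, and the Airplane limit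 space $A$ is the quotient of $\Omega$ by it, with the quotient topology. The cell $\chi(e)$ of an edge $e$ is the set of points of $A$ represented by words beginning with $e$. A cellular partition is a cover of $A$ by finitely many cells with pairwise disjoint interiors. If $e,e'$ are edges of the same colour, the canonical homeomorphism $\chi(e)\to\chi(e')$ sends the class of $ew$ to the class of $e'w$. A rearrangement is a homeomorphism $f:A\to A$ for which there is a cellular partition such that $f$ restricts on each of its cells to a canonical homeomorphism onto some cell. Rearrangements form a group $T_A$ under composition. The element $\varepsilon$. Below, $e\mapsto e'$ means that $\varepsilon$ maps $\chi(e)$ onto $\chi(e')$ canonically, and $e\mapsto e'$ (rev), for blue edges, means that it maps $\chi(e)$ onto $\chi(e')$ by the orientation-reversed map sending the classes of $e\mathsf b_\pm w$, $e\mathsf u w$, $e\mathsf d w$ to those of $e'\mathsf b_\mp w$, $e'\mathsf d w$, $e'\mathsf u w$. Then $\varepsilon$ is given by: $e_L\mapsto e_L$, $e_U\mapsto e_U$, $e_D\mapsto e_D$, $e_R\mathsf b_-\mathsf b_+\mapsto e_R\mathsf b_-$, $e_R\mathsf b_-\mathsf d\mapsto e_R\mathsf u$, $e_R\mathsf b_-\mathsf u\mapsto e_R\mathsf d$, $e_R\mathsf b_-\mathsf b_-\mapsto e_R\mathsf b_+\mathsf b_-$ (rev), $e_R\mathsf u\mapsto e_R\mathsf b_+\mathsf u$, $e_R\mathsf d\mapsto e_R\mathsf b_+\mathsf d$, $e_R\mathsf b_+\mapsto e_R\mathsf b_+\mathsf b_+$. *)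

(* Defs.v *)
From HB Require Import structures.
From mathcomp Require Import all_boot generic_quotient all_classical topology.
Set Implicit Arguments.
Unset Strict Implicit.
Unset Printing Implicit Defensive.

Local Open Scope quotient_scope.
Local Open Scope classical_set_scope.

Inductive color := Red | Blue.

(* Base edges, then the edges of the red and of the blue replacement graph:
   [bm], [bp] stand for b_- and b_+, and [rs], [bu], [bd] for s, u and d. *)
Inductive letter :=
  | eL | eR | eU | eD
  | r1 | r2 | rs
  | bm | bp | bu | bd.

Inductive base_vertex := vl | va | vb | vr.

Inductive new_vertex := nm | nw | nx | ny.

Lemma color_comparable : comparable color.
Proof. by move=> x y; rewrite /decidable; decide equality. Defined.
HB.instance Definition _ := hasDecEq.Build color (compareP color_comparable).

Lemma letter_comparable : comparable letter.
Proof. by move=> x y; rewrite /decidable; decide equality. Defined.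
HB.instance Definition _ := hasDecEq.Build letter (compareP letter_comparable).
HB.instance Definition _ := gen_choiceMixin letter.

Lemma base_vertex_comparable : comparable base_vertex.
Proof. by move=> x y; rewrite /decidable; decide equality. Defined.
HB.instance Definition _ :=
  hasDecEq.Build base_vertex (compareP base_vertex_comparable).

Lemma new_vertex_comparable : comparable new_vertex.
Proof. by move=> x y; rewrite /decidable; decide equality. Defined.
HB.instance Definition _ :=
  hasDecEq.Build new_vertex (compareP new_vertex_comparable).

Definition word := seq letter.

(* [New u k] is the vertex k created when the edge named u is replaced. *)
Inductive vertex :=
  | Base of base_vertex
  | New of word & new_vertex.

Lemma vertex_comparable : comparable vertex.
Proof.
move=> x y; rewrite /decidable; decide equality; exact: eq_comparable.
Defined.
HB.instance Definition _ := hasDecEq.Build vertex (compareP vertex_comparable).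

Record edge := Edge { name : word; clr : color; src : vertex; tgt : vertex }.

Lemma edge_comparable : comparable edge.
Proof.
move=> x y; rewrite /decidable; decide equality; exact: eq_comparable.
Defined.
HB.instance Definition _ := hasDecEq.Build edge (compareP edge_comparable).

Definition ends (e : edge) : seq vertex := [:: src e; tgt e].

(* No graph considered here has an isolated vertex, so that a graph is given
   by the list of its edges. *)
Definition graph := seq edge.

Definition base_graph : graph :=
  [:: Edge [:: eL] Blue (Base va) (Base vl);
      Edge [:: eR] Blue (Base vb) (Base vr);
      Edge [:: eU] Red  (Base vb) (Base va);
      Edge [:: eD] Red  (Base va) (Base vb)].

Definition replacement (e : edge) : graph :=
  let n := name e in
  match clr e with
  | Red =>
      [:: Edge (rcons n r1) Red  (src e)    (New n nm);
          Edge (rcons n r2) Red  (New n nm) (tgt e);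
          Edge (rcons n rs) Blue (New n nm) (New n nw)]
  | Blue =>
      [:: Edge (rcons n bm) Blue (New n nx) (src e);
          Edge (rcons n bp) Blue (New n ny) (tgt e);
          Edge (rcons n bu) Red  (New n ny) (New n nx);
          Edge (rcons n bd) Red  (New n nx) (New n ny)]
  end.

Inductive expansion : graph -> Prop :=
  | expansion_base : expansion base_graph
  | expansion_step (G1 G2 : graph) (e : edge) :
      expansion (G1 ++ e :: G2) -> expansion (G1 ++ replacement e ++ G2).

Definition is_edge (e : edge) : Prop := exists2 G, expansion G & e \in G.

Definition full_expansion (n : nat) : graph :=
  iter n (fun G => flatten (map replacement G)) base_graph.

Definition initial_word (x : nat -> letter) (n : nat) : word := mkseq x n.

Definition begins (u : word) (x : nat -> letter) : Prop :=
  initial_word x (size u) = u.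

Definition Omega : set (prod_topology (fun _ : nat => discrete_topology letter)) :=
  [set x | forall n, exists2 e, is_edge e & name e = initial_word x n.+1].

Definition glue (x y : Omega) : Prop :=
  forall n, exists e f,
    [/\ e \in full_expansion n, name e = initial_word (val x) n.+1,
        f \in full_expansion n, name f = initial_word (val y) n.+1 &
        exists2 p, p \in ends e & p \in ends f].

Lemma full_expansionS n e :
  e \in full_expansion n.+1 <->
  exists2 e0, e0 \in full_expansion n & e \in replacement e0.
Proof.
rewrite /full_expansion iterS; split=> [/flatten_mapP//|[e0 h0 h]].
by apply/flatten_mapP; exists e0.
Qed.

Lemma replacement_name e e' :
  e' \in replacement e -> exists a, name e' = rcons (name e) a.
Proof.
rewrite /replacement; case: (clr e); rewrite !inE.
  by case/or3P => /eqP ->; eexists.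
by case/or4P => /eqP ->; eexists.
Qed.

Lemma replacement_inj e e1 e2 : e1 \in replacement e -> e2 \in replacement e ->
  name e1 = name e2 -> e1 = e2.
Proof.
rewrite /replacement; case: (clr e); rewrite !inE.
  by case/or3P => /eqP -> /or3P[] /eqP -> //= /rcons_inj[].
by case/or4P => /eqP -> /or4P[] /eqP -> //= /rcons_inj[].
Qed.

Lemma replacement_ends e e' p : e' \in replacement e -> p \in ends e' ->
  p \in ends e \/ exists k, p = New (name e) k.
Proof.
rewrite /replacement /ends; case: (clr e); rewrite !inE.
  by case/or3P => /eqP -> /= /orP[] /eqP ->; rewrite ?eqxx ?orbT;
     (by left) || (by right; eexists).
by case/or4P => /eqP -> /= /orP[] /eqP ->; rewrite ?eqxx ?orbT;
   (by left) || (by right; eexists).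
Qed.

Lemma full_expansion_size n e : e \in full_expansion n -> size (name e) = n.+1.
Proof.
elim: n e => [|n IH] e.
  by rewrite /= !inE => /or4P[] /eqP ->.
by move=> /full_expansionS[e0 /IH h0 /replacement_name[a ->]]; rewrite size_rcons h0.
Qed.

Lemma full_expansion_inj n e f : e \in full_expansion n ->
  f \in full_expansion n -> name e = name f -> e = f.
Proof.
elim: n e f => [|n IH] e f.
  by rewrite /= !inE => /or4P[] /eqP -> /or4P[] /eqP ->.
move=> /full_expansionS[e0 e0n ee0] /full_expansionS[f0 f0n ff0] ef.
have [a ea] := replacement_name ee0; have [b fb] := replacement_name ff0.
have /rcons_inj[nef _] : rcons (name e0) a = rcons (name f0) b.
  by rewrite -ea -fb.
have e0f0 := IH _ _ e0n f0n nef; rewrite -e0f0 in ff0.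
exact: replacement_inj ee0 ff0 ef.
Qed.

Lemma full_expansion_fresh n e u k : e \in full_expansion n ->
  New u k \in ends e -> size u <= n.
Proof.
elim: n e => [|n IH] e.
  by rewrite /= !inE => /or4P[] /eqP -> /orP[].
move=> /full_expansionS[e0 e0n ee0] /(replacement_ends ee0)[/(IH _ e0n)/leqW//|].
by move=> [k' [-> _]]; rewrite (full_expansion_size e0n).
Qed.

Lemma replacement_old n e e' p q : e \in full_expansion n ->
  e' \in replacement e -> p \in ends e' -> q \in ends e' ->
  p \in ends e -> q \in ends e -> p = q.
Proof.
move=> en; have fr k : New (name e) k \notin ends e.
  apply/negP => /(full_expansion_fresh en).
  by rewrite (full_expansion_size en) ltnn.
have nfr p' k : p' \in ends e -> p' = New (name e) k -> False.
  by move=> h E; move: h (fr k); rewrite -E => ->.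
move=> ee; rewrite /ends => pe qe pend qend.
have {}nfr1 k := nfr p k pend; have {}nfr2 k := nfr q k qend.
move: ee pe qe; rewrite /replacement; case: (clr e); rewrite !inE.
  by case/or3P => /eqP -> /= /orP[] /eqP hp /orP[] /eqP hq;
    (by rewrite hp hq) || (by case: (nfr1 _ hp)) || (by case: (nfr2 _ hq)).
by case/or4P => /eqP -> /= /orP[] /eqP hp /orP[] /eqP hq;
  (by rewrite hp hq) || (by case: (nfr1 _ hp)) || (by case: (nfr2 _ hq)).
Qed.

Lemma replacement_share n e f e' f' p :
  e \in full_expansion n -> f \in full_expansion n -> e <> f ->
  e' \in replacement e -> f' \in replacement f ->
  p \in ends e' -> p \in ends f' -> p \in ends e /\ p \in ends f.
Proof.
move=> en fn ef ee ff pe pf.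
have fr g h k : g \in full_expansion n -> h \in full_expansion n ->
    New (name g) k \in ends h -> False.
  move=> gn hn /(full_expansion_fresh hn).
  by rewrite (full_expansion_size gn) ltnn.
have [he|[k hk]] := replacement_ends ee pe;
  have [hf|[j hj]] := replacement_ends ff pf => //.
- by rewrite hj in he; case: (fr _ _ _ fn en he).
- by rewrite hk in hf; case: (fr _ _ _ en fn hf).
- move: hj; rewrite hk => -[nef _].
  by case: ef; exact: full_expansion_inj en fn nef.
Qed.

Lemma is_edge_full e : is_edge e -> e \in full_expansion (size (name e)).-1.
Proof.
move=> [G + eG]; move=> hG; elim: hG e eG => [|G1 G2 f _ IH] e.
  by rewrite !inE => /or4P[] /eqP ->.
rewrite !mem_cat => /or3P[eG|eG|eG].
- by apply: IH; rewrite mem_cat eG.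
- have fn : f \in full_expansion (size (name f)).-1.
    by apply: IH; rewrite mem_cat inE eqxx orbT.
  have [a ->] := replacement_name eG; rewrite size_rcons /=.
  rewrite -(prednK (n := size (name f))); last by rewrite (full_expansion_size fn).
  by apply/full_expansionS; exists f.
- by apply: IH; rewrite mem_cat inE eG !orbT.
Qed.

Lemma Omega_full_expansion (x : Omega) n :
  exists2 e, e \in full_expansion n & name e = initial_word (val x) n.+1.
Proof.
have /set_mem/(_ n)[e ie ne] := valP x; exists e => //.
by have := is_edge_full ie; rewrite ne size_mkseq.
Qed.

Lemma full_expansion_parent (x : nat -> letter) n e e' :
  e \in full_expansion n -> name e = initial_word x n.+1 ->
  e' \in full_expansion n.+1 -> name e' = initial_word x n.+2 ->
  e' \in replacement e.
Proof.
move=> en ne /full_expansionS[e0 e0n e'e0] ne'.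
have [a ha] := replacement_name e'e0.
suff -> : e = e0 by [].
apply: (full_expansion_inj en e0n); rewrite ne.
have mkS (y : nat -> letter) m : mkseq y m.+1 = rcons (mkseq y m) (y m).
  by rewrite /mkseq -addn1 iotaD map_cat cats1.
by move: ne'; rewrite ha /initial_word [RHS]mkS => /rcons_inj[->].
Qed.

Lemma glue_refl (x : Omega) : glue x x.
Proof.
move=> n; have [e en ne] := Omega_full_expansion x n.
by exists e, e; split => //; exists (src e); rewrite /ends inE eqxx.
Qed.

Lemma glue_sym (x y : Omega) : glue x y -> glue y x.
Proof.
move=> xy n; have [e [f [en ne fn nf [p pe pf]]]] := xy n.
by exists f, e; split => //; exists p.
Qed.

Lemma glue_trans (x y z : Omega) : glue x y -> glue y z -> glue x z.
Proof.
move=> xy yz n.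
have [e [f [en ne fn nf ef]]] := xy n.
have [f1 [g [f1n nf1 gn ng fg]]] := yz n.
have {f1n nf1} ff1 : f1 = f.
  by apply: (full_expansion_inj f1n fn); rewrite nf1 nf.
subst f1; exists e, g; split => //.
have [e'e|nef] := eqVneq e f; first by rewrite e'e.
have [g'f|nfg] := eqVneq f g; first by rewrite -g'f.
have [e' [f' [e'n ne' f'n nf' [p pe pf]]]] := xy n.+1.
have [f1 [g' [f1n nf1 g'n ng' [q qf qg]]]] := yz n.+1.
have ff1 : f1 = f' by apply: (full_expansion_inj f1n f'n); rewrite nf1 nf'.
subst f1.
have ee := full_expansion_parent en ne e'n ne'.
have ff := full_expansion_parent fn nf f'n nf'.
have gg := full_expansion_parent gn ng g'n ng'.
have [p1 p2] := replacement_share en fn (elimN eqP nef) ee ff pe pf.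
have [q1 q2] := replacement_share fn gn (elimN eqP nfg) ff gg qf qg.
by exists p => //; rewrite (replacement_old fn ff pf qf p2 q1).
Qed.

Definition glueb (x y : Omega) : bool := `[< glue x y >].

Lemma glueb_equiv : equiv_class_of glueb.
Proof.
split=> [x|x y|y x z]; first exact/asboolP/glue_refl.
  by apply/asboolP/asboolP; exact: glue_sym.
by move=> /asboolP xy /asboolP yz; apply/asboolP; exact: glue_trans xy yz.
Qed.

Canonical glue_equiv := EquivRelPack glueb_equiv.

Definition airplane : Type := quotient_topology {eq_quot glue_equiv}.
HB.instance Definition _ :=
  Topological.copy airplane (quotient_topology {eq_quot glue_equiv}).

Definition point_of (x : Omega) : airplane := \pi_{eq_quot glue_equiv} x.

Lemma point_ofP (x y : Omega) : point_of x = point_of y <-> glue x y.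
Proof.
by split=> [/eqmodP/asboolP|/asboolP h]; last exact/eqmodP.
Qed.

Definition cell (e : edge) : set airplane :=
  [set p | exists2 x : Omega, begins (name e) (val x) & point_of x = p].

Definition cellular_partition (P : seq edge) : Prop :=
  [/\ {in P, forall e, is_edge e},
      \bigcup_(e in [set` P]) cell e = setT &
      {in P &, forall e f, e != f -> (cell e)° `&` (cell f)° = set0}].

Record homeo (X : topologicalType) := Homeo {
  homeo_fun :> X -> X;
  homeo_inv : X -> X;
  homeo_continuous : continuous homeo_fun;
  homeo_inv_continuous : continuous homeo_inv;
  homeoK : cancel homeo_fun homeo_inv;
  homeo_invK : cancel homeo_inv homeo_fun }.

Section HomeoGroup.
Variable X : topologicalType.
Implicit Types f g h : homeo X.

Lemma homeo_ext f g : (homeo_fun f =1 homeo_fun g) -> f = g.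
Proof.
case: f g => [f f' cf cf' K K'] [g g' cg cg' L L'] /= /funext E; subst g.
have E : f' = g' by apply/funext => x; rewrite -{1}(L' x) K.
by subst g'; congr Homeo; exact: Prop_irrelevance.
Qed.

Definition homeo_id : homeo X :=
  @Homeo X id id (fun x => @cvg_id _ (nbhs x)) (fun x => @cvg_id _ (nbhs x))
    (fun=> erefl) (fun=> erefl).

Definition homeo_comp f g : homeo X :=
  @Homeo X (f \o g) (homeo_inv g \o homeo_inv f)
    (fun x => continuous_comp (@homeo_continuous _ g x)
                              (@homeo_continuous _ f (g x)))
    (fun x => continuous_comp (@homeo_inv_continuous _ f x)
                              (@homeo_inv_continuous _ g (homeo_inv f x)))
    (can_comp (@homeoK _ f) (@homeoK _ g))
    (can_comp (@homeo_invK _ g) (@homeo_invK _ f)).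

Definition homeo_rev f : homeo X :=
  @Homeo X (homeo_inv f) f (@homeo_inv_continuous _ f) (@homeo_continuous _ f)
    (@homeo_invK _ f) (@homeoK _ f).

Lemma homeo_compA : associative homeo_comp.
Proof. by move=> f g h; exact: homeo_ext. Qed.
Lemma homeo_comp1f : left_id homeo_id homeo_comp.
Proof. by move=> f; exact: homeo_ext. Qed.
Lemma homeo_compf1 : right_id homeo_id homeo_comp.
Proof. by move=> f; exact: homeo_ext. Qed.
Lemma homeo_compVf : left_inverse homeo_id homeo_rev homeo_comp.
Proof. by move=> f; apply: homeo_ext => x; exact: homeoK. Qed.
Lemma homeo_compfV : right_inverse homeo_id homeo_rev homeo_comp.
Proof. by move=> f; apply: homeo_ext => x; exact: homeo_invK. Qed.

HB.instance Definition _ := gen_eqMixin (homeo X).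
HB.instance Definition _ := gen_choiceMixin (homeo X).
HB.instance Definition _ := isGroup.Build (homeo X)
  homeo_compA homeo_comp1f homeo_compf1 homeo_compVf homeo_compfV.

End HomeoGroup.

Local Open Scope group_scope.

Definition subgroup (gT : groupType) : set (set gT) :=
  [set H | group_closed (mem H)].

Definition generated (gT : groupType) (S : set gT) : set gT :=
  smallest (@subgroup gT) S.

Definition commutator_subgroup (gT : groupType) (G : set gT) : set gT :=
  generated [set [~ x, y] | x in G & y in G].

Definition cyclic_subgroup (gT : groupType) (x : gT) : set gT :=
  generated [set x].

Definition internal_sdprod (gT : groupType) (G N H : set gT) : Prop :=
  [/\ [/\ subgroup G, subgroup N & subgroup H],
      N `<=` G /\ H `<=` G,
      forall n g, N n -> G g -> N (n ^ g),
      N `&` H = [set 1] &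
      [set n * h | n in N & h in H] = G].

(* When the edges u and v have the same colour: on the cell of u, the map f is
   the canonical homeomorphism onto the cell of v, namely [uw] |-> [vw]. *)
Definition canonical_on (f : airplane -> airplane) (u v : word) : Prop :=
  forall x y : Omega, begins u (val x) -> begins v (val y) ->
    (forall k, val x (size u + k)%N = val y (size v + k)%N) ->
    f (point_of x) = point_of y.

Definition reversed_on (f : airplane -> airplane) (u v : word) : Prop :=
  [/\ canonical_on f (rcons u bm) (rcons v bp),
      canonical_on f (rcons u bp) (rcons v bm),
      canonical_on f (rcons u bu) (rcons v bd) &
      canonical_on f (rcons u bd) (rcons v bu)].

Definition airplane_group : set (homeo airplane) :=
  [set f | exists2 P, cellular_partition P &
     {in P, forall e, exists e',
       [/\ is_edge e', clr e' = clr e & canonical_on f (name e) (name e')]}].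

Definition is_epsilon (f : airplane -> airplane) : Prop :=
  [/\ [/\ canonical_on f [:: eL] [:: eL],
          canonical_on f [:: eU] [:: eU] &
          canonical_on f [:: eD] [:: eD]],
      [/\ canonical_on f [:: eR; bm; bp] [:: eR; bm],
          canonical_on f [:: eR; bm; bd] [:: eR; bu],
          canonical_on f [:: eR; bm; bu] [:: eR; bd] &
          reversed_on f [:: eR; bm; bm] [:: eR; bp; bm]] &
      [/\ canonical_on f [:: eR; bu] [:: eR; bp; bu],
          canonical_on f [:: eR; bd] [:: eR; bp; bd] &
          canonical_on f [:: eR; bp] [:: eR; bp; bp]]].

(* Main.v *)
Require Import Defs.
From HB Require Import structures.
From mathcomp Require Import all_boot generic_quotient all_classical topology.
From mathcomp Require Import ssralg ssrint zify.
Import Defs GRing.Theory.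

(** Rearrangements are the homeomorphisms acting canonically on all edges of
    some level of the graphs [full_expansion n] ([airplane_groupP]), and the
    statement amounts to two facts about the subgroup generated by [epsilon] and
    the commutators, [mod_epsilon].

    Splitting. The tips are the far ends of the edges [eL], [eR] and [rs], the
    vertices of degree one. A rearrangement permutes the tips, and near a tip it
    adds or removes a number of letters [bp]: it is a power of the local
    contraction. These integers vanish at all but finitely many tips, so that
    their sum is a homomorphism to the integers ([tip_sumM]), zero on
    commutators. It takes the value 1 on [epsilon] ([tip_sum_epsilon]), so that
    the only power of [epsilon] among the products of commutators is 1.

    Generation. All rearrangements belong to [mod_epsilon] ([mod_epsilon_full]).
    Explicit elements are given by finite tables of cells, and relations between
    them are checked by computation: on the central circle, [alpha] and [beta]
    are the generators of Thompson's group F and [rho] is the half turn, while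
    [kappa] is a translation along the axis from the tip of [eL] to that of
    [eR]. Each of [alpha] and [beta] is a product of two conjugates of [beta],
    so that both are products of commutators, and [rho] follows from
    [rho^2 = (rho alpha^-1)^3 = 1]; the element [kappa epsilon^-1] is a
    conjugate of [rho epsilon^-1 rho]. With these elements any edge can be moved
    to [eU], to [eR] or to the other kind of blue edge [eR b_-]
    ([edges_reachable]), which allows one to assume that a rearrangement fixes
    [eU]. It is then a product of three rearrangements supported in [eD], [eL]
    and [eR]: the interior of a cell is connected, so that a rearrangement which
    fixes the border of a cell and sends some edge inside it to another one
    preserves this cell ([cell_dichotomy]) and can be cut there ([restriction]).

    By conjugation, it remains to deal with the rearrangements supported in [eU]
    or in [eR], by induction on the number of expansions needed to describe them
    ([all_tame]). For [eU], factors [beta] on both sides make the map fix the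
    first half [eU r_1], without increasing the total number of expansions; it
    splits into two pieces, supported in [eU r_2] and [eU s], and each of them is conjugate to a rearrangement of [eU] or [eR]
    with fewer expansions. For [eR], factors [epsilon] make the map fix
    [eR b_-], then factors [omega], a conjugate of [alpha], make it fix [eR d];
    the remaining two edges are dealt with as before. *)

Set Implicit Arguments.
Unset Strict Implicit.
Unset Printing Implicit Defensive.

Local Open Scope classical_set_scope.

(** * Words, edges and vertices *)

Notation stream := (nat -> letter).

Definition is_root (a : letter) : bool :=
  match a with eL | eR | eU | eD => true | _ => false end.

Definition paint (a : letter) : color :=
  match a with eL | eR | rs | bm | bp => Blue | _ => Red end.

Definition fits (c : color) (a : letter) : bool :=
  match c, a with
  | Red, (r1 | r2 | rs) | Blue, (bm | bp | bu | bd) => true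
  | _, _ => false
  end.

Definition step (a b : letter) : bool := fits (paint a) b.

Definition valid (w : word) : bool :=
  if w is a :: s then is_root a && path step a s else false.

Definition wcol (w : word) : color := paint (last eL w).

Definition root_edge (a : letter) : edge :=
  match a with
  | eL => Edge [:: eL] Blue (Base va) (Base vl)
  | eR => Edge [:: eR] Blue (Base vb) (Base vr)
  | eU => Edge [:: eU] Red (Base vb) (Base va)
  | eD => Edge [:: eD] Red (Base va) (Base vb)
  | _ => Edge [:: a] (paint a) (Base va) (Base va)
  end.

Definition child (e : edge) (a : letter) : edge :=
  let n := name e in
  match a with
  | r1 => Edge (rcons n r1) Red (src e) (New n nm)
  | r2 => Edge (rcons n r2) Red (New n nm) (tgt e)
  | rs => Edge (rcons n rs) Blue (New n nm) (New n nw)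
  | bm => Edge (rcons n bm) Blue (New n nx) (src e)
  | bp => Edge (rcons n bp) Blue (New n ny) (tgt e)
  | bu => Edge (rcons n bu) Red (New n ny) (New n nx)
  | bd => Edge (rcons n bd) Red (New n nx) (New n ny)
  | _ => Edge (rcons n a) (paint a) (src e) (tgt e)
  end.

(** The edge named by [w]; its value is arbitrary when [w] is not [valid]. *)
Definition edge_of (w : word) : edge :=
  if w is a :: s then foldl child (root_edge a) s else root_edge eL.

Notation wends w := (ends (edge_of w)).

Lemma valid_rcons w a : w != [::] -> valid (rcons w a) = valid w && fits (wcol w) a.
Proof. by case: w => // b w _; rewrite /valid /= rcons_path andbA. Qed.

Lemma valid_cat w z :
  w != [::] -> valid (w ++ z) = valid w && path step (last eL w) z.
Proof. by case: w => // b w _; rewrite /valid /= cat_path andbA. Qed.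

Lemma valid_neq0 w : valid w -> w != [::]. Proof. by case: w. Qed.

Lemma edge_of_rcons w a :
  w != [::] -> edge_of (rcons w a) = child (edge_of w) a.
Proof. by case: w => // b w _; rewrite /= foldl_rcons. Qed.

Lemma name_edge_of w : w != [::] -> name (edge_of w) = w.
Proof.
elim/last_ind: w => // w a IH _.
have [->|w0] := eqVneq w [::]; first by case: a.
by rewrite edge_of_rcons //; case: a => /=; rewrite IH.
Qed.

Lemma clr_edge_of w : w != [::] -> clr (edge_of w) = wcol w.
Proof.
elim/last_ind: w => // w a IH _; rewrite /wcol last_rcons.
have [->|w0] := eqVneq w [::]; first by case: a.
by rewrite edge_of_rcons //; case: a.
Qed.

Lemma mem_replacement e e' :
  e' \in replacement e <-> exists2 a, fits (clr e) a & e' = child e a.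
Proof.
rewrite /replacement; case: (clr e); rewrite !inE; split.
- by case/or3P => /eqP ->; [exists r1|exists r2|exists rs].
- by case=> -[] // _ ->; rewrite /= eqxx ?orbT.
- by case/or4P => /eqP ->; [exists bm|exists bp|exists bu|exists bd].
- by case=> -[] // _ ->; rewrite /= eqxx ?orbT.
Qed.

Lemma mem_full_expansion n e : e \in full_expansion n <->
  [/\ size (name e) = n.+1, valid (name e) & e = edge_of (name e)].
Proof.
elim: n e => [|n IH] e.
  split; first by rewrite /= !inE => /or4P[] /eqP ->.
  case; case: (name e) => [|a []] //= _.
  by case: a => //= _ ->; rewrite !inE eqxx ?orbT.
split=> [/full_expansionS[e0 /IH[s0 v0 e0E] /mem_replacement[a fa ->]]|].
  have n0 : name e0 != [::] by case: (name e0) s0.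
  have -> : name (child e0 a) = rcons (name e0) a by case: (a).
  rewrite size_rcons s0 valid_rcons // v0 edge_of_rcons // -e0E; split=> //.
  by rewrite -(clr_edge_of n0) -e0E fa.
case; case/lastP: (name e) => // w a; rewrite size_rcons => -[sw].
have w0 : w != [::] by case: (w) sw.
rewrite valid_rcons // edge_of_rcons // => /andP[vw fa] ->.
apply/full_expansionS; exists (edge_of w).
  by apply/IH; rewrite name_edge_of.
by apply/mem_replacement; exists a => //; rewrite clr_edge_of.
Qed.

Lemma edge_of_full w n : valid w -> size w = n.+1 -> edge_of w \in full_expansion n.
Proof.
move=> vw sw; apply/mem_full_expansion.
by rewrite name_edge_of ?(valid_neq0 vw).
Qed.

(** Every edge of [G] is replaced, from the last one to the first one. *)
Lemma expansion_flatten G H :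
  expansion (G ++ H) -> expansion (flatten (map replacement G) ++ H).
Proof.
elim/last_ind: G H => [|G e IH] H //.
rewrite cat_rcons => /expansion_step /IH.
by rewrite map_rcons -cats1 flatten_cat /= cats0 -catA.
Qed.

Lemma expansion_full n : expansion (full_expansion n).
Proof.
elim: n => [|n IH]; first exact: expansion_base.
rewrite /full_expansion iterS -/(full_expansion n) -[flatten _]cats0.
by apply: expansion_flatten; rewrite cats0.
Qed.

Lemma is_edgeP e : is_edge e <-> valid (name e) /\ e = edge_of (name e).
Proof.
split=> [/is_edge_full/mem_full_expansion[]//|[v eE]].
exists (full_expansion (size (name e)).-1); first exact: expansion_full.
by apply/mem_full_expansion; split=> //; case: (name e) v.
Qed.

Lemma is_edge_of w : valid w -> is_edge (edge_of w).
Proof. by move=> v; apply/is_edgeP; rewrite name_edge_of ?valid_neq0. Qed.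

(** A vertex created inside the edge [u] only belongs to edges which descend
    from [u]. *)
Lemma wends_fresh w u k : w != [::] -> New u k \in wends w ->
  exists a z, w = u ++ a :: z.
Proof.
elim/last_ind: w => // w a IH _.
have [->|w0] := eqVneq w [::]; first by case: a; rewrite /ends !inE.
rewrite edge_of_rcons // => h.
suff [/(IH w0)[b [z ->]]|->] : New u k \in wends w \/ u = w.
- by exists b, (rcons z a); rewrite rcons_cat.
- by exists a, [::]; rewrite cats1.
move: h; rewrite /ends !inE; case: a => /= /orP[] /eqP; rewrite ?name_edge_of //;
  by [move=> <-; rewrite eqxx ?orbT; left|case; right].
Qed.

Lemma wends_fresh_size w u k : w != [::] -> New u k \in wends w -> size u < size w.
Proof.
by move=> w0 /(wends_fresh w0)[a [z ->]]; rewrite size_cat /= addnS ltnS leq_addr.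
Qed.

Lemma wends_nofresh w k : w != [::] -> New w k \in wends w = false.
Proof. by move=> w0; apply/negP => /(wends_fresh_size w0); rewrite ltnn. Qed.

Lemma wends_child w a p : w != [::] -> p \in wends (rcons w a) ->
  p \in wends w \/ exists k, p = New w k.
Proof.
move=> w0; rewrite edge_of_rcons // /ends !inE.
case: a => /= /orP[] /eqP; rewrite ?name_edge_of // => ->;
  by [rewrite eqxx ?orbT; left|right; eexists].
Qed.

(** An edge keeps at most one end of its parent. *)
Lemma wends_old w a p q : w != [::] ->
  fits (wcol w) a ->
  p \in wends (rcons w a) -> q \in wends (rcons w a) ->
  p \in wends w -> q \in wends w -> p = q.
Proof.
move=> w0 fa pa qa pw qw.
move: pa qa; rewrite edge_of_rcons // /ends !inE.
by case: a fa; case: (wcol w) => //= _ /orP[] /eqP hp /orP[] /eqP hq;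
  rewrite ?name_edge_of // in hp hq; subst p q => //; rewrite ?wends_nofresh // in pw qw.
Qed.

(** Distinct edges create distinct vertices, so that a vertex shared by their
    children is inherited on both sides. *)
Lemma wends_share u v a b p : u != [::] -> v != [::] -> size u = size v ->
  u <> v ->
  p \in wends (rcons u a) -> p \in wends (rcons v b) ->
  p \in wends u /\ p \in wends v.
Proof.
move=> u0 v0 suv uv pu pv.
have nofr w w' k : w != [::] -> size w = size w' -> New w' k \in wends w -> False.
  by move=> w0 sw /(wends_fresh_size w0); rewrite sw ltnn.
have [hu|[k hk]] := wends_child u0 pu; have [hv|[j hj]] := wends_child v0 pv => //.
- by subst p; case: (nofr u v j u0 suv hu).
- by subst p; case: (nofr v u k v0 (esym suv) hv).
- by move: hj; rewrite hk => -[/uv].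
Qed.

(** * Streams, limits and gluing *)

Lemma mkseqSr (x : stream) n : mkseq x n.+1 = rcons (mkseq x n) (x n).
Proof. by rewrite /mkseq -addn1 iotaD map_cat cats1. Qed.

Lemma mkseq_take (x : stream) m n : m <= n -> mkseq x m = take m (mkseq x n).
Proof. by move=> mn; rewrite /mkseq -map_take take_iota (minn_idPl mn). Qed.

Lemma mkseq_prefix (x y : stream) m n :
  m <= n -> mkseq x n = mkseq y n -> mkseq x m = mkseq y m.
Proof. by move=> mn h; rewrite !(mkseq_take _ mn) h. Qed.

Lemma mkseq_neq0 (x : stream) n : mkseq x n.+1 != [::]. Proof. by []. Qed.

Lemma OmegaP (x : stream) : Omega x <-> forall n, valid (mkseq x n.+1).
Proof.
split=> h n.
  by have [e /is_edgeP[v _] ne] := h n; rewrite ne in v.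
exists (edge_of (mkseq x n.+1)); first exact: is_edge_of.
by rewrite name_edge_of.
Qed.

Lemma Omega_valid (x : Omega) n : valid (mkseq (val x) n.+1).
Proof. by have /set_mem/OmegaP := valP x. Qed.

Lemma Omega_fits (x : Omega) n : fits (wcol (mkseq (val x) n.+1)) (val x n.+1).
Proof. by have := Omega_valid x n.+1; rewrite mkseqSr valid_rcons // => /andP[]. Qed.

Lemma Omega_ext (x y : Omega) : val x =1 val y -> x = y.
Proof. by move=> h; apply: val_inj; apply/funext. Qed.

Lemma glueP (x y : Omega) : glue x y <->
  forall n, exists2 p, p \in wends (mkseq (val x) n.+1) &
                       p \in wends (mkseq (val y) n.+1).
Proof.
split=> h n.
  have [e [f [/mem_full_expansion[_ _ eE] ne /mem_full_expansion[_ _ fE] nf]]] := h n.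
  by rewrite eE fE ne nf.
exists (edge_of (mkseq (val x) n.+1)), (edge_of (mkseq (val y) n.+1)).
by split=> //; rewrite ?name_edge_of //; apply: edge_of_full;
  rewrite ?size_mkseq //; exact: Omega_valid.
Qed.

(** [tends x p]: the edges of the stream [x] shrink to the vertex [p]. *)
Definition tends (x : stream) (p : vertex) : Prop :=
  exists n, forall m, n <= m -> p \in wends (mkseq x m.+1).

Lemma tends_uniq (x : Omega) p q : tends (val x) p -> tends (val x) q -> p = q.
Proof.
move=> [n hn] [m hm]; pose k := maxn n m.
have nk : n <= k by exact: leq_maxl.
have mk : m <= k by exact: leq_maxr.
apply: (@wends_old (mkseq (val x) k.+1) (val x k.+1)) => //.
- exact: Omega_fits.
- by rewrite -mkseqSr; apply: hn; exact: leqW.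
- by rewrite -mkseqSr; apply: hm; exact: leqW.
- exact: hn.
- exact: hm.
Qed.

(** Two distinct glued streams converge to a vertex shared by the edges where
    they have separated: the shared vertices are inherited from the parents,
    and an edge retains at most one vertex of its parent. *)
Lemma glue_tends (x y : Omega) n : glue x y ->
  mkseq (val x) n.+1 <> mkseq (val y) n.+1 ->
  exists p, [/\ tends (val x) p, tends (val y) p, p \in wends (mkseq (val x) n.+1) &
                p \in wends (mkseq (val y) n.+1)].
Proof.
move=> /glueP h nxy.
have nm m : n <= m -> mkseq (val x) m.+1 <> mkseq (val y) m.+1.
  by move=> mn /(@mkseq_prefix _ _ n.+1) E; apply: nxy; exact: E.
have par m p : n <= m -> p \in wends (mkseq (val x) m.+2) ->
    p \in wends (mkseq (val y) m.+2) ->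
    p \in wends (mkseq (val x) m.+1) /\ p \in wends (mkseq (val y) m.+1).
  move=> mn; rewrite (mkseqSr _ m.+1) (mkseqSr (val y) m.+1).
  by apply: wends_share => //; rewrite ?size_mkseq //; exact: nm.
have [p px py] := h n.+1.
have all m : n <= m -> p \in wends (mkseq (val x) m.+2) /\ p \in wends (mkseq (val y) m.+2).
  elim: m => [|m IH]; first by rewrite leqn0 => /eqP n0; rewrite n0 in px py.
  rewrite leq_eqVlt => /orP[/eqP <-//|]; rewrite ltnS => nm'.
  have [pxm pym] := IH nm'.
  have [q qx qy] := h m.+2.
  have [qx1 qy1] := par m.+1 q (leqW nm') qx qy.
  have [px0 _] := par m p nm' pxm pym.
  have [qx0 _] := par m q nm' qx1 qy1.
  suff -> : p = q by [].
  apply: (@wends_old (mkseq (val x) m.+1) (val x m.+1)); rewrite -?mkseqSr //.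
  exact: Omega_fits.
have [px0 py0] := par n p (leqnn n) px py.
exists p; split=> //; exists n.
  case=> [|m]; first by rewrite leqn0 => /eqP n0; rewrite n0 in px0.
  rewrite leq_eqVlt => /orP[/eqP <- //|]; rewrite ltnS => /all[]//.
case=> [|m]; first by rewrite leqn0 => /eqP n0; rewrite n0 in py0.
by rewrite leq_eqVlt => /orP[/eqP <- //|]; rewrite ltnS => /all[].
Qed.

(** A stream which converges to [p] has [p] on all its edges, except those
    which contain [p] in their interior. *)
Lemma tends_wends (x : Omega) p n : tends (val x) p ->
  p \in wends (mkseq (val x) n.+1) \/
  exists m k, n <= m /\ p = New (mkseq (val x) m.+1) k.
Proof.
move=> [N hN].
have [d le] : exists d, N <= n + d by exists N; rewrite leq_addl.
elim: d n le => [|d IH] n le; first by left; apply: hN; rewrite addn0 in le.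
have [||[m [k [nm ->]]]] := IH n.+1; first by rewrite addSnnS.
  rewrite (mkseqSr _ n.+1) => /wends_child[]//; first by left.
  by case=> k ->; right; exists n, k.
by right; exists m, k; split=> //; exact: ltnW.
Qed.

(** Either both streams have [p] on their edges, or [p] is created inside an
    edge of one of them, which then has to be an edge of the other. *)
Lemma tends_glue (x y : Omega) p : tends (val x) p -> tends (val y) p -> glue x y.
Proof.
move=> lx ly; apply/glueP => n.
have [px|[m [k [nm pE]]]] := tends_wends n lx.
  have [py|[m [k [nm pE]]]] := tends_wends n ly; first by exists p.
  rewrite pE in px; have := wends_fresh_size (mkseq_neq0 _ _) px.
  by rewrite !size_mkseq ltnS ltnNge nm.
suff E : mkseq (val x) n.+1 = mkseq (val y) n.+1.
  by exists (src (edge_of (mkseq (val x) n.+1))); rewrite -?E /ends inE eqxx.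
have [N hN] := ly; have := hN (maxn N m) (leq_maxl _ _).
rewrite pE => /(wends_fresh (mkseq_neq0 _ _))[a [z E]].
rewrite (@mkseq_take (val x) n.+1 m.+1) // (@mkseq_take (val y) n.+1 (maxn N m).+1).
  by rewrite E take_cat size_mkseq ltnS; move: nm; rewrite leq_eqVlt => /orP[/eqP ->|->//];
    rewrite ltnn subnn take0 cats0 take_oversize ?size_mkseq.
by rewrite ltnS (leq_trans nm) // leq_maxr.
Qed.

Lemma glue_cases (x y : Omega) : glue x y ->
  x = y \/ exists p, tends (val x) p /\ tends (val y) p.
Proof.
move=> g; have [|ne] := pselect (x = y); [by left|right].
have [n nn] : exists n, mkseq (val x) n.+1 <> mkseq (val y) n.+1.
  apply: contrapT => H; apply: ne; apply: Omega_ext => n.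
  have : mkseq (val x) n.+1 = mkseq (val y) n.+1.
    by apply: contrapT => ?; apply: H; exists n.
  by rewrite !mkseqSr => /rcons_inj[].
by have [p [tx ty _ _]] := glue_tends g nn; exists p.
Qed.

(** * Cylinders, copies and generic streams *)

(** The product topology on streams is generated by cylinders. *)
Lemma nbhs_cylinder (x : Omega) (U : set Omega) : nbhs x U <->
  exists n, forall y : Omega, mkseq (val y) n = mkseq (val x) n -> U y.
Proof.
pose X := prod_topology (fun _ : nat => discrete_topology letter).
pose F : set_system X := [set A | exists n, forall z : X, mkseq z n = mkseq (val x) n -> A z].
have FF : Filter F.
  split; first by exists 0.
  - move=> A B [n hA] [m hB]; exists (maxn n m) => z E; split.
      by apply: hA; apply: mkseq_prefix E; exact: leq_maxl.
    by apply: hB; apply: mkseq_prefix E; exact: leq_maxr.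
  - by move=> A B AB [n hA]; exists n => z /hA/AB.
split.
  move=> [_ [/= [B Bo <-]]] Bx BU.
  have Fx : F --> (val x : X).
    apply/cvg_sup => N A [V] [[W] oW <-] WfN WU.
    exists N.+1 => z; rewrite !mkseqSr => /rcons_inj[_ E].
    by apply: WU; rewrite /= E.
  have [n hn] : F B by apply: Fx; apply: open_nbhs_nbhs; split.
  by exists n => y /hn By; apply: BU.
move=> [n hn].
have coord k : nbhs x [set y : Omega | val y k = val x k].
  have c : {for x, continuous ((@proj _ (fun _ => discrete_topology letter) k) \o (val : Omega -> X))}.
    apply: continuous_comp; first exact: initial_continuous.
    exact: proj_continuous.
  apply: (c [set a | a = val x k]).
  by rewrite /= nbhs_principalE.
suff : nbhs x [set y : Omega | mkseq (val y) n = mkseq (val x) n].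
  by apply: filterS => y; exact: hn.
elim: n {hn} => [|n IH].
  by apply: filterS (@filterT _ _ (nbhs_filter x)).
apply: filterS (filterI IH (coord n)) => y [/= E1 E2].
by rewrite !mkseqSr E1 E2.
Qed.

Definition scat (u : word) (z : stream) : stream :=
  fun n => if n < size u then nth eL u n else z (n - size u).

Definition follows (c : color) (z : stream) : Prop :=
  fits c (z 0) /\ forall n, step (z n) (z n.+1).

(** [x = uz] and [y = vz] with the same tail [z]. The action on cells is phrased
    by this relation, since only some tails can follow a given word. *)
Definition copies (u v : word) (x y : Omega) : Prop :=
  [/\ begins u (val x), begins v (val y) &
      forall k, val x (size u + k) = val y (size v + k)].

Lemma begins_mkseq (x : stream) n : begins (mkseq x n) x.
Proof. by rewrite /begins /initial_word size_mkseq. Qed.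

Lemma beginsE (x : stream) u : begins u x -> mkseq x (size u) = u.
Proof. by []. Qed.

Lemma begins_scat u z : begins u (scat u z).
Proof.
rewrite /begins /initial_word; apply: (@eq_from_nth _ eL); rewrite size_mkseq //.
by move=> i iu; rewrite nth_mkseq // /scat iu.
Qed.

Lemma mkseq_add (x : stream) m n :
  mkseq x (m + n) = mkseq x m ++ mkseq (fun k => x (m + k)) n.
Proof.
by rewrite /mkseq iotaD map_cat add0n -[X in iota X n]addn0 iotaDl -map_comp.
Qed.

Lemma begins_cat u w x : begins (u ++ w) x <->
  begins u x /\ begins w (fun k => x (size u + k)).
Proof.
rewrite /begins /initial_word size_cat mkseq_add; split; last by case=> -> ->.
by move=> /eqP; rewrite eqseq_cat ?size_mkseq // => /andP[/eqP ? /eqP].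
Qed.

Lemma begins_catl u w x : begins (u ++ w) x -> begins u x.
Proof. by case/begins_cat. Qed.

Lemma begins_prefix u v x : prefix u v -> begins v x -> begins u x.
Proof. by move=> /prefixP[w ->] /begins_catl. Qed.

Lemma begins_comparable u v x : begins u x -> begins v x ->
  size u <= size v -> prefix u v.
Proof.
by move=> bu bv h; rewrite prefixE -{1}bv /initial_word -mkseq_take // beginsE.
Qed.

Lemma scat_tail u x : begins u x -> x = scat u (fun k => x (size u + k)).
Proof.
move=> bu; apply/funext => n; rewrite /scat; case: ltnP => nu.
  by rewrite -{1}bu /initial_word nth_mkseq.
by rewrite subnKC.
Qed.

Lemma scat_add u z k : scat u z (size u + k) = z k.
Proof. by rewrite /scat ltnNge leq_addr addKn. Qed.

Lemma mkseq_scat u z k : mkseq (scat u z) (size u + k) = u ++ mkseq z k.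
Proof.
rewrite mkseq_add (beginsE (begins_scat u z)); congr (_ ++ _).
by apply: eq_map => i; exact: scat_add.
Qed.

Lemma path_follows c z n : follows c z -> 
  forall a, paint a = c -> path step a (mkseq z n).
Proof.
case=> h0 h a ac; case: n => // n; rewrite /= {1}/step ac h0 /=.
apply/(pathP eL) => i; rewrite size_map size_iota => ni.
rewrite (nth_map 0) ?size_iota // nth_iota // add1n.
case: i ni => [|i] ni; first exact: h.
by rewrite /= (nth_map 0) ?size_iota ?(ltnW ni) // nth_iota ?(ltnW ni) ?add1n.
Qed.

Lemma Omega_scat u z : valid u -> follows (wcol u) z -> Omega (scat u z).
Proof.
move=> vu fz; apply/OmegaP => n.
have u0 := valid_neq0 vu.
have V k : valid (mkseq (scat u z) (size u + k)).
  by rewrite mkseq_scat valid_cat // vu; exact: path_follows fz _ _.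
have := V n; have -> : size u + n = n.+1 + (size u).-1.
  by rewrite addSn -addnS addnC prednK // lt0n size_eq0.
by rewrite mkseq_add valid_cat // => /andP[].
Qed.

Lemma Omega_follows u (x : Omega) : u != [::] -> begins u (val x) ->
  follows (wcol u) (fun k => val x (size u + k)).
Proof.
move=> u0 bu; have su : 0 < size u by rewrite lt0n size_eq0.
split=> [|n]; rewrite ?addn0.
  by have := Omega_fits x (size u).-1; rewrite prednK // beginsE.
have := Omega_fits x (size u + n); rewrite mkseqSr addnS.
by rewrite /wcol last_rcons.
Qed.

Lemma begins_valid u (x : Omega) : u != [::] -> begins u (val x) -> valid u.
Proof.
move=> u0 <-; rewrite /initial_word; case: (size u) (size_eq0 u) => [|n _].
  by rewrite (negPf u0).
exact: Omega_valid.
Qed.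

Definition splice u z (vu : valid u) (fz : follows (wcol u) z) : Omega :=
  exist _ (scat u z) (mem_set (Omega_scat vu fz)).

Lemma transfer u v (x : Omega) : u != [::] -> valid v -> wcol u = wcol v ->
  begins u (val x) -> exists y, copies u v x y.
Proof.
move=> u0 vv uv bu; have := Omega_follows u0 bu; rewrite uv => fz.
exists (splice vv fz); split=> //=; first exact: begins_scat.
by move=> k; rewrite scat_add.
Qed.

Lemma copies_sym u v x y : copies u v x y -> copies v u y x.
Proof. by case=> bu bv h; split. Qed.

Lemma copies_inj u v x x' y : copies u v x y -> copies u v x' y -> x = x'.
Proof.
case=> bu bv h [bu' _ h']; apply: Omega_ext => n.
rewrite (scat_tail bu) (scat_tail bu') /scat; case: ltnP => // _.
by rewrite h h'.
Qed.

Lemma copies_cat u v w x y : copies u v x y -> begins (u ++ w) (val x) ->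
  copies (u ++ w) (v ++ w) x y.
Proof.
case=> bu bv h buw; split=> //.
  apply/begins_cat; split=> //; have [_ bw] := (begins_cat _ _ _).1 buw.
  by rewrite /begins -[RHS]bw /initial_word; apply: eq_mkseq => k; rewrite h.
by move=> k; rewrite !size_cat -!addnA h.
Qed.

Lemma copies_trans u v w x y z : copies u v x y -> copies v w y z ->
  copies u w x z.
Proof. by case=> bu bv h [_ bw h']; split=> // k; rewrite h h'. Qed.

(** Such a stream is alone in its class, by [glue_cases]. *)
Definition generic (x : Omega) : Prop := forall p, ~ tends (val x) p.

Lemma generic_eq x y : generic x -> point_of x = point_of y -> x = y.
Proof.
by move=> gx /point_ofP/glue_cases[//|[p [/gx]]].
Qed.

(** Neither end of a red edge belongs to its descendant by [r1 r2 r1], so that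
    this stream does not converge to a vertex. After a blue edge, one letter leads to
    a red edge first. *)
Definition zigzag (n : nat) : letter := if odd n then r2 else r1.

Definition wander (c : color) : stream :=
  if c is Red then zigzag else fun n => if n is n'.+1 then zigzag n' else bu.

Lemma wander_follows c : follows c (wander c).
Proof.
have z n : step (zigzag n) (zigzag n.+1) by rewrite /zigzag /=; case: odd.
by case: c; split=> // -[|n] //; exact: z.
Qed.

Lemma generic_zigzag (x : Omega) n :
  (forall k, val x (n + k) = zigzag k) -> generic x.
Proof.
move=> zx p [N hN].
pose m := n + N.*2.
have xm : val x m = r1 by rewrite /m zx /zigzag odd_double.
have xm1 : val x m.+1 = r2 by rewrite /m -addnS zx /zigzag /= odd_double.
have xm2 : val x m.+2 = r1 by rewrite /m -!addnS zx /zigzag /= odd_double.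
have le k : N <= m + k.
  apply: leq_trans (leq_addr _ _); apply: leq_trans (leq_addl _ _).
  by rewrite -addnn leq_addr.
have p0 := hN m (leq_trans (le 0) (eq_leq (addn0 _))).
have := hN m.+2; rewrite -addn2 => /(_ (le 2)).
rewrite addn2 !(mkseqSr _ m.+2) !(mkseqSr _ m.+1) xm1 xm2.
have w0 : mkseq (val x) m.+1 != [::] by [].
move: (mkseq _ m.+1) w0 p0 => w w0 p0.
have wr : rcons w r2 != [::] by rewrite -size_eq0 size_rcons.
rewrite (edge_of_rcons _ wr) (edge_of_rcons _ w0) /ends !inE /= !name_edge_of //.
case/orP => /eqP pE; move: p0; rewrite pE ?wends_nofresh //.
by move=> /(wends_fresh_size w0); rewrite size_rcons ltnNge leqnSn.
Qed.

Lemma generic_point u : valid u -> exists2 x : Omega, begins u (val x) & generic x.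
Proof.
move=> vu; pose x := splice vu (wander_follows (wcol u)).
exists x; first exact: begins_scat.
have E k : val x (size u + k) = wander (wcol u) k by rewrite /= scat_add.
case: (wcol u) E => E; first exact: generic_zigzag E.
by apply: (@generic_zigzag _ (size u).+1) => k; rewrite addSnnS E.
Qed.

(** Generic streams continuing [u] can avoid any prescribed next letter. *)
Lemma generic_avoid u a : valid u -> exists2 x : Omega,
  begins u (val x) & generic x /\ val x (size u) <> a.
Proof.
move=> vu; have [b fb ba] : exists2 b, fits (wcol u) b & b <> a.
  by case: (wcol u); case: (a); solve [exists r1 => // | exists r2 => // | exists bm => // | exists bp => //].
have vb : valid (rcons u b) by rewrite valid_rcons ?valid_neq0 // vu.
have [x bx gx] := generic_point vb; exists x.
  by move: bx; rewrite -cats1 => /begins_catl.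
split=> // E; apply: ba; rewrite -E.
by move: bx; rewrite /begins /initial_word size_rcons mkseqSr => /rcons_inj[].
Qed.

(** * Canonical actions on cells *)

Definition acts (f : airplane -> airplane) (u v : word) : Prop :=
  [/\ valid u, valid v, wcol u = wcol v & canonical_on f u v].

Definition Cell (u : word) : set airplane :=
  [set p | exists2 x : Omega, begins u (val x) & point_of x = p].

Lemma point_surj (p : airplane) : exists x, point_of x = p.
Proof. by exists (repr p); exact: reprK. Qed.

Lemma acts_copies f u v x y : acts f u v -> copies u v x y ->
  f (point_of x) = point_of y.
Proof. by case=> _ _ _ h [bu bv c]; exact: h. Qed.

Lemma actsP f u v : valid u -> valid v -> wcol u = wcol v ->
  (forall x y, copies u v x y -> f (point_of x) = point_of y) -> acts f u v.
Proof. by move=> vu vv uv h; split=> // x y bu bv c; apply: h. Qed.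

Lemma acts_image f u v x : acts f u v -> begins u (val x) ->
  exists2 y, copies u v x y & f (point_of x) = point_of y.
Proof.
move=> fuv bu; case: (fuv) => vu vv uv _.
have [y c] := transfer (valid_neq0 vu) vv uv bu; exists y => //.
exact: acts_copies c.
Qed.

Lemma acts_onto f u v y : acts f u v -> begins v (val y) ->
  exists2 x, copies u v x y & f (point_of x) = point_of y.
Proof.
move=> fuv bv; case: (fuv) => vu vv uv _.
have [x /copies_sym c] := transfer (valid_neq0 vv) vu (esym uv) bv; exists x => //.
exact: acts_copies c.
Qed.

Lemma wcol_cat u v w : wcol u = wcol v -> wcol (u ++ w) = wcol (v ++ w).
Proof. by case: w => [|a w] uv; rewrite ?cats0 // /wcol !last_cat. Qed.

Lemma path_step_paint a b w : paint a = paint b -> path step a w = path step b w.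
Proof. by case: w => //= c w ab; rewrite /step ab. Qed.

Lemma valid_swap u v w : valid u -> valid v -> wcol u = wcol v ->
  valid (u ++ w) -> valid (v ++ w).
Proof.
move=> vu vv uv; rewrite !valid_cat ?valid_neq0 // vu vv /=.
suff -> : path step (last eL u) w = path step (last eL v) w by [].
exact: path_step_paint.
Qed.

Lemma copies_catl u v w x y : copies (u ++ w) (v ++ w) x y -> copies u v x y.
Proof.
case=> /begins_cat[bu bw] /begins_cat[bv bw'] h; split=> // k.
case: (ltnP k (size w)) => kw.
  have := congr1 (fun s => nth eL s k) bw; rewrite nth_mkseq // => ->.
  by have := congr1 (fun s => nth eL s k) bw'; rewrite nth_mkseq // => ->.
by have := h (k - size w); rewrite !size_cat -!addnA subnKC.
Qed.

Lemma acts_cat f u v w : acts f u v -> valid (u ++ w) -> acts f (u ++ w) (v ++ w).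
Proof.
move=> fuv vw; case: (fuv) => vu vv uv _; apply: actsP => //.
- exact: valid_swap vw.
- exact: wcol_cat.
- by move=> x y /copies_catl; exact: acts_copies.
Qed.

Lemma acts_rcons f u v a : acts f u v -> valid (rcons u a) ->
  acts f (rcons u a) (rcons v a).
Proof. by rewrite -!cats1; exact: acts_cat. Qed.

Lemma acts_id u : valid u -> acts id u u.
Proof.
by move=> vu; apply: actsP => // x y c; congr point_of; apply: (copies_inj c); split=> //; case: c.
Qed.

Lemma acts_self_point (f : airplane -> airplane) u x : acts f u u -> begins u (val x) ->
  f (point_of x) = point_of x.
Proof.
move=> h bx; have [y c ->] := acts_image h bx; congr point_of.
by apply/esym; apply: (copies_inj c); case: c => _ b _; split.
Qed.

Lemma acts_comp f g u v w : acts g u v -> acts f v w -> acts (f \o g) u w.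
Proof.
move=> guv fvw; have [vu vv uv _] := guv; have [_ vw vw' _] := fvw.
apply: actsP => //; first by rewrite uv.
move=> x z c; have bu : begins u (val x) by case: c.
have [y cy /= ->] := acts_image guv bu; apply: (acts_copies fvw).
exact: copies_trans (copies_sym cy) c.
Qed.

Lemma acts_inv (f : homeo airplane) u v : acts f u v -> acts (homeo_inv f) v u.
Proof.
move=> fuv; have [vu vv uv _] := fuv; apply: actsP => // y x /copies_sym c.
by rewrite -(acts_copies fuv c) homeoK.
Qed.

(** Generic streams have one-point classes, and they distinguish cells: two images
    of [u] have the same generic streams, and a generic stream of the larger cell
    can be taken out of the smaller one. *)
Lemma acts_uniq f u v v' : acts f u v -> acts f u v' -> v = v'.
Proof.
wlog le : v v' / size v <= size v'.
  by move=> W h h'; case/orP: (leq_total (size v) (size v')) => le;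
    [exact: W le h h'|apply/esym; exact: W le h' h].
move=> h h'; have [vu vv uv _] := h; have [_ vv' uv' _] := h'.
have key y : generic y -> begins v (val y) -> exists2 y', copies v v' y y' & y = y'.
  move=> gy bv; have [x c E] := acts_onto h bv.
  have [y' c' E'] := acts_image h' (let: And3 b _ _ := c in b).
  exists y'; first exact: copies_trans (copies_sym c) c'.
  by apply: generic_eq => //; rewrite -E -E'.
have [y by_ gy] := generic_point vv.
have [y' [_ b' _] E] := key y gy by_; subst y'.
have /prefixP[w E] := begins_comparable by_ b' le.
case: w E => [|a w] E; first by rewrite E cats0.
have [z bz [gz za]] := generic_avoid a vv.
have [z' [_ bz' _] E'] := key z gz bz; subst z'; case: za.
move: bz'; rewrite E => /begins_cat[_] bw.
by have := congr1 (fun s => nth eL s 0) bw; rewrite nth_mkseq //= addn0.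
Qed.

(** * The rearrangement group *)

Definition level_acts (f : airplane -> airplane) n : Prop :=
  forall u, valid u -> size u = n.+1 -> exists v, acts f u v.

Lemma level_acts_ge f n u : level_acts f n -> valid u -> n < size u ->
  exists v, acts f u v.
Proof.
move=> h vu nu; have E := cat_take_drop n.+1 u.
have st : size (take n.+1 u) = n.+1 by rewrite size_takel.
have t0 : take n.+1 u != [::] by rewrite -size_eq0 st.
have vt : valid (take n.+1 u) by move: vu; rewrite -{1}E valid_cat // => /andP[].
have [v fv] := h _ vt st; exists (v ++ drop n.+1 u).
by rewrite -{1}E; apply: acts_cat fv _; rewrite E.
Qed.

(** An open set contains the point of a generic stream, which belongs to a
    single cell of each level. *)
Lemma full_expansion_partition n : cellular_partition (full_expansion n).
Proof.
have nm e : e \in full_expansion n -> [/\ size (name e) = n.+1, valid (name e) &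
  e = edge_of (name e)] by move/mem_full_expansion.
split.
- by move=> e /nm[_ v eE]; apply/is_edgeP.
- apply/seteqP; split=> // p _; have [x <-] := point_surj p.
  have ef : edge_of (mkseq (val x) n.+1) \in full_expansion n.
    by apply: edge_of_full; rewrite ?size_mkseq //; exact: Omega_valid.
  exists (edge_of (mkseq (val x) n.+1)); first exact: ef.
  by exists x => //; rewrite name_edge_of //; exact: begins_mkseq.
- move=> e f en fn ef; apply/seteqP; split=> // p [ep fp]; exfalso.
  have [x xp] := point_surj p.
  pose U := (cell e)° `&` (cell f)°.
  have oU : open U by apply: openI; exact: open_interior.
  have : nbhs x (point_of @^-1` U).
    apply: open_nbhs_nbhs; split; first exact: oU.
    by rewrite /U /= xp.
  move=> /nbhs_cylinder[m hm].
  have [y yb gy] := generic_point (Omega_valid x m).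
  have [/interior_subset[z bz zy] /interior_subset[t bt ty]] : U (point_of y).
    apply: hm; apply: (@mkseq_prefix _ _ _ m.+1) => //.
    by rewrite -[RHS]yb /initial_word size_mkseq.
  have [E1 E2] := (generic_eq gy (esym zy), generic_eq gy (esym ty)); subst z t.
  have [se _ eE] := nm e en; have [sf _ fE] := nm f fn.
  move/eqP: ef; apply; rewrite eE fE; congr edge_of.
  by rewrite -bz -bt se sf.
Qed.

(** Since generic streams have one-point classes, an edge of a deep enough
    graph descends from an edge of any given cellular partition. *)
Lemma airplane_groupP (f : homeo airplane) :
  airplane_group f <-> exists n, level_acts f n.
Proof.
split=> [[P [Pe cov _] h]|[n h]].
  exists (\max_(e <- P) size (name e)) => u vu su.
  have [x bx gx] := generic_point vu.
  have [e eP [y by_ yx]] : (\bigcup_(e in [set` P]) cell e) (point_of x) by rewrite cov.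
  have {yx} := generic_eq gx (esym yx) => E; subst y.
  have le : size (name e) <= size u.
    by rewrite su leqW //; apply: leq_bigmax_seq.
  have /prefixP[w uE] := begins_comparable by_ bx le; subst u.
  have [e' [/is_edgeP[ve' e'E] ce can]] := h e eP.
  have /is_edgeP[ve eE] := Pe e eP.
  exists (name e' ++ w); apply: acts_cat => //; split=> //.
  by rewrite -!clr_edge_of ?valid_neq0 // -eE -e'E.
exists (full_expansion n); first exact: full_expansion_partition.
move=> e /mem_full_expansion[se ve eE].
have [v [_ vv cv can]] := h _ ve se; exists (edge_of v); split.
- exact: is_edge_of.
- by rewrite eE !clr_edge_of ?valid_neq0.
- by rewrite name_edge_of ?valid_neq0.
Qed.

Lemma airplane_group1 : airplane_group 1%g.
Proof. by apply/airplane_groupP; exists 0 => u vu _; exists u; exact: acts_id. Qed.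

Lemma airplane_groupM f g : airplane_group f -> airplane_group g ->
  airplane_group (f * g)%g.
Proof.
move=> /airplane_groupP[n hf] /airplane_groupP[m hg]; apply/airplane_groupP.
exists (m + n.+1) => u vu su.
have st : size (take m.+1 u) = m.+1 by rewrite size_takel // su ltnS leq_addr.
have vt : valid (take m.+1 u).
  by move: vu; rewrite -{1}(cat_take_drop m.+1 u) valid_cat -?size_eq0 ?st // => /andP[].
have [v gv] := hg _ vt st.
have gv' : acts g u (v ++ drop m.+1 u).
  by rewrite -{1}(cat_take_drop m.+1 u); apply: acts_cat gv _; rewrite cat_take_drop.
have [_ vv _ _] := gv'.
have [|w fw] := level_acts_ge hf vv; last by exists w; exact: acts_comp gv' fw.
by rewrite size_cat size_drop su subSS addKn ltn_addl // addnS.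
Qed.

(** The images of the cells of a level cover, so a generic stream of a deep
    cell witnesses that this cell lies in one of them. *)
Lemma airplane_groupV f : airplane_group f -> airplane_group f^-1%g.
Proof.
move=> /airplane_groupP[n hf]; apply/airplane_groupP.
have [im imP] : exists im : word -> word, forall u, valid u -> size u = n.+1 -> acts f u (im u).
  suff : forall u, exists v, valid u -> size u = n.+1 -> acts f u v by move=> H; have [im] := boolp.choice H; exists im.
  move=> u.
  have [vu|] := boolP (valid u); last by exists [::].
  have [su|] := eqVneq (size u) n.+1; last by move=> su; exists [::] => _ /eqP; rewrite (negPf su).
  by have [v] := hf u vu su; exists v.
exists (\max_(e <- full_expansion n) size (im (name e))) => v vv sv.
have [y by_ gy] := generic_point vv.
have [x xE] := point_surj (homeo_inv f (point_of y)).
pose u := mkseq (val x) n.+1.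
have vu : valid u := Omega_valid x n.
have su : size u = n.+1 by rewrite size_mkseq.
have fu := imP u vu su.
have [y' c E] := acts_image fu (begins_mkseq (val x) n.+1).
have {E} E : y = y' by apply: generic_eq; rewrite // -E xE homeo_invK.
subst y'.
have le : size (im u) <= size v.
  rewrite sv leqW // -{1}[u]name_edge_of //.
  by apply: (@leq_bigmax_seq _ _ xpredT (fun e => size (im (name e)))) => //; exact: edge_of_full.
have [_ bi _] := c.
have /prefixP[w vE] := begins_comparable bi by_ le.
exists (u ++ w); rewrite vE; apply: acts_inv; apply: acts_cat => //.
have [_ vi ui _] := fu; apply: (valid_swap vi vu) => //.
by rewrite -vE.
Qed.

(** * Homeomorphisms given by tables of cells *)

(** A cell meets the rest of the limit space only at the ends of its edge. *)
Lemma tends_frontier (x y : Omega) u p : u != [::] -> tends (val x) p -> tends (val y) p ->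
  begins u (val x) -> ~ begins u (val y) -> p \in wends u.
Proof.
move=> u0 lx [N hN] bu nbu.
have su : (size u).-1.+1 = size u by rewrite prednK // lt0n size_eq0.
have [|[m [k [um pE]]]] := tends_wends (size u).-1 lx; first by rewrite su (beginsE bu).
case: nbu.
have := hN N (leqnn N); rewrite pE => /(wends_fresh (mkseq_neq0 _ _))[a [z E]].
apply: (@begins_prefix _ (mkseq (val y) N.+1)); last exact: begins_mkseq.
rewrite E; apply: prefix_trans (prefix_prefix _ _).
by apply: (begins_comparable bu (begins_mkseq _ _)); rewrite size_mkseq -su.
Qed.

Lemma edge_of_loopless w : valid w -> src (edge_of w) != tgt (edge_of w).
Proof.
elim/last_ind: w => // w a IH.
have [->|w0] := eqVneq w [::]; first by case: a.
rewrite valid_rcons // => /andP[vw fa]; rewrite edge_of_rcons //.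
have fr k : (New (name (edge_of w)) k \in wends w) = false.
  by rewrite name_edge_of // wends_nofresh.
have frs k : src (edge_of w) != New (name (edge_of w)) k.
  by apply: contraFneq (fr k) => <-; rewrite /ends inE eqxx.
have frt k : tgt (edge_of w) != New (name (edge_of w)) k.
  by apply: contraFneq (fr k) => <-; rewrite /ends !inE eqxx orbT.
move: (edge_of w) frs frt => e frs frt {fr IH vw}.
case: a fa; case: (wcol w) => // _.
- exact: frs.
- by have := frt nm; rewrite eq_sym.
- by apply/eqP; case.
- by have := frs nx; rewrite eq_sym.
- by have := frt ny; rewrite eq_sym.
- by apply/eqP; case.
- by apply/eqP; case.
Qed.

(** The vertex corresponding to [p] when the cell of [u] is copied onto the
    cell of [v]. *)
Definition move_vertex (u v : word) (p : vertex) : vertex :=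
  if p == src (edge_of u) then src (edge_of v)
  else if p == tgt (edge_of u) then tgt (edge_of v)
  else if p is New s k then New (v ++ drop (size u) s) k else p.

Lemma move_vertexE u v w : valid u -> valid v -> wcol u = wcol v -> valid (u ++ w) ->
  src (edge_of (v ++ w)) = move_vertex u v (src (edge_of (u ++ w))) /\
  tgt (edge_of (v ++ w)) = move_vertex u v (tgt (edge_of (u ++ w))).
Proof.
move=> vu vv uv.
have u0 := valid_neq0 vu; have v0 := valid_neq0 vv.
elim/last_ind: w => [|w a IH].
  rewrite !cats0 /move_vertex !eqxx => _; split=> //.
  by rewrite eq_sym (negPf (edge_of_loopless vu)).
have uw0 : u ++ w != [::] by case: (u) u0.
have vw0 : v ++ w != [::] by case: (v) v0.
rewrite -!rcons_cat valid_rcons // => /andP[vuw fa].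
rewrite !edge_of_rcons //.
have [Es Et] := IH vuw.
have new k : New (v ++ w) k = move_vertex u v (New (u ++ w) k).
  rewrite /move_vertex; case: eqP => [E|_].
    have : New (u ++ w) k \in wends u by rewrite E /ends inE eqxx.
    by move=> /(wends_fresh_size u0); rewrite size_cat ltnNge leq_addr.
  case: eqP => [E|_]; last by rewrite drop_size_cat.
  have : New (u ++ w) k \in wends u by rewrite E /ends !inE eqxx orbT.
  by move=> /(wends_fresh_size u0); rewrite size_cat ltnNge leq_addr.
by case: (a) => /=; rewrite ?name_edge_of // -?new -?Es -?Et.
Qed.

Lemma tends_copies u v x y p : valid u -> valid v -> wcol u = wcol v ->
  copies u v x y -> tends (val x) p -> tends (val y) (move_vertex u v p).
Proof.
move=> vu vv uv [bu bv c] [N hN].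
have s0 : size v = (size v).-1.+1 by rewrite prednK // lt0n size_eq0 valid_neq0.
have t0 : size u = (size u).-1.+1 by rewrite prednK // lt0n size_eq0 valid_neq0.
exists ((size v).-1 + N) => m le.
have [k kE] : exists k, m = (size v).-1 + (N + k).
  by exists (m - ((size v).-1 + N)); rewrite addnA subnKC.
pose z := mkseq (fun k => val x (size u + k)) (N + k).
have Ex : mkseq (val x) ((size u).-1 + (N + k)).+1 = u ++ z.
  by rewrite -addSn -t0 mkseq_add (beginsE bu).
have Ey : mkseq (val y) m.+1 = v ++ z.
  rewrite kE -addSn -s0 mkseq_add (beginsE bv); congr (_ ++ _).
  by apply: eq_map => i; rewrite c.
have vz : valid (u ++ z) by rewrite -Ex; exact: Omega_valid.
have := hN ((size u).-1 + (N + k)); rewrite Ex Ey addnCA leq_addr => /(_ isT).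
have [E1 E2] := move_vertexE vu vv uv vz.
by rewrite /ends !inE E1 E2 => /orP[] /eqP ->; rewrite eqxx ?orbT.
Qed.

(** ** Continuity of maps defined on streams *)

(** A map of the limit space which is locally, on streams, equal to continuous
    maps is continuous: cylinders need not be neighbourhoods in the quotient,
    but continuity can be tested on streams. *)
Lemma lift_continuous (F : airplane -> airplane) :
  (forall x : Omega, exists n, exists g : airplane -> airplane,
     {for point_of x, continuous g} /\
     forall y : Omega, mkseq (val y) n = mkseq (val x) n ->
       F (point_of y) = g (point_of y)) ->
  continuous F.
Proof.
move=> h; apply/quotient_continuous => x V.
have [n [g [cg E]]] := h x.
rewrite /= (E x erefl) => /cg gV.
have : nbhs x (point_of @^-1` (g @^-1` V)) by apply: pi_continuous gV.
move=> /nbhs_cylinder[m hm]; apply/nbhs_cylinder; exists (maxn n m) => y yx.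
rewrite /= E; first by apply: hm; apply: mkseq_prefix yx; exact: leq_maxr.
by apply: mkseq_prefix yx; exact: leq_maxl.
Qed.

Lemma copies_continuous (F : airplane -> airplane) :
  (forall x : Omega, exists u v : word, begins u (val x) /\
     forall y, begins u (val y) ->
       exists2 z, copies u v y z & F (point_of y) = point_of z) ->
  continuous F.
Proof.
move=> h; apply/quotient_continuous => x V.
have [u [v [bu uv]]] := h x.
have [z cz Ez] := uv x bu; rewrite /= Ez.
move=> /(@pi_continuous _ _ z) /nbhs_cylinder[m hm]; apply/nbhs_cylinder.
exists (size u + m) => y yx.
have by_ : begins u (val y).
  by rewrite /begins /initial_word (mkseq_prefix _ yx) ?leq_addr.
have [t ct Et] := uv y by_; rewrite /= Et; apply: (hm t).
case: cz => _ bz hz; case: ct => _ bt ht.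
apply: (@mkseq_prefix _ _ _ (size v + m)); first exact: leq_addl.
rewrite !mkseq_add (beginsE bz) (beginsE bt); congr (_ ++ _).
rewrite -(eq_mkseq hz m) -(eq_mkseq ht m).
by move: yx; rewrite !mkseq_add (beginsE bu) (beginsE by_) => /eqP;
  rewrite eqseq_cat // => /andP[_ /eqP].
Qed.

(** ** Tables *)

Definition table := seq (word * word).

Definition children (w : word) : seq word :=
  [seq rcons w a | a <- [:: r1; r2; rs; bm; bp; bu; bd] & fits (wcol w) a].

Definition root_words : seq word := [:: [:: eL]; [:: eR]; [:: eU]; [:: eD]].

(** A decidable form of the statement that each stream starting by [w] has a
    prefix satisfying [P], found within [n] letters after [w]. *)
Fixpoint bars (n : nat) (P : pred word) (w : word) : bool :=
  if P w then true
  else if n is n'.+1 then all (bars n' P) (children w) else false.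

Lemma childrenP w a : (rcons w a \in children w) = fits (wcol w) a.
Proof.
apply/mapP/idP => [[b + /rcons_inj[->]]|fa]; first by rewrite mem_filter => /andP[].
by exists a => //; rewrite mem_filter fa; case: a fa; case: (wcol w).
Qed.

Lemma barsP n P w (x : Omega) : valid w -> begins w (val x) -> bars n P w ->
  exists w', [/\ valid w', begins w' (val x) & P w'].
Proof.
elim: n w => [|n IH] w vw bw /=; case: ifP => [Pw|] //; try by exists w.
move=> _ /allP h; have w0 := valid_neq0 vw.
have s0 : (size w).-1.+1 = size w by rewrite prednK // lt0n size_eq0.
pose a := val x (size w).
have fa : fits (wcol w) a.
  by have := Omega_fits x (size w).-1; rewrite s0 beginsE.
apply: (IH (rcons w a)).
- by rewrite valid_rcons // vw.
- by rewrite /begins /initial_word size_rcons mkseqSr beginsE.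
- by apply: h; rewrite childrenP.
Qed.

Lemma rootsP (x : Omega) n P : all (bars n P) root_words ->
  exists w, [/\ valid w, begins w (val x) & P w].
Proof.
move=> /allP h.
have rx : is_root (val x 0) by have := Omega_valid x 0; rewrite /= andbT.
apply: (@barsP n P [:: val x 0]) => //; first by rewrite /= [is_root _]rx.
by apply: h; move: (val x 0) rx; case => //; rewrite !inE ?eqxx ?orbT.
Qed.

Definition swap (T : table) : table := [seq (uv.2, uv.1) | uv <- T].

Definition end_map (u v : word) (p : vertex) : vertex :=
  if p == src (edge_of u) then src (edge_of v) else tgt (edge_of v).

(** Entries of a table have disjoint source cells, except for their common
    vertices, which have to be sent to the same vertices. *)
Definition compatible (uv uv' : word * word) : bool :=
  (uv == uv') ||
  [&& ~~ prefix uv.1 uv'.1 & all (fun p => (p \in wends uv'.1) ==>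
      (end_map uv.1 uv.2 p == end_map uv'.1 uv'.2 p)) (wends uv.1)].

(** The conditions for a table to define a map; it is bijective when the table
    read backwards satisfies them too. *)
Definition half_table (n : nat) (T : table) : bool :=
  [&& all (fun uv => [&& valid uv.1, valid uv.2 & wcol uv.1 == wcol uv.2]) T,
      all (bars n (fun w => w \in unzip1 T)) root_words &
      all (fun uv => all (compatible uv) T) T].

Definition is_table n T := half_table n T && half_table n (swap T).

Definition realizes_table (f : airplane -> airplane) (T : table) : Prop :=
  forall uv, uv \in T -> acts f uv.1 uv.2.

(** Glued streams converge to the same vertex, and when they belong to different
    cells this is a common end of the two edges: compatibility of the table at the
    ends of its edges is enough for the map to be defined on the limit space. *)
Lemma half_table_map n T : half_table n T ->
  exists2 f, continuous f & realizes_table f T.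
Proof.
move=> /and3P[/allP valT cov /allP comp0].
have comp uv uv' : uv \in T -> uv' \in T -> compatible uv uv'.
  by move=> /comp0/allP h /h.
have val1 uv : uv \in T -> [/\ valid uv.1, valid uv.2 & wcol uv.1 = wcol uv.2].
  by move=> /valT /and3P[-> -> /eqP].
pose R (x y : Omega) := exists2 uv, uv \in T & copies uv.1 uv.2 x y.
have Rex (x : Omega) : exists2 uv, uv \in T & begins uv.1 (val x).
  have [w [vw bw /mapP[uv uvT wE]]] := rootsP x cov; exists uv => //.
  by rewrite -wE.
have glueR x x' y y' : R x y -> R x' y' -> glue x x' -> glue y y'.
  move=> [uv uvT c] [uv' uvT' c'] g.
  have [v1 v2 v12] := val1 _ uvT; have [v1' v2' v12'] := val1 _ uvT'.
  have [E|[p [tx tx']]] := glue_cases g.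
    subst x'; have Euv : uv = uv'.
      have [b _ _] := c; have [b' _ _] := c'.
      case/orP: (leq_total (size uv.1) (size uv'.1)) => le.
        have /orP[/eqP //|/andP[]] := comp _ _ uvT uvT'.
        by rewrite (begins_comparable b b' le).
      have /orP[/eqP //|/andP[]] := comp _ _ uvT' uvT.
      by rewrite (begins_comparable b' b le).
    subst uv'; have -> : y = y' by apply: copies_inj (copies_sym c) (copies_sym c').
    exact: glue_refl.
  have ty := tends_copies v1 v2 v12 c tx.
  have ty' := tends_copies v1' v2' v12' c' tx'.
  have /orP[/eqP E|] := comp _ _ uvT uvT'.
    by subst uv'; exact: tends_glue ty ty'.
  move=> /andP[npre /allP agree].
  have /orP[/eqP E|] := comp _ _ uvT' uvT.
    by subst uv'; exact: tends_glue ty ty'.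
  move=> /andP[npre' _].
  have [b _ _] := c; have [b' _ _] := c'.
  have nb : ~ begins uv.1 (val x').
    move=> b1; case/orP: (leq_total (size uv.1) (size uv'.1)) => le.
      by rewrite (begins_comparable b1 b' le) in npre.
    by rewrite (begins_comparable b' b1 le) in npre'.
  have nb' : ~ begins uv'.1 (val x).
    move=> b1; case/orP: (leq_total (size uv.1) (size uv'.1)) => le.
      by rewrite (begins_comparable b b1 le) in npre.
    by rewrite (begins_comparable b1 b le) in npre'.
  have pu := tends_frontier (valid_neq0 v1) tx tx' b nb.
  have pu' := tends_frontier (valid_neq0 v1') tx' tx b' nb'.
  have me (u v : word) : p \in wends u -> move_vertex u v p = end_map u v p.
    by rewrite /ends !inE /move_vertex /end_map; case: eqP => // _ /= ->.
  have /implyP/(_ pu')/eqP E := agree p pu.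
  by rewrite me // E -me // in ty; exact: tends_glue ty ty'.
have Rtot (x : Omega) : exists y, R x y.
  have [uv uvT b] := Rex x; have [v1 v2 v12] := val1 _ uvT.
  by have [y c] := transfer (valid_neq0 v1) v2 v12 b; exists y, uv.
have [h hR] := boolp.choice Rtot.
pose f (p : airplane) : airplane := point_of (h (repr p)).
have fE x y : R x y -> f (point_of x) = point_of y.
  move=> xy; apply/point_ofP; apply: glueR (hR _) xy _.
  by apply/point_ofP; exact: reprK.
have fT : realizes_table f T.
  move=> uv uvT; have [v1 v2 v12] := val1 _ uvT.
  by apply: actsP => // x y c; apply: fE; exists uv.
exists f => //; apply: copies_continuous => x.
have [uv uvT b] := Rex x; exists uv.1, uv.2; split=> // y by_.
exact: acts_image (fT _ uvT) by_.
Qed.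

Lemma table_homeo n T : is_table n T -> exists f : homeo airplane, realizes_table f T.
Proof.
move=> /andP[hT hS].
have [f cf fT] := half_table_map hT.
have [g cg gS] := half_table_map hS.
have cancels n' T' (f' g' : airplane -> airplane) : half_table n' T' ->
    realizes_table f' T' -> realizes_table g' (swap T') -> cancel f' g'.
  move=> /and3P[_ cov _] fT' gT' p; have [x <-] := point_surj p.
  have [w [vw bw /mapP[uv uvT wE]]] := rootsP x cov; subst w.
  have [y c ->] := acts_image (fT' _ uvT) bw.
  apply: (acts_copies (u := uv.2) (v := uv.1)); last exact: copies_sym.
  by apply: (gT' (uv.2, uv.1)); apply/mapP; exists uv.
have sK : swap (swap T) = T.
  by rewrite /swap -map_comp -[RHS]map_id; apply: eq_map => -[].
exists (Homeo cf cg (cancels _ _ _ _ hT fT gS)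
  (cancels _ _ _ _ hS gS (eq_ind_r (realizes_table f) fT sK))).
exact: fT.
Qed.

(** ** Computing with tables *)

(** The image of [w] under the map given by [T], when [w] is small enough to lie
    in a cell of [T]; such partial maps on words are composed and compared by
    computation. *)
Definition subst (T : table) (w : word) : option word :=
  if [seq uv <- T | prefix uv.1 w] is uv :: _
  then Some (uv.2 ++ drop (size uv.1) w) else None.

Definition realizes (f : airplane -> airplane) (R : word -> option word) : Prop :=
  forall w w', valid w -> R w = Some w' -> acts f w w'.

Definition after (R S : word -> option word) (w : word) : option word :=
  obind R (S w).

Definition agree (n : nat) (R S : word -> option word) : bool :=
  all (bars n (fun w => (R w == S w) && isSome (R w))) root_words.

Lemma realizes_subst f T : realizes_table f T -> realizes f (subst T).
Proof.
move=> fT w w' vw; rewrite /subst.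
case E : (seq.filter _ T) => [|uv l] //.
have : uv \in seq.filter (fun uv => prefix uv.1 w) T by rewrite E mem_head.
rewrite mem_filter => /andP[/prefixP[z wE] uvT] [<-].
rewrite wE drop_size_cat // in vw *; exact: acts_cat (fT _ uvT) vw.
Qed.

Lemma realizes_inv (f : homeo airplane) T :
  realizes_table f T -> realizes (f^-1)%g (subst (swap T)).
Proof.
move=> fT; apply: realizes_subst => _ /mapP[uv uvT ->] /=.
by apply: acts_inv; exact: fT.
Qed.

Lemma realizes_mul (f g : homeo airplane) R S : realizes f R -> realizes g S ->
  realizes (f * g)%g (after R S).
Proof.
move=> fR gS w w' vw; rewrite /after; case E : (S w) => [v|//] /= Rv.
have gv := gS w v vw E; have [_ vv _ _] := gv.
exact: acts_comp gv (fR v w' vv Rv).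
Qed.

Lemma realizes1 : realizes (1%g : homeo airplane) (@Some word).
Proof. by move=> w w' vw [<-]; exact: acts_id. Qed.

Lemma acts_eq n (f g : homeo airplane) (P : pred word) :
  all (bars n P) root_words ->
  (forall w, valid w -> P w -> exists v, acts f w v /\ acts g w v) -> f = g.
Proof.
move=> cov h; apply: homeo_ext => p; have [x <-] := point_surj p.
have [w [vw bw Pw]] := rootsP x cov; have [v [fv gv]] := h w vw Pw.
by have [y c ->] := acts_image fv bw; rewrite (acts_copies gv c).
Qed.

Lemma realizes_eq n (f g : homeo airplane) R S :
  realizes f R -> realizes g S -> agree n R S -> f = g.
Proof.
move=> fR gS /acts_eq; apply=> w vw /andP[/eqP E].
case RE : (R w) => [v|//] _; exists v; split; first exact: fR.
by apply: gS; rewrite -?E.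
Qed.

Lemma table_group n (f : homeo airplane) T : is_table n T -> realizes_table f T ->
  airplane_group f.
Proof.
move=> /andP[/and3P[_ cov _] _] fT; apply/airplane_groupP.
exists (\max_(uv <- T) size uv.1) => w vw sw.
have [x bx _] := generic_point vw.
have [u [vu bu /mapP[uv uvT uE]]] := rootsP x cov; subst u.
have /prefixP[z wE] : prefix uv.1 w.
  apply: begins_comparable bu bx _; rewrite sw leqW //.
  exact: (@leq_bigmax_seq _ _ xpredT (fun uv => size uv.1)).
by exists (uv.2 ++ z); rewrite wE in vw *; exact: acts_cat (fT _ uvT) vw.
Qed.

(** ** The generators *)

(** [rho] is the half turn of the central circle. Reading this circle from [a] to
    [b] along [eD] and back along [eU], as the unit interval with ends glued,
    [alpha] doubles the quarter [eD r_1] and halves [eU], and [beta] is its copy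
    in [eU]: up to inverses, these are the standard generators of Thompson's
    group F. The translation [kappa] goes from [eL] to [eR] and takes the central
    circle to the circle of [eR]; the circle of [eL] becomes the central one. *)
Definition rho_table : table :=
  [:: ([:: eL], [:: eR]); ([:: eR], [:: eL]); ([:: eU], [:: eD]); ([:: eD], [:: eU])].

Definition alpha_table : table :=
  [:: ([:: eL], [:: eL]); ([:: eD; r1], [:: eD]); ([:: eD; rs], [:: eR]);
      ([:: eD; r2], [:: eU; r1]); ([:: eR], [:: eU; rs]); ([:: eU], [:: eU; r2])].

Definition beta_table : table :=
  [:: ([:: eL], [:: eL]); ([:: eR], [:: eR]); ([:: eD], [:: eD]);
      ([:: eU; r1; r1], [:: eU; r1]); ([:: eU; r1; rs], [:: eU; rs]);
      ([:: eU; r1; r2], [:: eU; r2; r1]); ([:: eU; rs], [:: eU; r2; rs]);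
      ([:: eU; r2], [:: eU; r2; r2])].

Definition reversal (u v : word) : table :=
  [:: (rcons u bm, rcons v bp); (rcons u bp, rcons v bm);
      (rcons u bu, rcons v bd); (rcons u bd, rcons v bu)].

Definition kappa_table : table :=
  [:: ([:: eL; bp], [:: eL]); ([:: eL; bu], [:: eD]); ([:: eL; bd], [:: eU]);
      ([:: eU], [:: eR; bu]); ([:: eD], [:: eR; bd]); ([:: eR], [:: eR; bp])]
  ++ reversal [:: eL; bm] [:: eR; bm].

Definition eps_table : table :=
  [:: ([:: eL], [:: eL]); ([:: eU], [:: eU]); ([:: eD], [:: eD]);
      ([:: eR; bm; bp], [:: eR; bm]); ([:: eR; bm; bd], [:: eR; bu]);
      ([:: eR; bm; bu], [:: eR; bd]); ([:: eR; bu], [:: eR; bp; bu]);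
      ([:: eR; bd], [:: eR; bp; bd]); ([:: eR; bp], [:: eR; bp; bp])]
  ++ reversal [:: eR; bm; bm] [:: eR; bp; bm].

Lemma rho_tableP : is_table 4 rho_table. Proof. by vm_compute. Qed.
Lemma alpha_tableP : is_table 4 alpha_table. Proof. by vm_compute. Qed.
Lemma beta_tableP : is_table 4 beta_table. Proof. by vm_compute. Qed.
Lemma kappa_tableP : is_table 4 kappa_table. Proof. by vm_compute. Qed.
Lemma eps_tableP : is_table 4 eps_table. Proof. by vm_compute. Qed.

Definition rho := sval (cid (table_homeo rho_tableP)).
Definition alpha := sval (cid (table_homeo alpha_tableP)).
Definition beta := sval (cid (table_homeo beta_tableP)).
Definition kappa := sval (cid (table_homeo kappa_tableP)).
Definition epsilon := sval (cid (table_homeo eps_tableP)).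

Lemma rhoP : realizes_table rho rho_table.
Proof. exact: svalP (cid (table_homeo rho_tableP)). Qed.
Lemma alphaP : realizes_table alpha alpha_table.
Proof. exact: svalP (cid (table_homeo alpha_tableP)). Qed.
Lemma betaP : realizes_table beta beta_table.
Proof. exact: svalP (cid (table_homeo beta_tableP)). Qed.
Lemma kappaP : realizes_table kappa kappa_table.
Proof. exact: svalP (cid (table_homeo kappa_tableP)). Qed.
Lemma epsilonP : realizes_table epsilon eps_table.
Proof. exact: svalP (cid (table_homeo eps_tableP)). Qed.

Ltac realize :=
  repeat first [apply: realizes_mul | exact: realizes1
    | exact: (realizes_subst rhoP) | exact: (realizes_inv rhoP)
    | exact: (realizes_subst alphaP) | exact: (realizes_inv alphaP)
    | exact: (realizes_subst betaP) | exact: (realizes_inv betaP)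
    | exact: (realizes_subst kappaP) | exact: (realizes_inv kappaP)
    | exact: (realizes_subst epsilonP) | exact: (realizes_inv epsilonP)].

(** The elements occurring below have prefixes of length at most 6 on which the
    two sides can be computed and compared. *)
Ltac check_equation :=
  eapply (@realizes_eq 5); [realize | realize | by vm_compute].

Local Open Scope group_scope.

Lemma rho_square : rho * rho = 1. Proof. check_equation. Qed.

Lemma rho_alpha_cube : rho * alpha^-1 * (rho * alpha^-1) * (rho * alpha^-1) = 1.
Proof. check_equation. Qed.

(** Both [alpha] and [beta] carry a subdivision of the first edge of an arc to a
    subdivision of its last edge, and they can be seen on an arc of three edges:
    [eD], [eU r_1], [eU r_2] for [alpha]. Moving the subdivided edge by two steps
    amounts to moving it by one step twice, and each step is conjugate to
    [beta]. *)
Lemma alpha_split : alpha = beta * ((alpha * rho) * beta * (rho * alpha^-1)).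
Proof. check_equation. Qed.

(** The same, for the arc [eU r_1], [eU r_2 r_1], [eU r_2 r_2]. *)
Lemma beta_split : beta = (alpha * beta * alpha^-1) *
  ((rho * alpha^-1) * beta^-1 * (alpha * rho) * beta * ((rho * alpha^-1) * beta * (alpha * rho))).
Proof. check_equation. Qed.

(** [kappa] and [epsilon] have the same action near the tip of [eR], so that
    their quotient is supported away from this tip, in the image of the cell of
    [eL] by [kappa^2]; there it is a copy of [epsilon^-1]. *)
Lemma kappa_epsilon :
  kappa * epsilon^-1 = kappa * kappa * (rho * epsilon^-1 * rho) * kappa^-1 * kappa^-1.
Proof. check_equation. Qed.

Lemma epsilon_is_epsilon : is_epsilon epsilon.
Proof.
have h u v : (u, v) \in eps_table -> canonical_on epsilon u v.
  by move=> /epsilonP[].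
by split; split; try exact: h; split; exact: h.
Qed.

Lemma is_epsilon_table (f : airplane -> airplane) : is_epsilon f -> realizes_table f eps_table.
Proof.
move=> [[h1 h2 h3] [h4 h5 h6 [h7 h8 h9 h10]] [h11 h12 h13]] uv.
rewrite /eps_table !inE /=.
do 12?[case/predU1P => [->|]]; last move/eqP=> ->; by split.
Qed.

Lemma is_epsilon_uniq (f : homeo airplane) : is_epsilon f -> f = epsilon.
Proof.
move=> /is_epsilon_table fT.
by apply: (@realizes_eq 5) (realizes_subst fT) (realizes_subst epsilonP) _; vm_compute.
Qed.

(** * Subgroups of an abstract group *)

Lemma subgroupP (gT : groupType) (H : set gT) :
  subgroup H <-> H 1 /\ forall x y, H x -> H y -> H (x * y^-1).
Proof.
split=> [[h1 hd]|[h1 hd]].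
  split=> [|x y Hx Hy]; first exact: set_mem h1.
  by apply: set_mem; apply: hd; exact: mem_set.
by split=> [|x y /set_mem Hx /set_mem Hy]; apply: mem_set => //; exact: hd.
Qed.

Lemma subgroup1 (gT : groupType) (H : set gT) : subgroup H -> H 1.
Proof. by case/subgroupP. Qed.

Lemma subgroupV (gT : groupType) (H : set gT) x : subgroup H -> H x -> H x^-1.
Proof. by case/subgroupP => h1 hd Hx; rewrite -[x^-1]mul1g; exact: hd. Qed.

Lemma subgroupM (gT : groupType) (H : set gT) x y :
  subgroup H -> H x -> H y -> H (x * y).
Proof.
move=> sH Hx Hy; have [_ hd] := (subgroupP H).1 sH.
by have := hd x y^-1 Hx (subgroupV sH Hy); rewrite invgK.
Qed.

Lemma subgroupJ (gT : groupType) (H : set gT) x y :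
  subgroup H -> H x -> H y -> H (x ^ y).
Proof. by move=> sH Hx Hy; rewrite conjgE; do ?apply: subgroupM => //; exact: subgroupV. Qed.

Lemma generated_subgroup (gT : groupType) (S : set gT) : subgroup (generated S).
Proof.
apply/subgroupP; split=> [A [/subgroup1]//|x y hx hy A [sA SA]].
by case/subgroupP: (sA) => _; apply; [apply: hx|apply: hy].
Qed.

Lemma generated_min (gT : groupType) (S H : set gT) :
  subgroup H -> S `<=` H -> generated S `<=` H.
Proof. exact: smallest_sub. Qed.

Lemma generated_sub (gT : groupType) (S : set gT) : S `<=` generated S.
Proof. move=> x Sx A [_]; exact. Qed.

Lemma commutator_sub (gT : groupType) (G : set gT) :
  subgroup G -> commutator_subgroup G `<=` G.
Proof.
move=> sG; apply: generated_min => // _ [x Gx [y Gy <-]].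
by rewrite commgEl; apply: (subgroupM sG); [exact: subgroupV|exact: subgroupJ].
Qed.

Lemma commutator_mem (gT : groupType) (G : set gT) x y :
  G x -> G y -> commutator_subgroup G [~ x, y].
Proof. by move=> Gx Gy; apply: generated_sub; exists x => //; exists y. Qed.

Lemma commutator_normal (gT : groupType) (G : set gT) n g : subgroup G ->
  commutator_subgroup G n -> G g -> commutator_subgroup G (n ^ g).
Proof.
move=> sG hn Gg; have sD := generated_subgroup [set [~ x, y] | x in G & y in G].
suff : commutator_subgroup G `<=` [set n | commutator_subgroup G (n ^ g)] by apply.
apply: generated_min.
  apply/subgroupP; split=> [|x y /= hx hy]; rewrite /= ?conj1g.
    exact: subgroup1 sD.
  by rewrite conjMg conjVg; apply: (subgroupM sD) => //; exact: (subgroupV sD).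
by move=> _ [x Gx [y Gy <-]] /=; rewrite conjRg; apply: commutator_mem; exact: subgroupJ.
Qed.

Lemma cyclic_sub (gT : groupType) (G : set gT) x : subgroup G -> G x ->
  cyclic_subgroup x `<=` G.
Proof. by move=> sG Gx; apply: generated_min => // _ ->. Qed.

(** The subgroup generated by [x] and by the commutators of [G]. *)
Definition extension (gT : groupType) (G : set gT) (x : gT) : set gT :=
  [set n * h | n in commutator_subgroup G & h in cyclic_subgroup x].

Lemma extension_commutator (gT : groupType) (G : set gT) (x : gT) :
  commutator_subgroup G `<=` extension G x.
Proof.
move=> n hn; exists n => //; exists 1; last exact: mulg1.
exact: (subgroup1 (generated_subgroup _)).
Qed.

Lemma extension_gen (gT : groupType) (G : set gT) (x : gT) : extension G x x.
Proof.
exists 1; first exact: subgroup1 (generated_subgroup _).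
by exists x; [exact: generated_sub|exact: mul1g].
Qed.

Lemma extension_sub (gT : groupType) (G : set gT) x : subgroup G -> G x ->
  extension G x `<=` G.
Proof.
move=> sG Gx _ [n hn [h hh <-]]; apply: (subgroupM sG).
  exact: commutator_sub hn.
exact: cyclic_sub hh.
Qed.

Lemma extension_subgroup (gT : groupType) (G : set gT) x : subgroup G -> G x ->
  subgroup (extension G x).
Proof.
move=> sG Gx; have sD := generated_subgroup [set [~ x, y] | x in G & y in G].
have sC := generated_subgroup [set x].
apply/subgroupP; split; first by apply: extension_commutator; exact: (subgroup1 sD).
move=> _ _ [n hn [h hh <-]] [m hm [k hk <-]].
have Gh : G (h * k^-1) by apply: (cyclic_sub sG Gx); apply: (subgroupM sC) => //; exact: (subgroupV sC).
exists (n * (m^-1) ^ (h * k^-1)^-1).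
  apply: (subgroupM sD) => //; apply: commutator_normal => //; last exact: (subgroupV sG).
  exact: (subgroupV sD).
exists (h * k^-1); first by apply: (subgroupM sC) => //; exact: (subgroupV sC).
have -> : n * h * (m * k)^-1 = n * (h * k^-1) * m^-1 by rewrite invgM !mulgA.
by move: (h * k^-1) => y; rewrite conjgE invgK -!mulgA mulVg mulg1.
Qed.

Lemma extension_normal (gT : groupType) (G : set gT) x g n : subgroup G -> G x ->
  extension G x n -> G g -> extension G x (n ^ g).
Proof.
move=> sG Gx Nn Gg; have sN := extension_subgroup sG Gx.
rewrite -[n ^ g]mul1g -(mulgV n) -mulgA -commgEl; apply: (subgroupM sN) => //.
apply: extension_commutator; apply: commutator_mem => //.
exact: extension_sub Nn.
Qed.

(** * The subgroup generated by [epsilon] and the commutators *)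

Lemma airplane_subgroup : subgroup airplane_group.
Proof.
apply/subgroupP; split=> [|f g Gf Gg]; first exact: airplane_group1.
by apply: airplane_groupM => //; exact: airplane_groupV.
Qed.

Lemma rho_group : airplane_group rho.
Proof. exact: table_group rho_tableP rhoP. Qed.
Lemma alpha_group : airplane_group alpha.
Proof. exact: table_group alpha_tableP alphaP. Qed.
Lemma beta_group : airplane_group beta.
Proof. exact: table_group beta_tableP betaP. Qed.
Lemma kappa_group : airplane_group kappa.
Proof. exact: table_group kappa_tableP kappaP. Qed.
Lemma epsilon_group : airplane_group epsilon.
Proof. exact: table_group eps_tableP epsilonP. Qed.

Definition mod_epsilon : set (homeo airplane) := extension airplane_group epsilon.
Local Notation N := mod_epsilon.

Lemma N_subgroup : subgroup N.
Proof. exact: extension_subgroup airplane_subgroup epsilon_group. Qed.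

Lemma N_group f : N f -> airplane_group f.
Proof. exact: extension_sub airplane_subgroup epsilon_group f. Qed.

Lemma N1 : N 1. Proof. exact: subgroup1 N_subgroup. Qed.
Lemma NM f g : N f -> N g -> N (f * g). Proof. exact: subgroupM N_subgroup. Qed.
Lemma NV f : N f -> N f^-1. Proof. exact: subgroupV N_subgroup. Qed.

Lemma NJ f g : N f -> airplane_group g -> N (f ^ g).
Proof. exact: extension_normal airplane_subgroup epsilon_group. Qed.

Lemma NJV f g : N f -> airplane_group g -> N (g * f * g^-1).
Proof.
move=> Nf Gg; have := NJ Nf (airplane_groupV Gg).
by rewrite conjgE invgK mulgA.
Qed.

Lemma NJK f g : N (g * f * g^-1) -> airplane_group g -> N f.
Proof.
by move=> h Gg; have := NJ h Gg; rewrite conjgE !mulgA mulVg mul1g mulgVK.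
Qed.

Lemma NR f g : airplane_group f -> airplane_group g -> N [~ f, g].
Proof. by move=> Gf Gg; apply: extension_commutator; exact: commutator_mem. Qed.

Lemma epsilon_N : N epsilon. Proof. exact: extension_gen. Qed.

Lemma rho_inv : rho^-1 = rho.
Proof. by rewrite -[LHS]mulg1 -rho_square mulgA mulVg mul1g. Qed.

Lemma kappa_N : N kappa.
Proof.
have := kappa_epsilon => /(congr1 (fun f => f * epsilon)); rewrite mulgVK => ->.
apply: NM epsilon_N; rewrite -mulgA -invgM.
apply: NJV; last exact: airplane_groupM kappa_group kappa_group.
by rewrite -{2}rho_inv; apply: NJV rho_group; exact: NV epsilon_N.
Qed.

(** By [beta_split], [beta] is the square of [beta] up to commutators, hence it
    is trivial up to commutators. *)
Lemma beta_N : N beta.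
Proof.
have Gra : airplane_group (alpha * rho) := airplane_groupM alpha_group rho_group.
pose t := (rho * alpha^-1) * beta * (alpha * rho).
have Gt : airplane_group t.
  apply: airplane_groupM Gra; apply: airplane_groupM beta_group.
  by apply: airplane_groupM rho_group _; exact: airplane_groupV alpha_group.
have E : (alpha * rho)^-1 = rho * alpha^-1 by rewrite invgM rho_inv.
have E' : (rho * alpha^-1)^-1 = alpha * rho by rewrite -E invgK.
have tV : (rho * alpha^-1) * beta^-1 * (alpha * rho) = t^-1.
  by rewrite /t [RHS]invgM [X in _ = _ * X]invgM E E' !mulgA.
have bt : beta = beta * [~ beta, alpha^-1] * beta ^ t.
  rewrite {1}beta_split tV -/t -[t^-1 * _ * _]mulgA -conjgE; congr (_ * _).
  by rewrite commgEl conjgE invgK !mulgA mulgV mul1g.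
have : N (beta ^ t).
  have -> : beta ^ t = [~ beta, alpha^-1]^-1.
    apply: (mulgI (beta * [~ beta, alpha^-1])).
    by rewrite -bt mulgK.
  by apply: NV; apply: NR beta_group _; exact: airplane_groupV alpha_group.
by move=> /NJ/(_ (airplane_groupV Gt)); rewrite conjgK.
Qed.

Lemma alpha_N : N alpha.
Proof.
rewrite alpha_split; apply: NM beta_N _.
have -> : rho * alpha^-1 = (alpha * rho)^-1 by rewrite invgM rho_inv.
apply: NJV beta_N _; exact: airplane_groupM alpha_group rho_group.
Qed.

(** Up to [alpha] and commutators, the relations give [rho^2 = rho^3 = 1]. *)
Lemma rho_N : N rho.
Proof.
have Nm : N (rho * alpha^-1 * rho^-1) := NJV (NV alpha_N) rho_group.
move: Nm; rewrite rho_inv => Nm.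
have -> : rho = alpha * (rho * alpha^-1 * rho)^-1 * alpha.
  have E : (rho * alpha^-1 * rho) * (alpha^-1 * rho * alpha^-1) = 1.
    by rewrite -rho_alpha_cube !mulgA.
  rewrite -[X in _ * X * _]mulg1 -E [X in _ * X * _]mulgA mulVg mul1g.
  by rewrite !mulgA mulgV mul1g mulgVK.
by apply: NM alpha_N; apply: NM alpha_N _; exact: NV.
Qed.

(** * Canonical and reversed actions *)

Definition opp (a : letter) : letter :=
  match a with bm => bp | bp => bm | bu => bd | bd => bu | _ => a end.

Lemma oppK a : opp (opp a) = a. Proof. by case: a. Qed.
Lemma fits_opp c a : fits c (opp a) = fits c a. Proof. by case: c; case: a. Qed.

(** [f] maps the cell of the blue edge [u] onto that of [v], exchanging ends. *)
Definition flips (f : airplane -> airplane) (u v : word) : Prop :=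
  [/\ valid u, valid v, wcol u = Blue, wcol v = Blue &
      forall a, fits Blue a -> acts f (rcons u a) (rcons v (opp a))].

(** Words for canonically or with reversal: [epsilon] itself sends
    [eR b_- b_-] to its image with reversal, and reversals have to be allowed in
    diagrams for [epsilon] not to increase their size. *)
Definition sacts f u v := acts f u v \/ flips f u v.

Lemma sacts_valid f u v : sacts f u v -> [/\ valid u, valid v & wcol u = wcol v].
Proof. by case=> [[]|[? ? -> ->]]. Qed.

Lemma sacts_rcons f u v a : sacts f u v -> valid (rcons u a) ->
  acts f (rcons u a) (rcons v a) \/ acts f (rcons u a) (rcons v (opp a)).
Proof.
move=> [fuv|[vu vv uB vB h]] va; first by left; exact: acts_rcons.
right; apply: h; move: va; rewrite valid_rcons ?valid_neq0 // uB.
by case/andP.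
Qed.

Lemma sacts_cat f u v a w : sacts f u v -> valid (u ++ a :: w) ->
  exists2 b, b = a \/ b = opp a & acts f (u ++ a :: w) (v ++ b :: w).
Proof.
move=> fuv; rewrite -cat_rcons => vw.
have va : valid (rcons u a) by move: vw; rewrite valid_cat -?size_eq0 ?size_rcons // => /andP[].
by have [h|h] := sacts_rcons fuv va; [exists a|exists (opp a)]; rewrite -?cat_rcons;
  [left|exact: acts_cat|right|exact: acts_cat].
Qed.

Lemma acts_children f u v : valid u -> valid v -> wcol u = wcol v ->
  (forall a, fits (wcol u) a -> acts f (rcons u a) (rcons v a)) -> acts f u v.
Proof.
move=> vu vv uv E; apply: actsP => // x y c; have [bu _ _] := c.
have u0 := valid_neq0 vu.
pose a := val x (size u).
have bux : begins (rcons u a) (val x).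
  by rewrite /begins /initial_word size_rcons mkseqSr (beginsE bu).
have fa : fits (wcol u) a by have [] := Omega_follows u0 bu; rewrite addn0.
by apply: (acts_copies (E a fa)); rewrite -!cats1 in bux *; exact: copies_cat.
Qed.

Lemma sacts_comp (f g : homeo airplane) u v w :
  sacts g u v -> sacts f v w -> sacts (f * g) u w.
Proof.
move=> [guv|[vu vv uB vB h]] [fvw|[vv' vw vB' wB h']].
- by left; exact: acts_comp guv fvw.
- have [vu _ uv _] := guv; right; split=> //; first by rewrite uv.
  move=> a fa; have va : valid (rcons u a) by rewrite valid_rcons ?valid_neq0 // vu uv vB'.
  exact: acts_comp (acts_rcons guv va) (h' a fa).
- have [_ vw vw' _] := fvw; right; split; rewrite -?vw' // => a fa.
  have va : valid (rcons v (opp a)) by rewrite valid_rcons ?valid_neq0 // vv vB fits_opp.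
  exact: acts_comp (h a fa) (acts_rcons fvw va).
- left; have E a : fits Blue a -> acts (f * g) (rcons u a) (rcons w a).
    move=> fa; rewrite -[a in rcons w a]oppK.
    by apply: acts_comp (h a fa) (h' (opp a) _); rewrite fits_opp.
  by apply: acts_children => //; [rewrite uB|move=> a; rewrite uB; exact: E].
Qed.

Lemma sacts_inv (f : homeo airplane) u v : sacts f u v -> sacts (f^-1)%g v u.
Proof.
move=> [fuv|[vu vv uB vB h]]; first by left; exact: acts_inv.
right; split=> // a fa; rewrite -[a in rcons v a]oppK.
by apply: acts_inv; apply: h; rewrite fits_opp.
Qed.

Lemma begins_rcons u (x : Omega) : u != [::] -> begins u (val x) ->
  exists2 a, fits (wcol u) a & begins (rcons u a) (val x).
Proof.
move=> u0 bu; exists (val x (size u)).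
  by have [] := Omega_follows u0 bu; rewrite addn0.
by rewrite /begins /initial_word size_rcons mkseqSr (beginsE bu).
Qed.

Lemma begins_rcons_l u a x : begins (rcons u a) x -> begins u x.
Proof. by rewrite -cats1 => /begins_catl. Qed.

Lemma sacts_image (f : homeo airplane) u v x : sacts f u v -> begins u (val x) ->
  exists2 y, begins v (val y) & f (point_of x) = point_of y.
Proof.
move=> [fuv|[vu vv uB vB h]] bu.
  by have [y [_ bv _] E] := acts_image fuv bu; exists y.
have [a fa ba] := begins_rcons (valid_neq0 vu) bu; rewrite uB in fa.
by have [y [_ /begins_rcons_l bv _] E] := acts_image (h a fa) ba; exists y.
Qed.

Lemma sacts_onto (f : homeo airplane) u v y : sacts f u v -> begins v (val y) ->
  exists2 x, begins u (val x) & f (point_of x) = point_of y.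
Proof.
move=> /sacts_inv h /(sacts_image h)[x bx E]; exists x => //.
by rewrite -E homeo_invK.
Qed.

(** * Transitivity on edges *)

(** The three kinds of edges, up to rearrangement and reversal, are the red
    edges, the blue edges which end at a tip, and the other blue edges. *)
Definition reachable (u : word) : Prop :=
  exists n, N n /\ (sacts n u [:: eU] \/ sacts n u [:: eR] \/ sacts n u [:: eR; bm]).

Lemma reachable_acts f u v : N f -> sacts f u v -> reachable v -> reachable u.
Proof.
move=> Nf fuv [n [Nn h]]; exists (n * f); split; first exact: NM.
by case: h => [h|[h|h]]; [left|right; left|right; right]; exact: sacts_comp fuv h.
Qed.

Lemma sacts1 u : valid u -> sacts (1 : homeo airplane) u u.
Proof. by move=> vu; left; exact: acts_id. Qed.

Lemma reachable_eU : reachable [:: eU].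
Proof. by exists 1; split; [exact: N1|left; exact: sacts1]. Qed.
Lemma reachable_eR : reachable [:: eR].
Proof. by exists 1; split; [exact: N1|right; left; exact: sacts1]. Qed.
Lemma reachable_eRbm : reachable [:: eR; bm].
Proof. by exists 1; split; [exact: N1|right; right; exact: sacts1]. Qed.

Lemma epsilon_flips : flips epsilon [:: eR; bm; bm] [:: eR; bp; bm].
Proof.
by split=> // a; case: a => // _;
  (eapply (realizes_subst epsilonP); [by []|by vm_compute]).
Qed.

Lemma reachable_table f R u v : N f -> realizes f R -> valid u -> R u = Some v ->
  reachable v -> reachable u.
Proof. by move=> Nf fR vu Ru; apply: reachable_acts Nf _; left; exact: fR. Qed.

Lemma reachable_eD : reachable [:: eD].
Proof. by apply: (reachable_table rho_N (realizes_subst rhoP) _ _ reachable_eU). Qed.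

Lemma reachable_red a : fits Red a -> reachable [:: eU; a].
Proof.
have rr v w : valid v -> subst rho_table v = Some w -> reachable w -> reachable v.
  exact: reachable_table rho_N (realizes_subst rhoP).
have aa v w : valid v -> subst alpha_table v = Some w -> reachable w -> reachable v.
  exact: reachable_table alpha_N (realizes_subst alphaP).
have aV v w : valid v -> subst (swap alpha_table) v = Some w -> reachable w -> reachable v.
  exact: reachable_table (NV alpha_N) (realizes_inv alphaP).
case: a => // _.
- apply: (rr _ [:: eD; r1]) => //; apply: (aa _ [:: eD]) => //; exact: reachable_eD.
- apply: (aV _ [:: eU]) => //; exact: reachable_eU.
- apply: (aV _ [:: eR]) => //; exact: reachable_eR.
Qed.

Lemma reachable_blue a : fits Blue a -> reachable [:: eR; a] /\ reachable [:: eR; bm; a].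
Proof.
have kV v w : valid v -> subst (swap kappa_table) v = Some w -> reachable w -> reachable v.
  exact: reachable_table (NV kappa_N) (realizes_inv kappaP).
have ee v w : valid v -> subst eps_table v = Some w -> reachable w -> reachable v.
  exact: reachable_table epsilon_N (realizes_subst epsilonP).
have rbu : reachable [:: eR; bu] by apply: (kV _ [:: eU]) => //; exact: reachable_eU.
have rbd : reachable [:: eR; bd] by apply: (kV _ [:: eD]) => //; exact: reachable_eD.
have rbp : reachable [:: eR; bp] by apply: (kV _ [:: eR]) => //; exact: reachable_eR.
case: a => // _; split=> //; try exact: reachable_eRbm.
- apply: (reachable_acts epsilon_N (or_intror epsilon_flips)).
  by apply: (kV _ [:: eR; bm]) => //; exact: reachable_eRbm.
- by apply: (ee _ [:: eR; bm]) => //; exact: reachable_eRbm.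
- by apply: (ee _ [:: eR; bd]).
- by apply: (ee _ [:: eR; bu]).
Qed.

(** A few moves take the children of the three model edges back to model edges;
    an arbitrary edge is treated along its ancestors. *)
Lemma edges_reachable u : valid u -> reachable u.
Proof.
elim/last_ind: u => // u a IH vua.
have [u0|u0] := eqVneq u [::].
  subst u; case: a vua => //= _.
  - apply: (reachable_table rho_N (realizes_subst rhoP) _ _ reachable_eR) => //.
  - exact: reachable_eR.
  - exact: reachable_eU.
  - exact: reachable_eD.
have /andP[vu fa] : valid u && fits (wcol u) a by rewrite -valid_rcons.
have [n [Nn h]] := IH vu.
have key v : sacts n u v -> (forall b, fits (wcol u) b -> reachable (rcons v b)) ->
    reachable (rcons u a).
  move=> nuv hv; have [h'|h'] := sacts_rcons nuv vua.
    by apply: (reachable_acts Nn (or_introl h')); exact: hv.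
  by apply: (reachable_acts Nn (or_introl h')); apply: hv; rewrite fits_opp.
case: h => [h|[h|h]]; apply: (key _ h) => b; have [_ _ ->] := sacts_valid h.
- exact: reachable_red.
- by case/reachable_blue.
- by case/reachable_blue.
Qed.

Local Notation G := airplane_group.



(** * Vertices as points of the limit space *)

Lemma nseqSr n (a : letter) : nseq n.+1 a = rcons (nseq n a) a.
Proof. by rewrite -[n.+1]addn1 nseqD cats1. Qed.

Lemma valid_nseq u a k : valid u -> fits (wcol u) a -> step a a -> valid (u ++ nseq k a).
Proof.
move=> vu fa sa; rewrite valid_cat ?valid_neq0 // vu; case: k => // k /=.
by rewrite {1}/step -/(wcol u) fa /=; elim: k => //= k ->; rewrite sa.
Qed.

Lemma wcol_nseq u a k : paint a = wcol u -> wcol (u ++ nseq k a) = wcol u.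
Proof. by move=> au; case: k => [|k]; rewrite ?cats0 // nseqSr -rcons_cat -au /wcol last_rcons. Qed.

Lemma end_nseq u a k (F : edge -> vertex) : u != [::] ->
  (forall e, F (child e a) = F e) ->
  F (edge_of (u ++ nseq k a)) = F (edge_of u).
Proof.
move=> u0 h; elim: k => [|k IH]; first by rewrite cats0.
rewrite nseqSr -rcons_cat edge_of_rcons ?h //.
by case: (u) u0.
Qed.

Lemma tends_constant (x : Omega) u a p :
  (forall k, val x (size u + k) = a) -> begins u (val x) -> u != [::] ->
  (forall k, p \in wends (u ++ nseq k a)) -> tends (val x) p.
Proof.
move=> xa bu u0 h; exists (size u) => m um.
have -> : m.+1 = size u + (m.+1 - size u) by rewrite subnKC // leqW.
rewrite mkseq_add (beginsE bu).
suff -> : mkseq (fun k => val x (size u + k)) (m.+1 - size u) = nseq (m.+1 - size u) a by [].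
apply: (@eq_from_nth _ a); rewrite size_mkseq ?size_nseq // => i ilt.
by rewrite nth_mkseq // nth_nseq xa ilt.
Qed.

Lemma begins_next u a (x : stream) : begins u x -> x (size u) = a -> begins (rcons u a) x.
Proof. by move=> bu xa; rewrite /begins /initial_word size_rcons mkseqSr (beginsE bu) xa. Qed.

(** Constant tails converge to the ends of an edge: [r1] and [r2] to those of a
    red edge, [bp] to the far end of a blue edge; the near end of a blue edge is
    the far end of its child [bm]. *)
Lemma vertex_point u p : valid u -> p \in wends u ->
  exists2 x : Omega, begins u (val x) & tends (val x) p.
Proof.
have cst v a q : valid v -> fits (wcol v) a -> step a a ->
    (forall k, q \in wends (v ++ nseq k a)) ->
    exists2 x : Omega, begins v (val x) & tends (val x) q.
  move=> vv fa sa h; have fc : follows (wcol v) (fun=> a) by split.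
  exists (splice vv fc) => /=; first exact: begins_scat.
  apply: (@tends_constant (splice vv fc) v a q) => //; first by move=> k; rewrite /= scat_add.
    exact: begins_scat.
  exact: valid_neq0.
have bpt v : valid v -> wcol v = Blue ->
    exists2 x : Omega, begins v (val x) & tends (val x) (tgt (edge_of v)).
  move=> vv cv; apply: (cst v bp) => //; first by rewrite cv.
  by move=> k; rewrite -(end_nseq (a := bp) k (F := tgt)) ?valid_neq0 // /ends !inE eqxx orbT.
move=> vu; have u0 := valid_neq0 vu; case cu: (wcol u); rewrite /ends !inE => /orP[] /eqP ->.
- apply: (cst u r1) => //; first by rewrite cu.
  by move=> k; rewrite -(end_nseq (a := r1) k (F := src)) // /ends !inE eqxx.
- apply: (cst u r2) => //; first by rewrite cu.
  by move=> k; rewrite -(end_nseq (a := r2) k (F := tgt)) // /ends !inE eqxx orbT.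
- have vb : valid (rcons u bm) by rewrite valid_rcons // vu cu.
  have [|x bx tx] := bpt _ vb; first by rewrite /wcol last_rcons.
  exists x; first exact: begins_rcons_l bx.
  by move: tx; rewrite edge_of_rcons.
- exact: bpt.
Qed.

(** A point of the limit space is at most one vertex. *)
Lemma glue_tends_eq (x y : Omega) p q : point_of x = point_of y ->
  tends (val x) p -> tends (val y) q -> p = q.
Proof.
move=> /point_ofP xy tp tq.
have [E|[r [tx ty]]] := glue_cases xy; first by subst y; exact: tends_uniq tp tq.
by rewrite (tends_uniq tp tx) (tends_uniq tq ty).
Qed.

Lemma tends_new (x : Omega) u k : u != [::] -> tends (val x) (New u k) -> begins u (val x).
Proof.
move=> u0 [n /(_ n (leqnn n))] /(wends_fresh (mkseq_neq0 _ _))[a [z E]].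
apply: (@begins_prefix _ (mkseq (val x) n.+1)); last exact: begins_mkseq.
by rewrite E prefix_prefix.
Qed.

Lemma red_src_inj u v : valid u -> valid v -> wcol u = Red -> wcol v = Red ->
  size u = size v -> src (edge_of u) = src (edge_of v) -> u = v.
Proof.
elim/last_ind: u v => [|u a IH] v; first by case: v.
case/lastP: v => [|v b]; first by case: (u).
rewrite !size_rcons => vu vv cu cv [suv].
have [u0|u0] := eqVneq u [::].
  have v0 : v = [::] by apply/nilP; rewrite /nilp -suv u0.
  subst u v; move: vu vv cu cv; rewrite /wcol /=.
  by case: a => //; case: b.
have v0 : v != [::] by rewrite -size_eq0 -suv size_eq0.
move: vu vv cu cv; rewrite !valid_rcons // => /andP[vu fa] /andP[vv fb].
rewrite /wcol !last_rcons !edge_of_rcons // => ca cb.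
have nofr w w' k : w != [::] -> size w = size w' -> src (edge_of w) <> New w' k.
  move=> w0 sw E; have : New w' k \in wends w by rewrite -E /ends inE eqxx.
  by move=> /(wends_fresh_size w0); rewrite sw ltnn.
have nuv k := nofr u v k u0 suv; have nvu k := nofr v u k v0 (esym suv).
case: a fa ca => //; case: b fb cb => //; case cu: (wcol u) => //; case cv: (wcol v) => //;
  move=> _ _ _ _ /=; rewrite ?name_edge_of //; try by [move/nuv | move/esym/nvu | case=> ->].
by move=> E; congr rcons; exact: IH.
Qed.

(** A vertex other than a tip starts a single red edge of each graph: two red
    edges starting there lie on the same ray of edges shrinking to it. *)
Lemma red_src_comparable u v : valid u -> valid v -> wcol u = Red -> wcol v = Red ->
  src (edge_of u) = src (edge_of v) -> exists k, v = u ++ nseq k r1 \/ u = v ++ nseq k r1.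
Proof.
move=> vu vv cu cv E; case/orP: (leq_total (size u) (size v)) => le.
  exists (size v - size u); left.
  apply: red_src_inj; rewrite ?valid_nseq ?wcol_nseq ?cu //.
    by rewrite size_cat size_nseq subnKC.
  by rewrite -E (end_nseq _ (F := src)) ?valid_neq0.
exists (size u - size v); right.
apply: red_src_inj; rewrite ?valid_nseq ?wcol_nseq ?cv //.
  by rewrite size_cat size_nseq subnKC.
by rewrite E (end_nseq _ (F := src)) ?valid_neq0.
Qed.

Lemma blue_src_inj u v : valid u -> valid v -> wcol u = Blue -> wcol v = Blue ->
  src (edge_of u) = src (edge_of v) -> u = v.
Proof.
case/lastP: u => // u a; case/lastP: v => // v b.
have [u0|u0] := eqVneq u [::]; have [v0|v0] := eqVneq v [::].
- by subst u v; case: a => //; case: b.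
- subst u; rewrite (valid_rcons b v0) (edge_of_rcons b v0) => va /andP[vv fb].
  rewrite /wcol !last_rcons => ca cb.
  by case: a va ca => //; case: b fb cb => //; case: (wcol v).
- subst v; rewrite (valid_rcons a u0) (edge_of_rcons a u0) => /andP[vu fa] vb.
  rewrite /wcol !last_rcons => ca cb.
  by case: b vb cb => //; case: a fa ca => //; case: (wcol u).
rewrite !valid_rcons // => /andP[vu fa] /andP[vv fb].
rewrite /wcol !last_rcons !edge_of_rcons // => ca cb.
by case: a fa ca => //; case: b fb cb => //; case: (wcol u) => //; case: (wcol v) => //;
  rewrite /= !name_edge_of // => _ _ _ _ [->].
Qed.

(** Only the blue edges [u b_- b_+^i] end where [u] begins. *)
Lemma blue_tgt_src u f : valid u -> valid f -> wcol u = Blue -> wcol f = Blue ->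
  tgt (edge_of f) = src (edge_of u) -> exists i, f = u ++ bm :: nseq i bp.
Proof.
move=> vu + cu; elim/last_ind: f => // f a IH.
have noroot v : src (edge_of u) = Base v -> v = va \/ v = vb.
  move: vu cu; case/lastP: (u) => // u' b.
  have [->|u0] := eqVneq u' [::]; first by case: b => //= _ _ [<-]; [left|right].
  rewrite valid_rcons // edge_of_rcons // /wcol last_rcons => /andP[_ +].
  by move: (paint (last eL u')) => c; case: b; case: c.
have nonw w : src (edge_of u) <> New w nw.
  move: vu cu; case/lastP: (u) => // u' b.
  have [->|u0] := eqVneq u' [::]; first by case: b.
  rewrite valid_rcons // edge_of_rcons // /wcol last_rcons => /andP[_ +].
  by move: (paint (last eL u')) => c; case: b; case: c.
have [->|f0] := eqVneq f [::].
  by case: a => //= _ _ /esym/noroot[].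
rewrite valid_rcons // edge_of_rcons // [wcol (rcons _ _)]/wcol last_rcons => /andP[vf fa].
case: a fa => //; case cf: (wcol f) => //= _ _.
- by move/esym/nonw.
- by move=> E; exists 0; rewrite (@blue_src_inj f u) // cats1.
- by move=> /(IH vf cf)[i ->]; exists i.+1; rewrite nseqSr rcons_cat.
Qed.

Definition at_tip (a : letter) : bool :=
  match a with eL | eR | rs => true | _ => false end.

(** Tips have degree one: a stream converging to the tip of [q] has to follow the
    edges which contain it. *)
Lemma tip_begins q (y : Omega) i : valid q -> at_tip (last bp q) ->
  tends (val y) (tgt (edge_of q)) -> begins (q ++ nseq i bp) (val y).
Proof.
move=> vq aq ty.
have wy n : (forall w k, n < size w -> tgt (edge_of q) <> New w k) ->
    tgt (edge_of q) \in wends (mkseq (val y) n.+1).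
  move=> h; have [//|[m [k [nm E]]]] := tends_wends n ty.
  by case: (h _ k _ E); rewrite size_mkseq.
have new w k : w != [::] -> tgt (edge_of q) = New w k -> size w < size q.
  move=> w0 E; have : New w k \in wends q by rewrite -E /ends !inE eqxx orbT.
  exact: wends_fresh_size (valid_neq0 vq).
have s0 : (size q).-1.+1 = size q by rewrite prednK // lt0n size_eq0 valid_neq0.
have bq : begins q (val y).
  move: vq aq ty wy {new s0}; case/lastP: q => // u a; rewrite last_rcons.
  have [->|u0] := eqVneq u [::].
    move=> va aa ty wy.
    have : tgt (edge_of [:: a]) \in wends (mkseq (val y) 1).
      apply: wy => w k _; clear ty; by case: a va aa => //= _ _ [].
    have ry : is_root (sval y 0) by have := Omega_valid y 0; rewrite /= andbT.
    rewrite /begins /initial_word /= /mkseq /=; move: (sval y 0) ry => b.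
    clear ty wy; by case: a va aa => // _ _; case: b => //= _;
      rewrite /ends !inE => /orP[] /eqP.
  rewrite valid_rcons // edge_of_rcons // => /andP[_ fa] aa.
  case: a fa aa => //; try by case: wcol.
  have -> : tgt (child (edge_of u) rs) = New u nw by rewrite /= name_edge_of.
  move=> _ _ ty wy.
  have bu := tends_new u0 ty.
  have := wy (size u); rewrite mkseqSr (beginsE bu).
  have nuw w k : size u < size w -> New u nw <> New w k by move=> + [E]; rewrite E ltnn.
  move=> /(_ nuw).
  rewrite edge_of_rcons //; have nu := wends_nofresh nw u0.
  have [n1 n2] : New u nw != src (edge_of u) /\ New u nw != tgt (edge_of u).
    by split; apply: contraFneq nu => ->; rewrite /ends !inE eqxx ?orbT.
  move=> h; apply: (begins_next bu); move: h; rewrite /ends !inE.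
  have d k : k != nw -> (New u nw == New u k) = false.
    by move=> kn; apply/eqP => -[E]; rewrite E eqxx in kn.
  by case: (val y (size u)) => //=; rewrite ?name_edge_of // ?(negPf n1) ?(negPf n2) ?d.
elim: i => [|i IH]; first by rewrite cats0.
pose v := q ++ nseq i bp; rewrite -/v in IH.
have v0 : v != [::] by rewrite /v -size_eq0 size_cat addn_eq0 size_eq0 (negPf (valid_neq0 vq)).
have te : tgt (edge_of v) = tgt (edge_of q) by apply: (end_nseq i (F := tgt)); rewrite ?valid_neq0.
have vv : valid v := begins_valid v0 IH.
have -> : q ++ nseq i.+1 bp = rcons v bp by rewrite nseqSr rcons_cat.
have := wy (size v); rewrite mkseqSr (beginsE IH).
have nvw w k : size v < size w -> tgt (edge_of q) <> New w k.
  move=> vw E; have w0 : w != [::] by rewrite -size_eq0; case: (size w) vw.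
  have := new w k w0 E; rewrite ltnNge (leq_trans _ (ltnW vw)) //.
  by rewrite /v size_cat leq_addr.
move=> /(_ nvw); rewrite edge_of_rcons // -te.
have lt : tgt (edge_of v) != src (edge_of v) by rewrite eq_sym edge_of_loopless.
have nv k : tgt (edge_of v) != New v k.
  by apply: contraFneq (wends_nofresh k v0) => <-; rewrite /ends !inE eqxx orbT.
have cv : wcol v = Blue.
  rewrite /v; case: (i) => [|j]; last by rewrite nseqSr -rcons_cat /wcol last_rcons.
  by rewrite cats0 /wcol; move: aq; case/lastP: (q) (valid_neq0 vq) => // z a _; rewrite !last_rcons; case: a.
have [fa _] := Omega_follows v0 IH; rewrite cv addn0 in fa.
move=> h; apply: (begins_next IH); move: h; rewrite /ends !inE.
by case: (val y (size v)) fa => //= _; rewrite ?name_edge_of // ?(negPf lt) ?(negPf (nv _)).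
Qed.

(** * Cutting a rearrangement along fixed vertices *)

Definition supported (f : airplane -> airplane) (u : word) : Prop :=
  forall x : Omega, ~ begins u (val x) -> f (point_of x) = point_of x.

Definition fixes (f : airplane -> airplane) (p : vertex) : Prop :=
  exists2 z : Omega, tends (val z) p & f (point_of z) = point_of z.

Lemma fixesP f p (x : Omega) : fixes f p -> tends (val x) p ->
  f (point_of x) = point_of x.
Proof.
move=> [z tz fz] tx; suff -> : point_of x = point_of z by [].
by apply/point_ofP; exact: tends_glue tx tz.
Qed.

Lemma fixes_inv (f : homeo airplane) p : fixes f p -> fixes (f^-1)%g p.
Proof. by move=> [z tz fz]; exists z => //; rewrite -{1}fz; exact: homeoK. Qed.

Lemma supported_fixes f u v p : supported f u -> valid v -> p \in wends v ->
  ~~ prefix u v -> ~~ prefix v u -> fixes f p.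
Proof.
move=> fu vv pv nuv nvu; have [x bx tx] := vertex_point vv pv.
exists x => //; apply: fu => bu.
case/orP: (leq_total (size u) (size v)) => le.
  by rewrite (begins_comparable bu bx le) in nuv.
by rewrite (begins_comparable bx bu le) in nvu.
Qed.

Lemma acts_fixes f u p : acts f u u -> p \in wends u -> fixes f p.
Proof.
move=> fuu pu; have [vu _ _ _] := fuu; have [x bx tx] := vertex_point vu pu.
by exists x => //; exact: acts_self_point fuu bx.
Qed.

(** A fixed vertex is its own image, and canonical maps send sources to
    sources. *)
Lemma acts_fixes_src f u v : acts f u v -> fixes f (src (edge_of u)) ->
  src (edge_of v) = src (edge_of u).
Proof.
move=> fuv fx; have [vu vv uv _] := fuv.
have [|x bx tx] := @vertex_point u (src (edge_of u)) vu.
  by rewrite /ends inE eqxx.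
have [y c E] := acts_image fuv bx.
have ty := tends_copies vu vv uv c tx; rewrite /move_vertex eqxx in ty.
apply/esym; apply: (glue_tends_eq _ tx ty).
by rewrite -E (fixesP fx tx).
Qed.

Lemma acts_fixes_tgt f u v : acts f u v -> fixes f (tgt (edge_of u)) ->
  tgt (edge_of v) = tgt (edge_of u).
Proof.
move=> fuv fx; have [vu vv uv _] := fuv.
have [|x bx tx] := @vertex_point u (tgt (edge_of u)) vu.
  by rewrite /ends !inE eqxx orbT.
have [y c E] := acts_image fuv bx.
have ty := tends_copies vu vv uv c tx.
rewrite /move_vertex eq_sym (negPf (edge_of_loopless vu)) eqxx in ty.
apply/esym; apply: (glue_tends_eq _ tx ty).
by rewrite -E (fixesP fx tx).
Qed.

(** [fenced f u]: the points where the cell of [u] meets the rest of the limit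
    space are fixed by [f]. *)
Definition fenced (f : airplane -> airplane) (u : word) : Prop :=
  forall p, p \in wends u ->
    fixes f p \/ forall y : Omega, tends (val y) p -> begins u (val y).

Definition on_border (u : word) (x : Omega) : Prop :=
  exists2 y : Omega, ~ begins u (val y) & point_of x = point_of y.

Lemma fenced_border f u x : valid u -> fenced f u -> begins u (val x) ->
  on_border u x -> f (point_of x) = point_of x.
Proof.
move=> vu fu bx [y ny xy].
have u0 := valid_neq0 vu; have s0 : (size u).-1.+1 = size u.
  by rewrite prednK // lt0n size_eq0.
have nn : mkseq (val x) (size u).-1.+1 <> mkseq (val y) (size u).-1.+1.
  by rewrite s0 (beginsE bx) => E; apply: ny; rewrite /begins /initial_word -E.
have [p [tx ty px _]] := glue_tends ((point_ofP x y).1 xy) nn.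
rewrite s0 (beginsE bx) in px.
have [/fixesP h|h] := fu p px; first exact: h.
by case: ny; exact: h.
Qed.

Lemma fenced_inv (f : homeo airplane) u : fenced f u -> fenced (f^-1)%g u.
Proof. by move=> h p /h[/fixes_inv|]; [left|right]. Qed.

(** The edges of the replacement graph of [w] are connected through the new
    vertices: [hub] meets each of the others at one of them. *)
Definition hub (c : color) : letter := if c is Red then r1 else bu.

Lemma hubP w a : valid w -> fits (wcol w) a ->
  exists k, New w k \in wends (rcons w (hub (wcol w))) /\ New w k \in wends (rcons w a).
Proof.
move=> vw; have w0 := valid_neq0 vw; rewrite !edge_of_rcons // /ends.
case: (wcol w); case: a => //= _; rewrite name_edge_of //;
  solve [by exists nm; rewrite !inE ?eqxx ?orbT | by exists nx; rewrite !inE ?eqxx ?orbT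
        | by exists ny; rewrite !inE ?eqxx ?orbT].
Qed.

Lemma fits_hub c : fits c (hub c). Proof. by case: c. Qed.

Lemma prefix_rcons_r (u w : word) a : prefix u w -> prefix u (rcons w a).
Proof. by move=> /prefixP[z ->]; rewrite rcons_cat prefix_prefix. Qed.

(** A rearrangement fixing the border points of a cell, and sending some edge
    inside the cell to another one, preserves this cell: the interior of a cell
    is connected. Connectedness takes the following combinatorial form: each
    edge [w] inside [u] is sent either into the cell of [u], or, except perhaps
    for border points, outside of it; this holds for small edges, and passes
    from the children of [w] to [w] since they meet at points which are not in
    the border. *)
Lemma cell_dichotomy (f : homeo airplane) u : G f -> valid u -> fenced f u ->
  forall w, valid w -> prefix u w ->
    (forall x, begins w (val x) -> Cell u (f (point_of x))) \/
    (forall x, begins w (val x) -> Cell u (f (point_of x)) -> on_border u x).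
Proof.
move=> /airplane_groupP[n hn] vu fu.
have small w : valid w -> prefix u w -> n + size u < size w ->
    (forall x, begins w (val x) -> Cell u (f (point_of x))) \/
    (forall x, begins w (val x) -> Cell u (f (point_of x)) -> on_border u x).
  move=> vw uw sw.
  have E := cat_take_drop n.+1 w.
  have st : size (take n.+1 w) = n.+1 by rewrite size_takel // (leq_trans _ sw) // ltnS leq_addr.
  have vt : valid (take n.+1 w).
    by move: vw; rewrite -{1}E valid_cat -?size_eq0 ?st // => /andP[].
  have [v fv] := hn _ vt st; rewrite -E in vw.
  have := acts_cat fv vw; rewrite E; set v' := v ++ _ => fv'.
  have sv' : size u <= size v'.
    by rewrite size_cat size_drop (leq_trans _ (leq_addl _ _)) // leq_subRL ?(leq_trans _ sw) // ?ltnS ?leq_addr // addSn.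
  have [uv'|nuv'] := boolP (prefix u v').
    left => x bx; have [y [_ by_ _] ->] := acts_image fv' bx.
    by exists y => //; exact: begins_prefix by_.
  right => x bx [z bz zE]; have [y [_ by_ _] yE] := acts_image fv' bx.
  have nby : ~ begins u (val y).
    by move=> b; rewrite (begins_comparable b by_ sv') in nuv'.
  have zb : on_border u z by exists y; rewrite // zE.
  have := fenced_border vu fu bz zb; rewrite zE => /(can_inj (homeoK f)) xE.
  by exists y => //; rewrite -yE xE.
have step w : valid w -> prefix u w ->
    (forall a, fits (wcol w) a ->
      (forall x, begins (rcons w a) (val x) -> Cell u (f (point_of x))) \/
      (forall x, begins (rcons w a) (val x) -> Cell u (f (point_of x)) -> on_border u x)) ->
    (forall x, begins w (val x) -> Cell u (f (point_of x))) \/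
    (forall x, begins w (val x) -> Cell u (f (point_of x)) -> on_border u x).
  move=> vw uw h; have w0 := valid_neq0 vw.
  have nob k x : tends (val x) (New w k) -> ~ on_border u x.
    move=> tx [y ny xy]; apply: ny; apply: (begins_prefix uw); apply: (@tends_new y w k) => //.
    have [<- //|[r [tx' ty]]] := glue_cases ((point_ofP x y).1 xy).
    by rewrite (tends_uniq tx tx').
  have valc a : fits (wcol w) a -> valid (rcons w a) by move=> fa; rewrite valid_rcons // vw.
  have meet a : fits (wcol w) a -> exists x y, [/\ begins (rcons w (hub (wcol w))) (val x),
      begins (rcons w a) (val y), point_of x = point_of y, ~ on_border u x & ~ on_border u y].
    move=> fa; have [k [k1 k2]] := hubP vw fa.
    have [x bx tx] := vertex_point (valc _ (fits_hub _)) k1.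
    have [y by_ ty] := vertex_point (valc _ fa) k2.
    exists x, y; split=> //; try exact: (nob k).
    by apply/point_ofP; exact: tends_glue tx ty.
  have [hin|hout] := h _ (fits_hub _).
    left => x bx; have [a fa ba] := begins_rcons w0 bx.
    have [ain|aout] := h a fa; first exact: ain.
    have [s [t [bs bt st _ nt]]] := meet a fa.
    by case: nt; apply: aout => //; rewrite -st; exact: hin.
  right => x bx; have [a fa ba] := begins_rcons w0 bx.
  have [ain|aout] := h a fa; last exact: aout.
  have [s [t [bs bt st ns _]]] := meet a fa.
  by case: ns; apply: hout => //; rewrite st; exact: ain.
move=> w; have [m] := ubnP ((n + size u).+1 - size w).
elim: m w => // m IH w le vw uw.
have [sw|sw] := ltnP (n + size u) (size w); first exact: small.
apply: step => // a fa; apply: IH.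
- by rewrite size_rcons subSS; move: le; rewrite subSn.
- by rewrite valid_rcons ?valid_neq0 // vw.
- exact: prefix_rcons_r.
Qed.

(** A witness that [f] does not move the cell of [u] away. *)
Definition germ (f : airplane -> airplane) (u : word) : Prop :=
  exists w v, [/\ acts f w v, prefix u w & prefix u v].

Lemma cell_preserved (f : homeo airplane) u x : G f -> valid u -> fenced f u -> germ f u ->
  begins u (val x) -> Cell u (f (point_of x)).
Proof.
move=> Gf vu fu [w [v [fwv uw uv]]] bx.
have [h|h] := cell_dichotomy Gf vu fu vu (prefix_refl u); first exact: h.
have [vw vv _ _] := fwv.
have [y by_ gy] := generic_point vw.
have bu := begins_prefix uw by_.
have [z [_ bz _] zE] := acts_image fwv by_.
have [|t nt yt] := h y bu.
  by rewrite zE; exists z => //; exact: begins_prefix uv bz.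
by case: nt; rewrite -(generic_eq gy yt).
Qed.

Lemma germ_inv (f : homeo airplane) u : germ f u -> germ (f^-1)%g u.
Proof. by move=> [w [v [/acts_inv h uw uv]]]; exists v, w. Qed.

(** Following the ray of red edges [u r_1^i], a map which fixes the source of
    [u] sends a deep enough edge to another edge of the ray. *)
Lemma germ_red f u : G f -> valid u -> wcol u = Red -> fixes f (src (edge_of u)) ->
  germ f u.
Proof.
move=> /airplane_groupP[n hn] vu cu fx; have u0 := valid_neq0 vu.
pose w := u ++ nseq n.+1 r1.
have vw : valid w by apply: valid_nseq; rewrite ?cu.
have cw : wcol w = Red by rewrite wcol_nseq ?cu.
have [|v fv] := level_acts_ge hn vw; first by rewrite size_cat size_nseq addnS ltnS leq_addl.
have [_ vv cv _] := fv; rewrite cw in cv.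
have wE : src (edge_of w) = src (edge_of u) by exact: (end_nseq n.+1 (F := src)).
have vE : src (edge_of w) = src (edge_of v) by rewrite (acts_fixes_src fv) ?wE.
have [k [kE|kE]] := red_src_comparable vw vv cw (esym cv) vE.
  by exists w, v; split=> //; rewrite ?kE /w -?catA prefix_prefix.
exists (w ++ nseq k r1), w; split; rewrite /w -?catA ?prefix_prefix // catA -/w.
by rewrite {2}kE; apply: acts_cat fv _; apply: valid_nseq; rewrite ?cw.
Qed.

(** The same, for the ray of blue edges [u b_- b_+^i] which end at the source of
    [u]. *)
Lemma germ_blue f u : G f -> valid u -> wcol u = Blue -> fixes f (src (edge_of u)) ->
  germ f u.
Proof.
move=> /airplane_groupP[n hn] vu cu fx; have u0 := valid_neq0 vu.
have E : u ++ bm :: nseq n bp = rcons u bm ++ nseq n bp by rewrite cat_rcons.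
have b0 : rcons u bm != [::] by rewrite -size_eq0 size_rcons.
have vw : valid (u ++ bm :: nseq n bp).
  rewrite E; apply: valid_nseq => //; last by rewrite /wcol last_rcons.
  by rewrite valid_rcons // vu cu.
have tE : tgt (edge_of (u ++ bm :: nseq n bp)) = src (edge_of u).
  by rewrite E (end_nseq n (F := tgt)) // edge_of_rcons.
have [|v fv] := level_acts_ge hn vw.
  by rewrite size_cat /= size_nseq addnS ltnS leq_addl.
have [_ vv cv _] := fv.
have [i vE] : exists i, v = u ++ bm :: nseq i bp.
  apply: blue_tgt_src => //.
    by rewrite -cv E wcol_nseq /wcol last_rcons.
  by rewrite (acts_fixes_tgt fv) tE.
by exists (u ++ bm :: nseq n bp), v; split=> //; rewrite ?vE prefix_prefix.
Qed.

Lemma germ_fixes f u : G f -> valid u -> fixes f (src (edge_of u)) -> germ f u.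
Proof.
move=> Gf vu fx; case cu: (wcol u); [exact: germ_red|exact: germ_blue].
Qed.

(** ** Restriction to a cell *)

(** Extended by the identity, the restriction of [f] to a cell that it preserves
    is well defined and continuous since [f] fixes the border. *)
Lemma restriction (f : homeo airplane) u : G f -> valid u -> fenced f u ->
  fixes f (src (edge_of u)) ->
  exists g : homeo airplane, [/\ G g, supported g u &
    forall x : Omega, begins u (val x) -> g (point_of x) = f (point_of x)].
Proof.
move=> Gf vu fu fx; have gf := germ_fixes Gf vu fx.
pose r (h : airplane -> airplane) p := if `[< Cell u p >] then h p else p.
have rin (h : airplane -> airplane) x : begins u (val x) -> r h (point_of x) = h (point_of x).
  by move=> bx; rewrite /r; case: asboolP => // -[]; exists x.
have rout h x : fenced h u -> ~ begins u (val x) -> r h (point_of x) = point_of x.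
  move=> fh nx; rewrite /r; case: asboolP => // -[y by_ yx].
  by rewrite -yx; apply: (fenced_border vu fh by_); exists x.
have rcont (h : homeo airplane) : fenced h u -> continuous (r h).
  move=> fh; apply: lift_continuous => x; exists (size u).
  have [bx|nx] := pselect (begins u (val x)).
    exists h; split; first exact: homeo_continuous.
    by move=> y yx; apply: rin; rewrite /begins /initial_word yx.
  exists id; split; first exact: cvg_id.
  move=> y yx; apply: rout => // by_; apply: nx.
  by rewrite /begins /initial_word -yx.
have rK (h k : homeo airplane) : fenced h u -> fenced k u -> cancel h k ->
    (forall x, begins u (val x) -> Cell u (h (point_of x))) -> cancel (r h) (r k).
  move=> fh fk hk hc p; have [x <-] := point_surj p.
  have [bx|nx] := pselect (begins u (val x)); last by rewrite !rout.
  rewrite rin //; have [y by_ yE] := hc x bx.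
  by rewrite -yE rin // yE hk.
have fV := fenced_inv fu.
have c1 x : begins u (val x) -> Cell u (f (point_of x)) by move=> bx; exact: cell_preserved gf bx.
have c2 x : begins u (val x) -> Cell u ((f^-1)%g (point_of x)).
  by move=> bx; apply: cell_preserved fV (germ_inv gf) bx => //; exact: airplane_groupV.
pose g := Homeo (rcont f fu) (rcont (f^-1)%g fV)
  (rK _ (f^-1)%g fu fV (@homeoK _ f) c1) (rK (f^-1)%g f fV fu (@homeo_invK _ f) c2).
exists g; split.
- case/airplane_groupP: Gf => n hn; apply/airplane_groupP; exists (n + size u) => w vw sw.
  have [uw|nuw] := boolP (prefix u w).
    have [|v fv] := level_acts_ge hn vw; first by rewrite sw ltnS leq_addr.
    exists v; have [_ vv wv _] := fv; apply: actsP => // x y c.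
    by rewrite /= rin; [exact: acts_copies fv c|case: c => b _ _; exact: begins_prefix b].
  exists w; apply: actsP => // x y c.
  have -> : y = x.
    apply/esym; apply: (copies_inj c); case: c => _ b _; by split.
  apply: rout => // bu; case: c => bw _ _; move: nuw.
  by rewrite (begins_comparable bu bw) // sw leqW // leq_addl.
- by move=> x nx; exact: rout.
- by move=> x bx; exact: rin.
Qed.

(** * Supports and images of edges *)

Lemma supportedM (f g : homeo airplane) u :
  supported f u -> supported g u -> supported (f * g) u.
Proof. by move=> fu gu x nx; rewrite /= gu // fu. Qed.

Lemma supportedV (f : homeo airplane) u : supported f u -> supported (f^-1)%g u.
Proof. by move=> fu x nx; rewrite -{1}(fu x nx); exact: homeoK. Qed.

Lemma supported_cell (f : homeo airplane) u x : supported f u -> begins u (val x) ->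
  Cell u (f (point_of x)).
Proof.
move=> fu bx; have [y yE] := point_surj (f (point_of x)).
have [by_|ny] := pselect (begins u (val y)); first by exists y.
have := fu y ny; rewrite yE => /(can_inj (homeoK f)) E.
by exists x.
Qed.

Lemma supported_eq1 (f : homeo airplane) u : supported f u -> acts f u u -> f = 1.
Proof.
move=> fu fuu; apply: homeo_ext => p; have [x <-] := point_surj p.
have [bx|nx] := pselect (begins u (val x)); last exact: fu.
exact: acts_self_point fuu bx.
Qed.

(** Inclusion of cells is detected by generic streams: if [v] is not inside [u],
    some generic stream starts by [v] but not by [u]. *)
Lemma sacts_prefix (f : homeo airplane) u w v :
  (forall x, begins w (val x) -> Cell u (f (point_of x))) ->
  sacts f w v -> u != [::] -> prefix u v.
Proof.
move=> h fwv u0; have [vw vv _] := sacts_valid fwv.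
have key y : generic y -> begins v (val y) -> begins u (val y).
  move=> gy bv; have [x bx xE] := sacts_onto fwv bv.
  have [t bt tE] := h x bx; have E : y = t by apply: generic_eq; rewrite // tE.
  by rewrite E.
have [y bv gy] := generic_point vv; have bu := key y gy bv.
case/orP: (leq_total (size u) (size v)) => le; first exact: begins_comparable bu bv le.
have /prefixP[z uE] := begins_comparable bv bu le.
case: z uE => [|a z] uE; first by rewrite uE cats0 prefix_refl.
have [t bt [gt ta]] := generic_avoid a vv; case: ta.
have := key t gt bt; rewrite uE => /begins_cat[_ bz].
by have := congr1 (fun s => nth eL s 0) bz; rewrite nth_mkseq //= addn0.
Qed.

(** Disjoint interiors have disjoint images. *)
Lemma sacts_incomparable (f : homeo airplane) w w' v v' :
  sacts f w v -> sacts f w' v' -> ~~ prefix w w' -> ~~ prefix w' w -> ~~ prefix v v'.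
Proof.
move=> h h' n n'; apply/negP => vv'.
have [vw' _ _] := sacts_valid h'.
have [x bx gx] := generic_point vw'.
have [y by_ yE] := sacts_image h' bx.
have [t bt tE] := sacts_onto h (begins_prefix vv' by_).
have E : x = t.
  by apply: generic_eq => //; apply: (can_inj (homeoK f)); rewrite yE tE.
subst t; case/orP: (leq_total (size w) (size w')) => le.
  by rewrite (begins_comparable bt bx le) in n.
by rewrite (begins_comparable bx bt le) in n'.
Qed.

(** Otherwise the rest of the cell of [u] would have no room left. *)
Lemma supported_proper (f : homeo airplane) u a z : supported f u ->
  ~ sacts f (u ++ a :: z) u.
Proof.
move=> fu h; have [_ vu _] := sacts_valid h.
have [x bx [gx xa]] := generic_avoid a vu.
have [y by_ yE] := supported_cell fu bx.
have [t bt tE] := sacts_onto h by_.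
have E : x = t.
  by apply: generic_eq => //; apply: (can_inj (homeoK f)); rewrite -yE.
subst t; case/begins_cat: bt => _ ba; apply: xa.
by have := congr1 (fun s => nth eL s 0) ba; rewrite nth_mkseq //= addn0.
Qed.

Lemma supported_sacts (f : homeo airplane) u v : supported f u -> u != [::] ->
  sacts f u v -> v = u.
Proof.
move=> fu u0 h; have [|[|a z] vE] := prefixP (sacts_prefix _ h u0).
- by move=> x; exact: supported_cell.
- by rewrite vE cats0.
- have := sacts_inv h; rewrite vE => h'.
  by case: (supported_proper (supportedV fu) h').
Qed.

(** * Diagrams of rearrangements *)

Definition cost (c : color) (k : letter -> nat) : nat :=
  if c is Red then (k r1 + k r2 + k rs).+1 else (k bm + k bp + k bu + k bd).+1.

(** [diagram f u n]: the edge [u] can be expanded [n] times so that [f] maps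
    each of the edges obtained onto some edge, canonically or with reversal.
    This number of expansions is the size of the induction below. *)
Inductive diagram (f : airplane -> airplane) : word -> nat -> Prop :=
  | diagram_leaf u v : sacts f u v -> diagram f u 0
  | diagram_node u k : valid u ->
      (forall a, fits (wcol u) a -> diagram f (rcons u a) (k a)) ->
      diagram f u (cost (wcol u) k).

Lemma diagram_red f u n1 n2 n3 : valid u -> wcol u = Red ->
  diagram f (rcons u r1) n1 -> diagram f (rcons u r2) n2 -> diagram f (rcons u rs) n3 ->
  diagram f u (n1 + n2 + n3).+1.
Proof.
move=> vu cu d1 d2 d3.
pose k a := match a with r1 => n1 | r2 => n2 | _ => n3 end.
have -> : (n1 + n2 + n3).+1 = cost (wcol u) k by rewrite cu.
by apply: diagram_node => // a; rewrite cu; case: a.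
Qed.

Lemma diagram_blue f u n1 n2 n3 n4 : valid u -> wcol u = Blue ->
  diagram f (rcons u bm) n1 -> diagram f (rcons u bp) n2 ->
  diagram f (rcons u bu) n3 -> diagram f (rcons u bd) n4 ->
  diagram f u (n1 + n2 + n3 + n4).+1.
Proof.
move=> vu cu d1 d2 d3 d4.
pose k a := match a with bm => n1 | bp => n2 | bu => n3 | _ => n4 end.
have -> : (n1 + n2 + n3 + n4).+1 = cost (wcol u) k by rewrite cu.
by apply: diagram_node => // a; rewrite cu; case: a.
Qed.

Lemma diagram_exists f u : G f -> valid u -> exists n, diagram f u n.
Proof.
move=> /airplane_groupP[n hn]; have [m] := ubnP (n.+1 - size u).
elim: m u => // m IH u le vu.
have [nu|nu] := ltnP n (size u).
  by have [v fv] := level_acts_ge hn vu nu; exists 0; apply: (@diagram_leaf _ _ v); left.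
have h a : exists k, fits (wcol u) a -> diagram f (rcons u a) k.
  have [fa|] := boolP (fits (wcol u) a); last by exists 0.
  have [||k dk] := IH (rcons u a); last by exists k.
  - by rewrite size_rcons subSS; move: le; rewrite subSn.
  - by rewrite valid_rcons ?valid_neq0 // vu.
by have [k kP] := boolp.choice h; exists (cost (wcol u) k); exact: diagram_node.
Qed.

(** Precomposition by [h^-1] carries a diagram from [u] to its image edge: a
    reversal only permutes the children. *)
Lemma diagram_comp (f h : homeo airplane) u u' n : sacts h u u' -> diagram f u n ->
  diagram (f * h^-1)%g u' n.
Proof.
move=> huu d; elim: d u' huu => {u n} [u v fuv|u k vu _ IH] u' huu.
  by apply: diagram_leaf; apply: sacts_comp (sacts_inv huu) fuv.
case: huu => [hu|[_ vu' cu cu' hf]].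
  have [_ vu' cuu' _] := hu; rewrite cuu'; apply: diagram_node => // a; rewrite -cuu' => fa.
  by apply: IH => //; left; apply: (acts_rcons hu); rewrite valid_rcons ?valid_neq0 // vu.
have -> : cost (wcol u) k = cost (wcol u') (k \o opp).
  rewrite cu cu' /cost /=; congr _.+1.
  by rewrite [k bp + _]addnC -[LHS]addnA -[RHS]addnA [k bd + _]addnC.
apply: diagram_node => // a; rewrite cu' => fa; apply: IH; first by rewrite cu fits_opp.
by left; rewrite -[a in rcons u' a]oppK; apply: hf; rewrite fits_opp.
Qed.

(** Postcomposition keeps a diagram if no image has to be subdivided. *)
Lemma diagram_left (f h : homeo airplane) u n : diagram f u n ->
  (forall w v, prefix u w -> sacts f w v -> exists v', sacts h v v') ->
  diagram (h * f) u n.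
Proof.
elim=> {u n} [u v fuv|u k vu _ IH] H.
  have [v' hv] := H u v (prefix_refl u) fuv.
  by apply: diagram_leaf; exact: sacts_comp fuv hv.
apply: diagram_node => // a fa; apply: IH => // w v uw; apply: H.
by apply: prefix_trans uw; rewrite -cats1 prefix_prefix.
Qed.

Lemma sacts_agree f g u v : (forall x, begins u (val x) -> g (point_of x) = f (point_of x)) ->
  sacts f u v -> sacts g u v.
Proof.
have ag w z : (forall x, begins w (val x) -> g (point_of x) = f (point_of x)) ->
    acts f w z -> acts g w z.
  move=> E fwz; have [vw vz cwz _] := fwz; apply: actsP => // x y c.
  by rewrite E; [exact: acts_copies c|case: c].
move=> E [h|[vu vv cu cv h]]; first by left; exact: ag.
right; split=> // a fa; apply: ag (h a fa) => x /begins_rcons_l; exact: E.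
Qed.

Lemma diagram_agree f g u n : diagram f u n ->
  (forall x, begins u (val x) -> g (point_of x) = f (point_of x)) -> diagram g u n.
Proof.
elim=> {u n} [u v fuv|u k vu _ IH] E.
  by apply: diagram_leaf; exact: sacts_agree E fuv.
by apply: diagram_node => // a fa; apply: IH => // x /begins_rcons_l; exact: E.
Qed.

(** ** Conjugation *)

Lemma sacts_outside (f : homeo airplane) u u' x : G f -> sacts f u u' ->
  ~ begins u' (val x) -> exists2 y : Omega, ~ begins u (val y) & f (point_of y) = point_of x.
Proof.
move=> /airplane_groupV/airplane_groupP[n hn] h nx.
pose w := mkseq (val x) (n + size u').+1.
have bw : begins w (val x) := begins_mkseq _ _.
have [v fv] : exists v, acts (f^-1)%g w v.
  by apply: (level_acts_ge hn); rewrite ?size_mkseq ?ltnS ?leq_addr //; exact: Omega_valid.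
have [y c yE] := acts_image fv bw; exists y; last by rewrite -yE homeo_invK.
have nw : ~~ prefix u' w.
  by apply/negP => /begins_prefix/(_ bw).
have nw' : ~~ prefix w u'.
  apply/negP => /prefixP[z /(congr1 size)]; rewrite size_cat size_mkseq => E.
  suff : size u' < size u' by rewrite ltnn.
  by rewrite {2}E addSn ltnS -addnA addnCA leq_addr.
move=> by_; have [_ bv _] := c; have hV := sacts_inv h.
case/orP: (leq_total (size u) (size v)) => le.
  have := sacts_incomparable hV (or_introl fv) nw nw'.
  by rewrite (begins_comparable by_ bv le).
have := sacts_incomparable (or_introl fv) hV nw' nw.
by rewrite (begins_comparable bv by_ le).
Qed.

(** The images of the edges of the diagram lie in the cell of [u], where [k] acts
    on every edge: the diagram is carried along without subdivision. *)
Lemma transport (k f : homeo airplane) u u' n : G k -> sacts k u u' -> supported f u ->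
  diagram f u n ->
  supported (k * f * k^-1) u' /\ diagram (k * f * k^-1) u' n.
Proof.
move=> Gk kuu fu d; split.
  move=> x nx; have [y ny yE] := sacts_outside Gk kuu nx.
  by rewrite -yE /= homeoK fu.
rewrite -mulgA; apply: diagram_left; first exact: diagram_comp kuu d.
move=> w v uw fwv; have [vu vu' _] := sacts_valid kuu.
have /prefixP[z vE] : prefix u v.
  apply: (sacts_prefix _ fwv); last exact: valid_neq0.
  move=> x bx; have [y by_ /= ->] := sacts_image (sacts_inv kuu) (begins_prefix uw bx).
  exact: supported_cell.
case: z vE => [|a z] vE; first by exists u'; rewrite vE cats0.
have [_ vv _] := sacts_valid fwv; rewrite vE in vv *.
by have [b _ kv] := sacts_cat kuu vv; exists (u' ++ b :: z); left.
Qed.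

(** * Rearrangements supported in [eU] or [eR] *)

Lemma diagram_cases f u n : diagram f u n ->
  (exists v, sacts f u v) \/
  exists2 k, n = cost (wcol u) k & forall a, fits (wcol u) a -> diagram f (rcons u a) (k a).
Proof. by case=> [{}u v h|{}u k _ h]; [left; exists v|right; exists k]. Qed.

Lemma supported_root (f : airplane -> airplane) e :
  (forall a, is_root a -> a != e -> acts f [:: a] [:: a]) -> supported f [:: e].
Proof.
move=> h x nx; have rx : is_root (val x 0) by have := Omega_valid x 0; rewrite /= andbT.
have ne : val x 0 != e by apply/eqP => E; apply: nx; rewrite /begins /initial_word /mkseq /= E.
have bx : begins [:: val x 0] (val x) by [].
exact: acts_self_point (h _ rx ne) bx.
Qed.

Lemma beta_supported : supported beta [:: eU].
Proof.
by apply: supported_root => -[] // _ _; apply: (realizes_subst betaP).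
Qed.

Lemma epsilon_supported : supported epsilon [:: eR].
Proof.
by apply: supported_root => -[] // _ _; apply: (realizes_subst epsilonP).
Qed.

(** The analogue of [alpha] around the circle which appears in the middle of
    the edge [eR]. *)
Definition omega : homeo airplane := kappa * alpha * kappa^-1.

Definition omega_map := after (after (subst kappa_table) (subst alpha_table))
  (subst (swap kappa_table)).

Lemma omegaP : realizes omega omega_map.
Proof. rewrite /omega /omega_map; realize. Qed.

Lemma omega_bm : acts omega [:: eR; bm] [:: eR; bm].
Proof. by apply: acts_children => // -[] // _; apply: omegaP. Qed.

Lemma omega_N : N omega. Proof. exact: NJV alpha_N kappa_group. Qed.

Lemma omega_supported : supported omega [:: eR].
Proof.
by apply: supported_root => -[] // _ _; apply: omegaP.
Qed.

Lemma realizes_cat f R u v z : realizes f R -> valid u -> R u = Some v ->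
  valid (u ++ z) -> exists w, acts f (u ++ z) w.
Proof. by move=> fR vu Ru vz; exists (v ++ z); apply: acts_cat vz; exact: fR. Qed.

(** The next three lemmas list the edges which [beta], [epsilon] and [omega] do
    not subdivide, in order to apply [diagram_left]. *)
Lemma beta_acts v : valid v -> prefix [:: eU] v -> ~~ prefix v [:: eU; r1] ->
  exists v', acts beta v v'.
Proof.
case: v => [|a [|b v]] //= /andP[_ vv] /andP[/eqP ea _]; subst a.
  by rewrite /= ?eqxx.
have val : valid (eU :: b :: v) by [].
move=> np; case: b vv val np => //.
- case: v => [|c v]; first by rewrite /= ?eqxx.
  case: c => // _ val _.
  + by apply: (@realizes_cat _ _ [:: eU; r1; r1] _ v (realizes_subst betaP)) => //.
  + by apply: (@realizes_cat _ _ [:: eU; r1; r2] _ v (realizes_subst betaP)) => //.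
  + by apply: (@realizes_cat _ _ [:: eU; r1; rs] _ v (realizes_subst betaP)) => //.
- by move=> _ val _; apply: (@realizes_cat _ _ [:: eU; r2] _ v (realizes_subst betaP)).
- by move=> _ val _; apply: (@realizes_cat _ _ [:: eU; rs] _ v (realizes_subst betaP)).
Qed.

Lemma epsilon_acts v : valid v -> prefix [:: eR] v -> ~~ prefix v [:: eR; bm] ->
  exists v', sacts epsilon v v'.
Proof.
case: v => [|a [|b v]] //= /andP[_ vv] /andP[/eqP ea _]; subst a.
  by rewrite /= ?eqxx.
have val : valid (eR :: b :: v) by [].
have h u z : valid (u ++ z) -> valid u -> subst eps_table u ->
    exists v', sacts epsilon (u ++ z) v'.
  move=> vz vu; case E : (subst eps_table u) => [w|//] _.
  by have [w' ?] := realizes_cat (realizes_subst epsilonP) vu E vz; exists w'; left.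
move=> np; case: b vv val np => //.
- case: v => [|c v]; first by rewrite /= ?eqxx.
  case: c => // vv val _.
  + case: v vv val => [|d v] vv val; first by eexists; right; exact: epsilon_flips.
    by case: d vv val => // vv val; [apply: (h [:: eR; bm; bm; bm])
      |apply: (h [:: eR; bm; bm; bp])|apply: (h [:: eR; bm; bm; bu])|apply: (h [:: eR; bm; bm; bd])].
  + exact: (h [:: eR; bm; bp]).
  + exact: (h [:: eR; bm; bu]).
  + exact: (h [:: eR; bm; bd]).
- by move=> _ val _; apply: (h [:: eR; bp]).
- by move=> _ val _; apply: (h [:: eR; bu]).
- by move=> _ val _; apply: (h [:: eR; bd]).
Qed.

Lemma omega_acts v : valid v -> prefix [:: eR] v -> v != [:: eR] ->
  ~~ prefix [:: eR; bm] v -> v != [:: eR; bd] -> exists v', acts omega v v'.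
Proof.
case: v => [|a [|b v]] //= /andP[_ vv] /andP[/eqP ea _]; subst a; first by rewrite ?eqxx.
have val : valid (eR :: b :: v) by [].
have h u z : valid (u ++ z) -> valid u -> omega_map u -> exists v', acts omega (u ++ z) v'.
  move=> vz vu; case E : (omega_map u) => [w|//] _.
  exact: realizes_cat omegaP vu E vz.
move=> _; case: b vv val => //.
- by rewrite /= ?eqxx prefix0s.
- by move=> _ val _ _; apply: (h [:: eR; bp]).
- by move=> _ val _ _; apply: (h [:: eR; bu]).
- case: v => [|c v]; first by rewrite ?eqxx.
  by case: c => // _ val _ _;
    [apply: (h [:: eR; bd; r1])|apply: (h [:: eR; bd; r2])|apply: (h [:: eR; bd; rs])].
Qed.

(** ** Peeling off the part of a rearrangement supported in a cell *)

(** The factor [k] forgets what [f] does in the cell, and the factor [g] is the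
    only one to need the corresponding part of a diagram of [f]. *)
Lemma peel (f : homeo airplane) u : G f -> valid u -> fenced f u ->
  fixes f (src (edge_of u)) ->
  exists g k : homeo airplane, [/\ f = k * g, G g, G k, supported g u &
   [/\ forall n, diagram f u n -> diagram g u n,
       forall x, begins u (val x) -> k (point_of x) = point_of x &
       forall x, ~ begins u (val x) -> k (point_of x) = f (point_of x)]].
Proof.
move=> Gf vu fu fx; have [g [Gg gu gf]] := restriction Gf vu fu fx.
exists g, (f * g^-1); split=> //.
- by rewrite mulgVK.
- by apply: airplane_groupM => //; exact: airplane_groupV.
split.
- by move=> n d; exact: diagram_agree d gf.
- move=> x bx; have [z bz zE] := supported_cell (supportedV gu) bx.
  have {}zE : homeo_inv g (point_of x) = point_of z by [].
  by rewrite /= zE -gf // -zE homeo_invK.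
- move=> x nx; have E : homeo_inv g (point_of x) = point_of x := supportedV gu nx.
  by rewrite /= E.
Qed.

Lemma peel_fixes f k u p :
  (forall x, begins u (val x) -> k (point_of x) = point_of x) ->
  (forall x, ~ begins u (val x) -> k (point_of x) = f (point_of x)) ->
  fixes f p -> fixes k p.
Proof.
move=> kin kout [z tz fz]; exists z => //.
have [bz|nz] := pselect (begins u (val z)); first exact: kin.
by rewrite kout.
Qed.

Lemma peel_diagram f k u v n :
  (forall x, ~ begins u (val x) -> k (point_of x) = f (point_of x)) ->
  ~~ prefix u v -> ~~ prefix v u -> diagram f v n -> diagram k v n.
Proof.
move=> kout nuv nvu d; apply: diagram_agree d _ => x bv; apply: kout => bu.
case/orP: (leq_total (size u) (size v)) => le.
  by rewrite (begins_comparable bu bv le) in nuv.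
by rewrite (begins_comparable bv bu le) in nvu.
Qed.

(** The induction statement. The cells of [eU] and [eR] suffice, since [alpha] and
    [kappa] bring to them, without reversal, all the smaller cells that occur. *)
Definition tame (n : nat) : Prop :=
  forall e (f : homeo airplane), e = [:: eU] \/ e = [:: eR] ->
    G f -> supported f e -> diagram f e n -> N f.

Lemma tame_transport n u e k f : tame n -> e = [:: eU] \/ e = [:: eR] ->
  G k -> acts k u e -> G f -> supported f u -> diagram f u n -> N f.
Proof.
move=> tn he Gk kue Gf fu d; have [s d'] := transport Gk (or_introl kue) fu d.
apply: (NJK _ Gk); apply: tn he _ s d'.
by apply: airplane_groupM; [exact: airplane_groupM|exact: airplane_groupV].
Qed.

Lemma supported_fixes_root e (f : airplane -> airplane) a p :
  supported f [:: e] -> is_root a -> a != e -> p \in wends [:: a] -> fixes f p.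
Proof.
move=> fe ra ae pa; apply: (supported_fixes fe (v := [:: a])) => //=; first by rewrite ra.
  by rewrite eq_sym (negPf ae).
by rewrite (negPf ae).
Qed.

(** A diagram without expansions is that of the identity, unless it exchanges the
    two ends of the edge. *)
Lemma root_leaf e (f : homeo airplane) v : is_root e -> supported f [:: e] ->
  ~ acts f [:: e; bm] [:: e; bp] -> sacts f [:: e] v -> f = 1.
Proof.
move=> re fe nflip h; have E := supported_sacts fe isT h; subst v.
case: h => [h|[_ _ _ _ h]]; first exact: supported_eq1 fe h.
by case: nflip; exact: (h bm isT).
Qed.

(** ** Rearrangements of a red edge *)

(** [beta^-1] on the right replaces [eU r_1] by its own first half, until no
    expansion is needed there. The expansion of [eU r_1] is then spent on
    [eU r_2], which receives the edges [eU r_1 r_2] and [eU r_2] as its halves: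
    the total does not increase. *)
Lemma red_shorten_domain (f : homeo airplane) a b c : G f -> supported f [:: eU] ->
  diagram f [:: eU; r1] a -> diagram f [:: eU; r2] b -> diagram f [:: eU; rs] c ->
  exists (f' : homeo airplane) v b' c', [/\ G f', supported f' [:: eU], (N f' -> N f),
     acts f' [:: eU; r1] v & [/\ diagram f' [:: eU; r2] b',
     diagram f' [:: eU; rs] c' & b' + c' <= a + b + c]].
Proof.
elim/ltn_ind: a f b c => a IH f b c Gf fe da db dc.
have [[v [h|[_ _ //]]]|[k aE dk]] := diagram_cases da.
  exists f, v, b, c; split=> //; split=> //.
  by rewrite -addnA leq_addl.
have bV : G beta^-1 := airplane_groupV beta_group.
have ac u v : valid u -> subst beta_table u = Some v -> sacts beta u v.
  by move=> vu E; left; exact: (realizes_subst betaP).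
have [||||| |f' [v [b' [c' [Gf' fe' nf' h [d1 d2 le]]]]]] :=
  IH (k r1) _ (f * beta^-1) ((k r2 + b + c).+1) (k rs).
- by rewrite aE /cost /= ltnS -addnA leq_addr.
- exact: airplane_groupM.
- by apply: supportedM fe _; apply: supportedV; exact: beta_supported.
- by apply: diagram_comp (dk r1 isT); exact: ac.
- apply: diagram_red => //.
  + by apply: diagram_comp (dk r2 isT); exact: ac.
  + by apply: diagram_comp db; exact: ac.
  + by apply: diagram_comp dc; exact: ac.
- by apply: diagram_comp (dk rs isT); exact: ac.
exists f', v, b', c'; split=> //.
  by move=> /nf' Nf; rewrite -[f](mulgVK beta); apply: NM Nf beta_N.
split=> //; apply: leq_trans le _; rewrite aE /cost /=.
lia.
Qed.

Lemma prefix_total (u v w : word) : prefix u w -> prefix v w -> prefix u v \/ prefix v u.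
Proof.
rewrite !prefixE => /eqP uw /eqP vw.
by case/orP: (leq_total (size u) (size v)) => le; [left|right];
  rewrite -{1}uw -{1}vw take_takel ?uw ?vw.
Qed.

Lemma nseq_cat_r1 v w k : w = v ++ nseq k r1 -> last eL w <> r1 -> w = v.
Proof. by case: k => [|k] ->; rewrite ?cats0 // nseqSr -rcons_cat last_rcons. Qed.

(** The source of [eU] is fixed, so that [eU r_1] is sent to [eU r_1^j] with
    [j > 0], and each factor [beta] on the left lowers [j]. The other edges are
    sent away from the image of [eU r_1], where [beta] subdivides nothing. *)
Lemma red_shorten_range (f : homeo airplane) v b c : G f -> supported f [:: eU] ->
  acts f [:: eU; r1] v -> diagram f [:: eU; r2] b -> diagram f [:: eU; rs] c ->
  exists f' : homeo airplane, [/\ G f', supported f' [:: eU], (N f' -> N f),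
     acts f' [:: eU; r1] [:: eU; r1] &
     diagram f' [:: eU; r2] b /\ diagram f' [:: eU; rs] c].
Proof.
move=> Gf fe h db dc.
have [j vE] : exists j, v = [:: eU; r1] ++ nseq j r1.
  have [_ vv cv _] := h.
  have fx : fixes f (src (edge_of [:: eU; r1])).
    by apply: (supported_fixes_root fe (a := eR)); rewrite // /ends !inE.
  have sE := acts_fixes_src h fx.
  have [k [kE|kE]] := red_src_comparable (u := [:: eU; r1]) isT vv erefl (esym cv) (esym sE).
    by exists k.
  case: k kE => [|k] kE; first by exists 0; rewrite cats0 kE cats0.
  have pv : prefix [:: eU] v.
    apply: (sacts_prefix _ (or_introl h)) => // x bx.
    by apply: (supported_cell fe); exact: (@begins_rcons_l [:: eU] r1 _ bx).
  case: v vv pv kE h {cv sE} => // a [|a' v] vv pv kE h; last first.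
    by move/(congr1 size): kE; rewrite size_cat size_nseq /= !addSn !addnS.
  have E : [:: a] = [:: eU] by case/prefixP: pv => z [-> _].
  by rewrite E in h; case: (@supported_proper f [:: eU] r1 [::] fe (or_introl h)).
elim: j v f vE Gf fe h db dc => [|j IH] v f vE Gf fe h db dc; first by exists f; subst v; split.
have v'E : [:: eU; r1] ++ nseq j.+1 r1 = [:: eU; r1; r1] ++ nseq j r1 by [].
have hb : acts (beta * f) [:: eU; r1] ([:: eU; r1] ++ nseq j r1).
  rewrite vE v'E in h; apply: (acts_comp h); apply: acts_cat.
    exact: (realizes_subst betaP).
  by case: h.
have left u n : valid u -> prefix [:: eU] u -> ~~ prefix [:: eU; r1] u ->
    ~~ prefix u [:: eU; r1] -> diagram f u n -> diagram (beta * f) u n.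
  move=> vu eu n1 n2 d; apply: diagram_left d _ => w w' uw hw.
  have [vw vw' _] := sacts_valid hw.
  have n1' : ~~ prefix [:: eU; r1] w.
    apply/negP => p; have [q|q] := prefix_total p uw; first by rewrite q in n1.
    by rewrite q in n2.
  have n2' : ~~ prefix w [:: eU; r1].
    by apply: contra n2; exact: prefix_trans.
  have pw' : prefix [:: eU] w'.
    apply: (sacts_prefix _ hw) => // x bx; apply: (supported_cell fe).
    exact: begins_prefix (prefix_trans eu uw) bx.
  have nv := sacts_incomparable hw (or_introl h) n2' n1'.
  have [|w'' hw''] := beta_acts vw' pw'; last by exists w''; left.
  by apply: contra nv => /prefix_trans; apply; rewrite vE prefix_prefix.
have [||||f' [Gf' fe' nf' h' d']] := IH _ (beta * f) erefl _ _ hb.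
- exact: airplane_groupM beta_group Gf.
- exact: supportedM beta_supported fe.
- exact: left.
- exact: left.
exists f'; split=> // /nf' Nbf; have := NM (NV beta_N) Nbf.
by rewrite mulKg.
Qed.

(** Once [eU r_1] is fixed, its expansion is no longer counted, and the other two
    edges are dealt with separately. *)
Lemma red_tame n (f : homeo airplane) : (forall m, m < n -> tame m) -> G f ->
  supported f [:: eU] -> diagram f [:: eU] n -> N f.
Proof.
move=> IH Gf fe d.
have [[v h]|[k nE dk]] := diagram_cases d.
  have -> : f = 1; last exact: N1.
  by apply: (root_leaf _ fe _ h) => // -[].
have [f1 [v [b [c [Gf1 f1e N1 h1 [db dc le]]]]]] :=
  red_shorten_domain Gf fe (dk r1 isT) (dk r2 isT) (dk rs isT).
apply: N1; have [f2 [Gf2 f2e N2 h2 [{}db {}dc]]] := red_shorten_range Gf1 f1e h1 db dc.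
apply: N2.
have bc : b + c < n by rewrite nE /cost /= ltnS.
have fm : fixes f2 (New [:: eU] nm).
  by apply: (acts_fixes h2); rewrite /ends !inE eqxx ?orbT.
have fa : fixes f2 (Base va).
  by apply: (supported_fixes_root f2e (a := eL)); rewrite // /ends !inE.
have Gav : G alpha^-1 := airplane_groupV alpha_group.
have [|||g [r [f2E Gg Gr gs [gd rin rout]]]] := @peel f2 [:: eU; r2] Gf2.
- by [].
- by move=> p; rewrite /ends !inE => /orP[] /eqP ->; left.
- exact: fm.
rewrite f2E; apply: NM.
  apply: (@tame_transport c [:: eU; rs] [:: eR] alpha^-1); auto.
  - by apply: IH; apply: leq_ltn_trans bc; exact: leq_addl.
  - exact: (realizes_inv alphaP).
  - move=> x nx; have [bx|nbx] := pselect (begins [:: eU; r2] (val x)); first exact: rin.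
    rewrite rout //; have [bU|nU] := pselect (begins [:: eU] (val x)); last exact: f2e.
    have [a fa' ba] := begins_rcons (u := [:: eU]) isT bU.
    by case: a fa' ba => // _ ba; [exact: acts_self_point h2 ba].
  - exact: peel_diagram rout _ _ dc.
apply: (@tame_transport b [:: eU; r2] [:: eU] alpha^-1); auto.
- by apply: IH; apply: leq_ltn_trans bc; exact: leq_addr.
- exact: (realizes_inv alphaP).
Qed.

(** ** Rearrangements of a terminal blue edge *)

(** The same as for a red edge, with [epsilon] instead of [beta]: the expansion of
    [eR b_-] is spent on [eR b_+], which receives the edges [eR b_- b_-],
    [eR u], [eR d] and [eR b_+]. *)
Lemma blue_shorten_domain_bm (f : homeo airplane) a b c d : G f -> supported f [:: eR] ->
  diagram f [:: eR; bm] a -> diagram f [:: eR; bp] b ->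
  diagram f [:: eR; bu] c -> diagram f [:: eR; bd] d ->
  exists (f' : homeo airplane) v b' c' d', [/\ G f', supported f' [:: eR], (N f' -> N f),
     sacts f' [:: eR; bm] v & [/\ diagram f' [:: eR; bp] b', diagram f' [:: eR; bu] c',
     diagram f' [:: eR; bd] d' & b' + c' + d' <= a + b + c + d]].
Proof.
elim/ltn_ind: a f b c d => a IH f b c d Gf fe da db dc dd.
have [[v h]|[k aE dk]] := diagram_cases da.
  exists f, v, b, c, d; split=> //; split=> //.
  by rewrite -!addnA leq_addl.
have eV : G epsilon^-1 := airplane_groupV epsilon_group.
have ac u v : valid u -> subst eps_table u = Some v -> sacts epsilon u v.
  by move=> vu E; left; exact: (realizes_subst epsilonP).
have [||||||| f' [v [b' [c' [d' [Gf' fe' nf' h [d1 d2 d3 le]]]]]]] :=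
  IH (k bp) _ (f * epsilon^-1) ((k bm + b + c + d).+1) (k bd) (k bu).
- by rewrite aE /cost /=; lia.
- exact: airplane_groupM.
- by apply: supportedM fe _; apply: supportedV; exact: epsilon_supported.
- by apply: diagram_comp (dk bp isT); exact: ac.
- apply: diagram_blue => //.
  + by apply: diagram_comp (dk bm isT); right; exact: epsilon_flips.
  + by apply: diagram_comp db; exact: ac.
  + by apply: diagram_comp dc; exact: ac.
  + by apply: diagram_comp dd; exact: ac.
- by apply: diagram_comp (dk bd isT); exact: ac.
- by apply: diagram_comp (dk bu isT); exact: ac.
exists f', v, b', c', d'; split=> //.
  by move=> /nf' Nf; rewrite -[f](mulgVK epsilon); apply: NM Nf epsilon_N.
by split=> //; apply: leq_trans le _; rewrite aE /cost /=; lia.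
Qed.

(** Edges inside [u] have images incomparable with those of the edges [u0]
    incomparable with [u]; a left factor [h] only has to act on such images. *)
Lemma diagram_left_away (f h : homeo airplane) e u n :
  supported f e -> e != [::] -> prefix e u ->
  (forall w, valid w -> prefix e w ->
    (forall u0 v0, sacts f u0 v0 -> ~~ prefix u0 u -> ~~ prefix u u0 ->
       ~~ prefix v0 w /\ ~~ prefix w v0) -> exists w', sacts h w w') ->
  diagram f u n -> diagram (h * f) u n.
Proof.
move=> fe e0 eu hw d; apply: diagram_left d _ => w w' uw ww'.
have [vw vw' _] := sacts_valid ww'.
apply: hw => //.
  apply: (sacts_prefix _ ww') => // x bx; apply: (supported_cell fe).
  exact: begins_prefix (prefix_trans eu uw) bx.
move=> u0 v0 f0 n1 n2.
have n1' : ~~ prefix u0 w.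
  by apply/negP => p; have [q|q] := prefix_total p uw; [rewrite q in n1|rewrite q in n2].
have n2' : ~~ prefix w u0 by apply: contra n2; exact: prefix_trans.
by split; [exact: sacts_incomparable f0 ww' n1' n2'|exact: sacts_incomparable ww' f0 n2' n1'].
Qed.

Lemma flips_ends f u v : flips f u v -> fixes f (tgt (edge_of u)) ->
  src (edge_of v) = tgt (edge_of u).
Proof.
move=> [vu vv cu cv h] fx; have := acts_fixes_tgt (h bp isT).
by rewrite !edge_of_rcons ?valid_neq0 //=; apply.
Qed.

(** The target of [eR b_-] is the source of [eR], which is fixed. This excludes
    reversal, and the image is [eR b_- b_+^j], which [epsilon] shortens. *)
Lemma blue_shorten_range_bm (f : homeo airplane) v b c d : G f -> supported f [:: eR] ->
  sacts f [:: eR; bm] v -> diagram f [:: eR; bp] b -> diagram f [:: eR; bu] c ->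
  diagram f [:: eR; bd] d ->
  exists f' : homeo airplane, [/\ G f', supported f' [:: eR], (N f' -> N f),
     acts f' [:: eR; bm] [:: eR; bm] &
     [/\ diagram f' [:: eR; bp] b, diagram f' [:: eR; bu] c & diagram f' [:: eR; bd] d]].
Proof.
move=> Gf fe h db dc dd.
have fx : fixes f (tgt (edge_of [:: eR; bm])).
  by apply: (supported_fixes_root fe (a := eU)); rewrite // /ends !inE.
have {}h : acts f [:: eR; bm] v.
  case: h => // h; have [_ vv _ cv _] := h.
  have vE : v = [:: eR].
    apply: blue_src_inj => //; exact: flips_ends h fx.
  by rewrite vE in h; case: (@supported_proper f [:: eR] bm [::] fe (or_intror h)).
have [j vE] : exists j, v = [:: eR; bm] ++ nseq j bp.
  have [_ vv cv _] := h.
  have tE := acts_fixes_tgt h fx.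
  have [//|i ->] := @blue_tgt_src [:: eR] v isT vv erefl (esym cv) _.
  by exists i.
elim: j v f vE Gf fe {fx} h db dc dd => [|j IH] v f vE Gf fe h db dc dd.
  by exists f; subst v; split.
have v'E : [:: eR; bm] ++ nseq j.+1 bp = [:: eR; bm; bp] ++ nseq j bp by [].
have hb : acts (epsilon * f) [:: eR; bm] ([:: eR; bm] ++ nseq j bp).
  rewrite vE v'E in h; apply: (acts_comp h); apply: acts_cat.
    exact: (realizes_subst epsilonP).
  by case: h.
have left u n : prefix [:: eR] u -> ~~ prefix [:: eR; bm] u ->
    ~~ prefix u [:: eR; bm] -> diagram f u n -> diagram (epsilon * f) u n.
  move=> eu n1 n2; apply: (diagram_left_away fe) => // w vw ew away.
  have [_ nwv] := away _ _ (or_introl h) n1 n2.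
  apply: epsilon_acts => //; apply: contra nwv => /prefix_trans; apply.
  by rewrite vE prefix_prefix.
have [|||||f' [Gf' fe' nf' h' d']] := IH _ (epsilon * f) erefl _ _ hb.
- exact: airplane_groupM epsilon_group Gf.
- exact: supportedM epsilon_supported fe.
- exact: left.
- exact: left.
- exact: left.
exists f'; split=> // /nf' Nbf; have := NM (NV epsilon_N) Nbf.
by rewrite mulKg.
Qed.

(** Now [omega] moves the expansion of the edge [eR d] of the circle to [eR u],
    and it fixes [eR b_-]. *)
Lemma blue_shorten_domain_bd (f : homeo airplane) b c d : G f -> supported f [:: eR] ->
  acts f [:: eR; bm] [:: eR; bm] -> diagram f [:: eR; bp] b ->
  diagram f [:: eR; bu] c -> diagram f [:: eR; bd] d ->
  exists (f' : homeo airplane) v b' c', [/\ G f', supported f' [:: eR], (N f' -> N f),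
     acts f' [:: eR; bm] [:: eR; bm] & [/\ acts f' [:: eR; bd] v, diagram f' [:: eR; bp] b',
     diagram f' [:: eR; bu] c' & b' + c' <= b + c + d]].
Proof.
elim/ltn_ind: d f b c => d IH f b c Gf fe h db dc dd.
have [[v [h'|[_ _ //]]]|[k dE dk]] := diagram_cases dd.
  exists f, v, b, c; split=> //; split=> //.
  exact: leq_addr.
have Go : G omega := N_group omega_N.
have oV : G omega^-1 := airplane_groupV Go.
have ac u v : valid u -> omega_map u = Some v -> sacts omega u v.
  by move=> vu E; left; exact: omegaP.
have [||||||| f' [v [b' [c' [Gf' fe' nf' h' [h'' d1 d2 le]]]]]] :=
  IH (k r1) _ (f * omega^-1) (k rs) ((k r2 + c + b).+1).
- by rewrite dE /cost /=; lia.
- exact: airplane_groupM.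
- by apply: supportedM fe _; apply: supportedV; exact: omega_supported.
- exact: acts_comp (acts_inv omega_bm) h.
- by apply: diagram_comp (dk rs isT); exact: ac.
- apply: diagram_red => //.
  + by apply: diagram_comp (dk r2 isT); exact: ac.
  + by apply: diagram_comp dc; exact: ac.
  + by apply: diagram_comp db; exact: ac.
- by apply: diagram_comp (dk r1 isT); exact: ac.
exists f', v, b', c'; split=> //.
  by move=> /nf' Nf; rewrite -[f](mulgVK omega); apply: NM Nf omega_N.
by split=> //; apply: leq_trans le _; rewrite dE /cost /=; lia.
Qed.

(** The source of [eR d] lies on [eR b_-], hence it is fixed. *)
Lemma blue_shorten_range_bd (f : homeo airplane) v b c : G f -> supported f [:: eR] ->
  acts f [:: eR; bm] [:: eR; bm] -> acts f [:: eR; bd] v ->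
  diagram f [:: eR; bp] b -> diagram f [:: eR; bu] c ->
  exists f' : homeo airplane, [/\ G f', supported f' [:: eR], (N f' -> N f),
     acts f' [:: eR; bm] [:: eR; bm] & [/\ acts f' [:: eR; bd] [:: eR; bd],
     diagram f' [:: eR; bp] b & diagram f' [:: eR; bu] c]].
Proof.
move=> Gf fe h h' db dc.
have [j vE] : exists j, v = [:: eR; bd] ++ nseq j r1.
  have [_ vv cv _] := h'.
  have fx : fixes f (src (edge_of [:: eR; bd])).
    by apply: (acts_fixes h); rewrite /ends !inE.
  have sE := acts_fixes_src h' fx.
  have [k [kE|kE]] := red_src_comparable (u := [:: eR; bd]) isT vv erefl (esym cv) (esym sE).
    by exists k.
  by exists 0; rewrite cats0; apply: esym; apply: (nseq_cat_r1 kE).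
elim: j v f vE Gf fe h h' db dc => [|j IH] v f vE Gf fe h h' db dc.
  by exists f; subst v; split.
have v'E : [:: eR; bd] ++ nseq j.+1 r1 = [:: eR; bd; r1] ++ nseq j r1 by [].
have ho : acts (omega * f) [:: eR; bd] ([:: eR; bd] ++ nseq j r1).
  rewrite vE v'E in h'; apply: (acts_comp h'); apply: acts_cat; first by apply: omegaP.
  by case: h'.
have left u n : prefix [:: eR] u -> ~~ prefix [:: eR; bd] u -> ~~ prefix u [:: eR; bd] ->
    ~~ prefix [:: eR; bm] u -> ~~ prefix u [:: eR; bm] ->
    diagram f u n -> diagram (omega * f) u n.
  move=> eu n1 n2 n3 n4; apply: (diagram_left_away fe) => // w vw ew away.
  have [nvw nwv] := away _ _ (or_introl h') n1 n2.
  have [nmw nwm] := away _ _ (or_introl h) n3 n4.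
  have [||w' hw'] := @omega_acts w vw ew _ nmw; last by exists w'; left.
  - by apply: contraNneq nwm => ->.
  - by apply: contraNneq nwv => ->; rewrite vE prefix_prefix.
have [|||||f' [Gf' fe' nf' hh d']] := IH _ (omega * f) erefl _ _ _ ho _ _.
- exact: airplane_groupM (N_group omega_N) Gf.
- exact: supportedM omega_supported fe.
- exact: acts_comp h omega_bm.
- exact: left.
- exact: left.
exists f'; split=> // /nf' Nof; have := NM (NV omega_N) Nof.
by rewrite mulKg.
Qed.

(** Once [eR b_-] and [eR d] are fixed, their expansions are no longer counted,
    and the other two edges are dealt with separately. *)
Lemma blue_tame n (f : homeo airplane) : (forall m, m < n -> tame m) -> G f ->
  supported f [:: eR] -> diagram f [:: eR] n -> N f.
Proof.
move=> IH Gf fe d.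
have fx : fixes f (Base vb).
  by apply: (supported_fixes_root fe (a := eU)); rewrite // /ends !inE.
have [[v h]|[k nE dk]] := diagram_cases d.
  have -> : f = 1; last exact: N1.
  apply: (root_leaf _ fe _ h) => // hf.
  by have := acts_fixes_tgt hf fx.
have [f1 [v1 [b1 [c1 [d1 [Gf1 f1e N1' h1 [db dc dd le1]]]]]]] :=
  blue_shorten_domain_bm Gf fe (dk bm isT) (dk bp isT) (dk bu isT) (dk bd isT).
apply: N1'; have [f2 [Gf2 f2e N2 h2 [{}db {}dc {}dd]]] := blue_shorten_range_bm Gf1 f1e h1 db dc dd.
apply: N2; have [f3 [v3 [b [c [Gf3 f3e N3 h3 [h3' {}db {}dc le2]]]]]] :=
  blue_shorten_domain_bd Gf2 f2e h2 db dc dd.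
apply: N3; have [f4 [Gf4 f4e N4 h4 [h4' {}db {}dc]]] := blue_shorten_range_bd Gf3 f3e h3 h3' db dc.
apply: N4.
have bc : b + c < n by rewrite nE /cost /= ltnS; exact: leq_trans le2 le1.
have fx4 : fixes f4 (New [:: eR] nx) by apply: (acts_fixes h4); rewrite /ends !inE.
have fy4 : fixes f4 (New [:: eR] ny) by apply: (acts_fixes h4'); rewrite /ends !inE ?eqxx ?orbT.
have Gkv : G kappa^-1 := airplane_groupV kappa_group.
have [|||g [r [f4E Gg Gr gs [gd rin rout]]]] := @peel f4 [:: eR; bu] Gf4.
- by [].
- by move=> p; rewrite /ends !inE => /orP[] /eqP ->; left.
- exact: fy4.
rewrite f4E; apply: NM.
  apply: (@tame_transport b [:: eR; bp] [:: eR] kappa^-1); auto.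
  - by apply: IH; apply: leq_ltn_trans bc; exact: leq_addr.
  - exact: (realizes_inv kappaP).
  - move=> x nx; have [bx|nbx] := pselect (begins [:: eR; bu] (val x)); first exact: rin.
    rewrite rout //; have [bR|nR] := pselect (begins [:: eR] (val x)); last exact: f4e.
    have [a fa ba] := begins_rcons (u := [:: eR]) isT bR.
    by case: a fa ba => // _ ba; [exact: acts_self_point h4 ba|exact: acts_self_point h4' ba].
  - exact: peel_diagram rout _ _ db.
apply: (@tame_transport c [:: eR; bu] [:: eU] kappa^-1); auto.
- by apply: IH; apply: leq_ltn_trans bc; exact: leq_addl.
- exact: (realizes_inv kappaP).
Qed.

Lemma all_tame n : tame n.
Proof.
elim/ltn_ind: n => n IH e f [->|->] Gf fe d; first exact: red_tame IH Gf fe d.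
exact: blue_tame IH Gf fe d.
Qed.

(** * Every rearrangement belongs to [mod_epsilon] *)

Lemma red_to_eU w : valid w -> wcol w = Red -> exists2 n, N n & acts n w [:: eU].
Proof.
move=> vw cw; have [n [Nn h]] := edges_reachable vw; exists n => //.
case: h => [[//|[_ _ //]]|[h|h]]; by have [_ _] := sacts_valid h; rewrite cw.
Qed.

Lemma supported_tame e (f : homeo airplane) k : e = [:: eU] \/ e = [:: eR] ->
  forall u, N k -> acts k u e -> G f -> supported f u -> N f.
Proof.
move=> he u Nk kue Gf fu; have [vu _ _ _] := kue.
have [n d] := diagram_exists Gf vu.
exact: (tame_transport (@all_tame n) he (N_group Nk) kue Gf fu d).
Qed.

(** The pieces supported in [eD] and [eL] are brought to [eU] and [eR] by the
    half turn [rho]. *)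
Lemma fixed_eU_N (f : homeo airplane) : G f -> acts f [:: eU] [:: eU] -> N f.
Proof.
move=> Gf h.
have fa : fixes f (Base va) by apply: (acts_fixes h); rewrite /ends !inE.
have fb : fixes f (Base vb) by apply: (acts_fixes h); rewrite /ends !inE.
have [|||g1 [k1 [fE Gg1 Gk1 gs1 [_ rin1 rout1]]]] := @peel f [:: eD] Gf.
- by [].
- by move=> p; rewrite /ends !inE => /orP[] /eqP ->; left.
- exact: fa.
have fa1 := peel_fixes rin1 rout1 fa; have fb1 := peel_fixes rin1 rout1 fb.
have [|||g2 [k2 [k1E Gg2 Gk2 gs2 [_ rin2 rout2]]]] := @peel k1 [:: eL] Gk1.
- by [].
- move=> p; rewrite /ends !inE => /orP[] /eqP ->; first by left.
  by right => y; exact: (@tip_begins [:: eL] y 0).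
- exact: fa1.
rewrite fE; apply: NM; last first.
  apply: (supported_tame (or_introl erefl) rho_N _ Gg1 gs1).
  exact: (realizes_subst rhoP).
rewrite k1E; apply: NM; last first.
  apply: (supported_tame (or_intror erefl) rho_N _ Gg2 gs2).
  exact: (realizes_subst rhoP).
apply: (@supported_tame [:: eR] k2 1 (or_intror erefl) [:: eR] N1) => //; first exact: acts_id.
move=> x nx.
have rx : is_root (val x 0) by have := Omega_valid x 0; rewrite /= andbT.
have bb a : val x 0 = a -> begins [:: a] (val x) by move=> <-.
have [bL|nL] := pselect (begins [:: eL] (val x)); first exact: rin2.
have [bD|nD] := pselect (begins [:: eD] (val x)); first by rewrite rout2 // rin1.
rewrite rout2 // rout1 //; apply: (acts_self_point h).
case E : (val x 0) rx => // _.
- by case: nL; exact: bb.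
- by case: nx; exact: bb.
- exact: bb.
- by case: nD; exact: bb.
Qed.

(** A deep red edge and its image are both moved to [eU]. *)
Theorem mod_epsilon_full (f : homeo airplane) : G f -> N f.
Proof.
move=> Gf; case/airplane_groupP: (Gf) => n hn.
have vw : valid ([:: eU] ++ nseq n r1) by exact: valid_nseq.
have cw : wcol ([:: eU] ++ nseq n r1) = Red by exact: wcol_nseq.
have [|v fv] := hn _ vw; first by rewrite size_cat size_nseq.
have [_ vv cv _] := fv.
have [n1 Nn1 h1] := red_to_eU vw cw.
have [n2 Nn2 h2] := red_to_eU vv (etrans (esym cv) cw).
have : N (n2 * f * n1^-1).
  apply: fixed_eU_N.
    apply: airplane_groupM; last exact: N_group (NV Nn1).
    exact: airplane_groupM (N_group Nn2) Gf.
  exact: acts_comp (acts_inv h1) (acts_comp fv h2).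
move=> /(NM (NV Nn2))/NM/(_ Nn1).
by rewrite -[n2 * f * _]mulgA mulKg mulgVK.
Qed.

(** * The total expansion at the tips *)

Definition tip (q : word) : bool := valid q && at_tip (last bp q).

(** [f] sends a neighbourhood of the tip of [p] to one of the tip of [q], with
    [d] more letters [bp]. *)
Definition tip_moves (f : airplane -> airplane) (p : word) (qd : word * int) : Prop :=
  tip qd.1 /\ exists k k', acts f (p ++ nseq k bp) (qd.1 ++ nseq k' bp) /\
    qd.2 = (k'%:Z - k%:Z)%R.

Lemma valid_nseq_bp u k : valid u -> wcol u = Blue -> valid (u ++ nseq k bp).
Proof. by move=> vu cu; apply: valid_nseq; rewrite ?cu. Qed.

Lemma wcol_nseq_bp u k : wcol u = Blue -> wcol (u ++ nseq k bp) = Blue.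
Proof. by move=> cu; rewrite wcol_nseq ?cu. Qed.

Lemma tip_blue q : tip q -> wcol q = Blue.
Proof. by case/andP; case/lastP: q => // q a _; rewrite /wcol !last_rcons; case: a. Qed.

Lemma acts_nseq f u v k : acts f u v -> wcol u = Blue -> acts f (u ++ nseq k bp) (v ++ nseq k bp).
Proof. by move=> h cu; apply: (acts_cat h); apply: valid_nseq_bp => //; case: h. Qed.

Lemma nseq_bp_inj q q' k k' : last bp q != bp -> last bp q' != bp ->
  q ++ nseq k bp = q' ++ nseq k' bp -> q = q' /\ k = k'.
Proof.
elim: k k' => [|k IH] [|k'] lq lq'; rewrite ?cats0 //.
- by move=> E; move: lq; rewrite E nseqSr -rcons_cat last_rcons.
- by move=> E; move: lq'; rewrite -E nseqSr -rcons_cat last_rcons.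
- by rewrite !nseqSr -!rcons_cat => /rcons_inj[/(IH _ lq lq')[-> ->]].
Qed.

Lemma tip_last q : tip q -> last bp q != bp.
Proof. by case/andP => _; case: (last bp q). Qed.

Lemma tip_moves_uniq f p qd qd' : tip p -> tip_moves f p qd -> tip_moves f p qd' -> qd = qd'.
Proof.
case: qd qd' => q d [q' d'] tp [/= tq [k [k' [h ->]]]] [/= tq' [i [i' [h' ->]]]].
have cp n := wcol_nseq_bp n (tip_blue tp).
have e1 := acts_nseq i h (cp k); have e2 := acts_nseq k h' (cp i).
rewrite -!catA -!nseqD in e1 e2; rewrite [(i + k)%N]addnC in e2.
have [-> E] := nseq_bp_inj (tip_last tq) (tip_last tq') (acts_uniq e1 e2).
by congr pair; lia.
Qed.

(** The number of letters is additive along the orbit of a tip. *)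
Lemma tip_moves_comp (f g : homeo airplane) p q r d e : tip p ->
  tip_moves g p (q, d) -> tip_moves f q (r, e) -> tip_moves (f * g)%g p (r, (d + e)%R).
Proof.
move=> tp [/= tq [k [k' [h ->]]]] [/= tr [i [i' [h' ->]]]]; split=> //=.
have e1 := acts_nseq i h (wcol_nseq_bp k (tip_blue tp)).
have e2 := acts_nseq k' h' (wcol_nseq_bp i (tip_blue tq)).
rewrite -!catA -!nseqD in e1 e2; rewrite [(i + k')%N]addnC in e2.
exists (k + i)%N, (i' + k')%N; split; first exact: acts_comp e1 e2.
by lia.
Qed.

Lemma tip_moves_inv (f : homeo airplane) p q d : tip p -> tip_moves f p (q, d) ->
  tip_moves (f^-1)%g q (p, (- d)%R).
Proof.
move=> tp [/= tq [k [k' [h ->]]]]; split=> //=; exists k', k; split; first exact: acts_inv.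
by rewrite GRing.opprB.
Qed.

(** The vertices other than tips lie on circles, hence start red edges. *)
Lemma blue_src_red u : valid u -> wcol u = Blue -> exists2 r, valid r &
  wcol r = Red /\ src (edge_of r) = src (edge_of u).
Proof.
case/lastP: u => // u a; have [->|u0] := eqVneq u [::].
  by case: a => //= _ _; [exists [:: eD]|exists [:: eU]].
rewrite valid_rcons // /wcol last_rcons -/(wcol u) => /andP[vu fa] pa.
case: a fa pa => //; case cu: (wcol u) => // _ _;
  [exists (rcons u r2)|exists (rcons u bd)|exists (rcons u bu)];
  rewrite ?valid_rcons ?vu ?cu //; by rewrite !edge_of_rcons // /wcol last_rcons.
Qed.

Lemma red_stream r : valid r -> wcol r = Red -> exists2 x : Omega,
  tends (val x) (src (edge_of r)) &
  forall n, size r <= n -> wcol (mkseq (val x) n) = Red.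
Proof.
move=> vr cr; have fc : follows (wcol r) (fun=> r1) by rewrite cr; split.
have xk k : scat r (fun=> r1) (size r + k) = r1 by rewrite scat_add.
exists (splice vr fc).
  apply: (@tends_constant (splice vr fc) r r1) => //; first exact: begins_scat.
    exact: valid_neq0.
  by move=> k; rewrite -(end_nseq (a := r1) k (F := src)) ?valid_neq0 // /ends inE eqxx.
move=> n rn; have -> : n = size r + (n - size r) by rewrite subnKC.
rewrite /= mkseq_scat; case: (n - size r) => [|k]; first by rewrite cats0.
have -> : mkseq (fun=> r1) k.+1 = rcons (mkseq (fun=> r1) k) r1 by rewrite mkseqSr.
by rewrite -rcons_cat /wcol last_rcons.
Qed.

(** Tips are sent to tips. The image of the ray [p b_+^i] is a ray of blue edges
    ending either at a tip or at another vertex; in the second case a ray of red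
    edges shrinks to this vertex, and its preimage shrinks to the tip of [p],
    although only blue edges do so. *)
Lemma tip_moves_exists f p : G f -> tip p -> exists qd, tip_moves f p qd.
Proof.
move=> Gf tp; have cp := tip_blue tp; have /andP[vp ap] := tp.
case/airplane_groupP: (Gf) => n hn.
have [|v fv] := level_acts_ge hn (valid_nseq_bp n.+1 vp cp).
  by rewrite size_cat size_nseq addnS ltnS leq_addl.
have [vpn vv cv _] := fv; rewrite wcol_nseq_bp // in cv.
have [q [j [vE lq]]] : exists q j, v = q ++ nseq j bp /\ last bp q != bp.
  elim/last_ind: v {fv} vv cv => // v a IH vva cva.
  have [ab|ab] := eqVneq a bp; last by exists (rcons v a), 0; rewrite cats0 last_rcons.
  have v0 : v != [::] by apply: contraTneq vva => ->; rewrite ab.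
  move: vva; rewrite valid_rcons // ab => /andP[vv fv].
  have [|q [j [vE lq]]] := IH vv; first by case: (wcol v) fv.
  by exists q, j.+1; rewrite nseqSr -rcons_cat -vE.
have q0 : q != [::] by apply: contraNneq lq => ->.
have vq : valid q by move: vv; rewrite vE valid_cat // => /andP[].
have [aq|naq] := boolP (at_tip (last bp q)).
  exists (q, (j%:Z - n.+1%:Z)%R); split; first by rewrite /tip vq.
  by exists n.+1, j; rewrite -vE.
have cq : wcol q = Blue.
  case: j vE => [|j] vE; first by rewrite cv vE cats0.
  move: vv; rewrite vE valid_cat // => /andP[_ /andP[]].
  by rewrite {1}/step -/(wcol q); case: (wcol q).
case/lastP: q q0 vE vq lq naq cq => // u a _ vE vua; rewrite !last_rcons => ab na.
rewrite /wcol last_rcons => ca.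
have u0 : u != [::] by apply: contraTneq vua => ->; case: (a) na ca.
move: vua; rewrite valid_rcons // => /andP[vu fa].
have {ab na ca fa} [aE cu] : a = bm /\ wcol u = Blue.
  by case: (a) ab na ca fa; case: (wcol u).
subst a.
have [r vr [cr rE]] := blue_src_red vu cu.
have [x tx xred] := red_stream vr cr.
have tvE : tgt (edge_of v) = src (edge_of u).
  rewrite vE (end_nseq _ (F := tgt)) -?size_eq0 ?size_rcons //.
  by rewrite edge_of_rcons.
have [|z bz tz] := @vertex_point (p ++ nseq n.+1 bp) (tgt (edge_of p)) vpn.
  by rewrite -(end_nseq (a := bp) n.+1 (F := tgt)) ?valid_neq0 // /ends !inE eqxx orbT.
have [y c zy] := acts_image fv bz.
have ty : tends (val y) (src (edge_of u)).
  have [_ _ cpv _] := fv.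
  have := tends_copies vpn vv cpv c tz; rewrite /move_vertex.
  rewrite -{1}(end_nseq (a := bp) n.+1 (F := tgt)) ?valid_neq0 //.
  rewrite eq_sym (negPf (edge_of_loopless vpn)).
  by rewrite -{1}(end_nseq (a := bp) n.+1 (F := tgt)) ?valid_neq0 // eqxx tvE.
have yx : point_of y = point_of x.
  by apply/point_ofP; apply: tends_glue ty _; rewrite -rE.
have /airplane_groupP[m hm] := airplane_groupV Gf.
pose l := (size r + m).+1.
have [|w0 hw0] := level_acts_ge hm (Omega_valid x (size r + m)).
  by rewrite size_mkseq ltnS leq_addl.
pose t := mkseq (fun k => val x (l + k)) (size p).
have xl : mkseq (val x) (l + size p) = mkseq (val x) l ++ t by exact: mkseq_add.
have vxl : valid (mkseq (val x) l ++ t) by rewrite -xl addSn; exact: Omega_valid.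
have hw := acts_cat hw0 vxl.
have bx : begins (mkseq (val x) l ++ t) (val x) by rewrite -xl; exact: begins_mkseq.
have [x' cx' xE] := acts_image hw bx.
have [_ vw cw _] := hw.
have E : point_of x' = point_of z.
  by rewrite -xE -yx -zy; exact: homeoK.
have [_ bx' _] := cx'.
have tx' := tends_copies vxl vw cw cx' tx.
have sE := glue_tends_eq E tx' tz; rewrite sE in tx'.
have cw' : wcol (w0 ++ t) = Red.
  by rewrite -cw -xl; apply: xred; rewrite /l addSn leqW // -addnA leq_addr.
have bpw := @tip_begins p x' (size (w0 ++ t) - size p) vp ap tx'.
have sw : size (p ++ nseq (size (w0 ++ t) - size p) bp) = size (w0 ++ t).
  by rewrite size_cat size_nseq subnKC // size_cat /t size_mkseq leq_addl.
move: cw'; rewrite -(beginsE bx') -sw (beginsE bpw).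
by rewrite (wcol_nseq_bp _ cp).
Qed.

Definition tip_value (f : airplane -> airplane) (p : word) : word * int :=
  xget ([::], 0%R) [set qd | tip_moves f p qd].

Lemma tip_valueP f p : G f -> tip p -> tip_moves f p (tip_value f p).
Proof. by move=> Gf tp; apply: (xgetPex ([::], 0%R)); exact: tip_moves_exists. Qed.

Lemma tip_value_eq f p qd : G f -> tip p -> tip_moves f p qd -> tip_value f p = qd.
Proof. by move=> Gf tp h; apply: tip_moves_uniq (tip_valueP Gf tp) h. Qed.

Lemma tip_value_tip f p : G f -> tip p -> tip (tip_value f p).1.
Proof. by move=> Gf tp; case: (tip_valueP Gf tp). Qed.

Lemma acts_tip f p q : acts f p q -> tip p -> tip q -> tip_moves f p (q, 0%R).
Proof. by move=> h tp tq; split=> //=; exists 0, 0; rewrite !cats0. Qed.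

(** A deep tip belongs to a cell on which [f] acts canonically, so that no letter
    is added there; the second part shows that deep tips stay deep. *)
Lemma tip_value_far f : G f -> exists n, forall p, tip p -> n < size p ->
  (tip_value f p).2 = 0%R /\ size p <= size (tip_value f p).1 + n.
Proof.
move=> Gf; case/airplane_groupP: (Gf) => n hn; exists n.+1 => p tp np.
have E := cat_take_drop n.+1 p.
have st : size (take n.+1 p) = n.+1 by rewrite size_takel // ltnW.
have /andP[vp ap] := tp.
have vt : valid (take n.+1 p).
  by move: vp; rewrite -{1}E valid_cat -?size_eq0 ?st // => /andP[].
have [v fv] := hn _ vt st; rewrite -E in vp.
have := acts_cat fv vp; rewrite E => fpv.
have tq : tip (v ++ drop n.+1 p).
  rewrite /tip; have [_ -> _ _] := fpv; rewrite /=.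
  move: ap; rewrite -{1}E !last_cat.
  have : 0 < size (drop n.+1 p) by rewrite size_drop subn_gt0.
  by case: (drop n.+1 p).
rewrite (tip_value_eq Gf tp (acts_tip fpv tp tq)) /=; split=> //.
by rewrite size_cat size_drop -addnA subnK ?leq_addl // ltnW.
Qed.

Definition tips_upto (m : nat) : seq word :=
  undup [seq p <- flatten [seq map name (full_expansion k) | k <- iota 0 m] | tip p].

Lemma mem_tips_upto m p : (p \in tips_upto m) = tip p && (size p <= m).
Proof.
rewrite mem_undup mem_filter; have [/andP[vp _]|] //= := boolP (tip p).
have s0 : (size p).-1.+1 = size p by rewrite prednK // lt0n size_eq0 valid_neq0.
apply/flattenP/idP => [[_ /mapP[k + ->] /mapP[e eE ->]]|pm].
  by rewrite mem_iota => /andP[_ km]; rewrite (full_expansion_size eE).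
exists (map name (full_expansion (size p).-1)).
  by apply/mapP; exists (size p).-1 => //; rewrite mem_iota /= add0n s0.
apply/mapP; exists (edge_of p); last by rewrite name_edge_of ?valid_neq0.
by apply: edge_of_full; rewrite ?s0.
Qed.

Lemma tips_sum (F : word -> int) m : (forall p, tip p -> m < size p -> F p = 0%R) ->
  (\sum_(p \in [set p | tip p]) F p = \sum_(p <- tips_upto m) F p)%R.
Proof.
move=> h; rewrite (fsbigE (tips_upto m)).
- rewrite big_mkcond; apply: eq_big_seq => p; rewrite mem_tips_upto => /andP[tp _].
  by rewrite ifT // inE.
- exact: undup_uniq.
- by move=> p /=; rewrite mem_tips_upto => /andP[].
- move=> p tp; rewrite mem_tips_upto tp /= -ltnNge; exact: h.
Qed.

(** The logarithm of the total expansion at the tips; the sum has finite support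
    by [tip_value_far]. *)
Definition tip_sum (f : airplane -> airplane) : int :=
  (\sum_(p \in [set p | tip p]) (tip_value f p).2)%R.

(** The value of [f * g] at [p] is that of [g] at [p] plus that of [f] at the
    image of [p], and [g] permutes the tips. *)
Lemma tip_sumM (f g : homeo airplane) : G f -> G g ->
  tip_sum (f * g) = (tip_sum f + tip_sum g)%R.
Proof.
move=> Gf Gg; have Gfg := airplane_groupM Gf Gg.
have [nf hf] := tip_value_far Gf; have [ng hg] := tip_value_far Gg.
have key p : tip p -> tip_value (f * g) p =
    ((tip_value f (tip_value g p).1).1,
     ((tip_value g p).2 + (tip_value f (tip_value g p).1).2)%R).
  move=> tp; apply: tip_value_eq => //.
  have := tip_valueP Gg tp; case: (tip_value g p) => q d h.
  have tq : tip q by case: h.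
  have := tip_valueP Gf tq; case: (tip_value f q) => r e h' /=.
  exact: tip_moves_comp h h'.
have far p : tip p -> nf + ng < size p -> (tip_value f (tip_value g p).1).2 = 0%R.
  move=> tp np; have [] := hg p tp; first by apply: leq_ltn_trans np; exact: leq_addl.
  move=> _ le; have [//||-> //] := hf (tip_value g p).1; first exact: tip_value_tip.
  by rewrite -(ltn_add2r ng); exact: leq_trans np le.
have far' p : tip p -> nf + ng < size p -> (tip_value g p).2 = 0%R.
  by move=> tp np; have [] := hg p tp; first by apply: leq_ltn_trans np; exact: leq_addl.
have E : (\sum_(p \in [set p | tip p]) (tip_value f p).2 =
    \sum_(p \in [set p | tip p]) (tip_value f (tip_value g p).1).2)%R.
  apply: (@reindex_fsbig _ _ _ _ _ (fun p => (tip_value g p).1)); split.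
  - by move=> p /= tp; exact: tip_value_tip.
  - move=> p p'; rewrite !inE => tp tp' E.
    have := tip_valueP Gg tp; have := tip_valueP Gg tp'; move: E.
    case: (tip_value g p) => q d; case: (tip_value g p') => q' d' /= <- h' h.
    have tq : tip q by case: h.
    by case: (tip_moves_uniq tq (tip_moves_inv tp h) (tip_moves_inv tp' h')).
  - move=> q /= tq; have GgV := airplane_groupV Gg.
    have := tip_valueP GgV tq; case: (tip_value (g^-1)%g q) => p d h.
    have tp : tip p by case: h.
    exists p => //; have := tip_moves_inv tq h; rewrite invgK => h'.
    by rewrite (tip_value_eq Gg tp h').
rewrite /tip_sum [in RHS]E !(@tips_sum _ (nf + ng)) //.
  rewrite addrC -big_split /=; apply: eq_big_seq => p; rewrite mem_tips_upto => /andP[tp _].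
  by rewrite key.
by move=> p tp np; rewrite key //= far // far' // addr0.
Qed.

Lemma tip_sum1 : tip_sum (1 : homeo airplane) = 0%R.
Proof.
apply: (@addrI _ (tip_sum (1 : homeo airplane))); rewrite addr0.
by rewrite -tip_sumM ?mulg1 //; exact: airplane_group1.
Qed.

Lemma tip_sumV (f : homeo airplane) : G f -> tip_sum (f^-1)%g = (- tip_sum f)%R.
Proof.
move=> Gf; apply: (@addrI _ (tip_sum f)).
rewrite -tip_sumM //; last exact: airplane_groupV.
by rewrite mulgV tip_sum1 subrr.
Qed.

(** At the tip of [eR], [epsilon] maps [eR b_+] to [eR b_+ b_+]. At any other tip
    [u s], it acts canonically on the red edge [u]. *)
Lemma tip_sum_epsilon : tip_sum epsilon = 1%R.
Proof.
have teR : tip [:: eR] by [].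
have v1 : (tip_value epsilon [:: eR]).2 = 1%R.
  rewrite (@tip_value_eq _ _ ([:: eR], 1%R) epsilon_group teR) //.
  by split=> //; exists 1%N, 2%N; split=> //; apply: (realizes_subst epsilonP).
have v0 p : tip p -> p != [:: eR] -> (tip_value epsilon p).2 = 0%R.
  move=> tp pe; suff [q tq h] : exists2 q, tip q & acts epsilon p q.
    by rewrite (tip_value_eq epsilon_group tp (acts_tip h tp tq)).
  have /andP[vp ap] := tp.
  have tE q : acts epsilon p q -> last bp q = last bp p -> exists2 q, tip q & acts epsilon p q.
    by move=> h l; exists q => //; rewrite /tip l ap andbT; case: h.
  move: tp pe vp ap tE; case/lastP: p => // u a.
  have [->|u0] := eqVneq u [::].
    case: a => // _.
    move=> _ _ _ tE; by apply: (tE [:: eL]) => //; apply: (realizes_subst epsilonP).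
  rewrite last_rcons => _ _ vua aa tE.
  have [vu fa] : valid u /\ fits (wcol u) a by apply/andP; rewrite -valid_rcons.
  have cu : wcol u = Red by case: (a) aa fa; case: (wcol u).
  suff [v h] : exists v, acts epsilon u v.
    by apply: (tE (rcons v a)); [exact: acts_rcons|rewrite !last_rcons].
  have [eu|neu] := boolP (prefix [:: eR] u).
    have [|v [h|[_ _ h]]] := epsilon_acts vu eu; last 2 first.
    - by exists v.
    - by rewrite cu in h.
    by apply/negP => /prefixP[z E]; case: u {u0 vua tE fa vu eu} cu E => // b [|c [|? ?]] //=;
      move=> + [? ?]; subst.
  case: u {u0 vua tE fa} vu cu neu => // b z vu cu neu.
  have rb : is_root b by case/andP: vu.
  have eb : acts epsilon [:: b] [:: b].
    move: neu; rewrite /= prefix0s andbT; case: (b) rb => //;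
    by move=> _ _; apply: (realizes_subst epsilonP).
  by exists ([:: b] ++ z); exact: acts_cat eb vu.
rewrite /tip_sum (@tips_sum _ 1%N); last first.
  move=> p tp sp; apply: v0 => //; by apply: contraTneq sp => ->.
rewrite (bigD1_seq [:: eR]) ?mem_tips_upto ?undup_uniq //= v1 big_seq_cond big1 ?addr0 //.
by move=> p /andP[]; rewrite mem_tips_upto => /andP[tp _] pe; exact: v0.
Qed.

(** * The semidirect product *)

Lemma commutator_tip_sum : commutator_subgroup airplane_group `<=`
  [set f | G f /\ tip_sum (f : homeo airplane) = 0%R].
Proof.
apply: generated_min.
  apply/subgroupP; split; first by split; [exact: airplane_group1|exact: tip_sum1].
  move=> f g [Gf f0] [Gg g0]; have GgV := airplane_groupV Gg.
  split; first exact: airplane_groupM.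
  by rewrite tip_sumM // tip_sumV // f0 g0 oppr0 addr0.
move=> _ [f Gf [g Gg <-]]; have GfV := airplane_groupV Gf; have GgV := airplane_groupV Gg.
have Gfg : G (f * g) := airplane_groupM Gf Gg.
have GgfV : G (g^-1 * (f * g)) := airplane_groupM GgV Gfg.
split; first exact: airplane_groupM GfV GgfV.
rewrite /commg /conjg tip_sumM // tip_sumM // tip_sumM // !tip_sumV //.
by rewrite [(tip_sum f + _)%R]addrC addKr addNr.
Qed.

(** Powers of [x] with an integer exponent, written as differences of natural
    ones. *)
Lemma cyclic_powers (gT : groupType) (x : gT) :
  cyclic_subgroup x `<=` [set h | exists i j, h = x ^+ i * (x ^+ j)^-1].
Proof.
have com i j : x ^+ i * (x ^+ j)^-1 = (x ^+ j)^-1 * x ^+ i.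
  exact/commuteV/commuteX2/commute_refl.
apply: generated_min.
  apply/subgroupP; split; first by exists 0%N, 0%N; rewrite expg0 mulgV.
  move=> _ _ [i [j ->]] [k [l ->]]; exists (i + l)%N, (k + j)%N.
  rewrite !expgnDr !invgM invgK -!mulgA; congr (_ * _).
  by rewrite !mulgA com.
by move=> _ ->; exists 1%N, 0%N; rewrite expg0 expg1 invg1 mulg1.
Qed.

Lemma tip_sum_power i : G (epsilon ^+ i) /\ tip_sum (epsilon ^+ i) = i%:Z%R.
Proof.
elim: i => [|i [Gi IH]]; first by rewrite expg0; split; [exact: airplane_group1|exact: tip_sum1].
rewrite expgS; split; first exact: airplane_groupM epsilon_group Gi.
by rewrite tip_sumM ?IH ?tip_sum_epsilon ?intS //; exact: epsilon_group.
Qed.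

Theorem corollary6p5 :
  exists eps : homeo airplane,
    [/\ is_epsilon eps,
        forall f : homeo airplane, is_epsilon f -> f = eps,
        airplane_group eps &
        internal_sdprod airplane_group (commutator_subgroup airplane_group)
          (cyclic_subgroup eps)].
Proof.
exists epsilon; split.
- exact: epsilon_is_epsilon.
- exact: is_epsilon_uniq.
- exact: epsilon_group.
have sG := airplane_subgroup.
have sD := commutator_sub sG; have sC := cyclic_sub sG epsilon_group.
split.
- by split; [exact: sG|exact: generated_subgroup|exact: generated_subgroup].
- by split.
- by move=> n g hn Gg; exact: commutator_normal.
- apply/seteqP; split=> [f [/commutator_tip_sum[Gf f0] /cyclic_powers[i [j fE]]]|_ ->].
    have [[Gi Di] [Gj Dj]] := (tip_sum_power i, tip_sum_power j).
    move: f0; rewrite fE tip_sumM //; last exact: airplane_groupV.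
    rewrite tip_sumV // Di Dj => /eqP; rewrite subr_eq0 => /eqP[->].
    exact: mulgV.
  by split; exact: (subgroup1 (generated_subgroup _)).
- apply/seteqP; split=> [f hf|f Gf]; last exact: mod_epsilon_full.
  exact: extension_sub sG epsilon_group f hf.
Qed.
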